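(* Let $\pi$ be a finite-dimensional irreducible unitary representation of $G$ of dimension $d_\pi$. Assume that $\phi\in C^1(X,G)$ and that $T_\phi$ is uniquely ergodic. Then, $$\lim_{N\to\infty}\left\|\frac1N\sum_{n=0}^{N-1}W_{\pi\circ\phi}^nM_{\pi\circ\phi}-(d\pi)_{e_G}(M_{\phi,\star})\right\|_{L^\infty(X,\mathscr B(\mathbb C^{d_\pi}))}=0,$$ with $$M_{\phi,\star}:=\int_{X\times G}d(\mu_X\otimes\mu_G)(x,g)\,\mathrm{Ad}_gM_\phi(x)=P_{\mathrm{Ad}}\left(\int_Xd\mu_X(x)\,M_\phi(x)\right).$$ Furthermore, $P_\phi M_\phi=M_{\phi,\star}$ $\mu_X$-almost everywhere.
   Context: $X$ is a smooth compact second countable Hausdorff manifold with Borel probability measure $\mu_X$, and $\{F_t\}_{t\in\mathbb R}$ is a $C^1$ flow on $X$ preserving $\mu_X$, with continuous vector field $Y$; $\mathcal L_Yf(x)=\frac{d}{dt}|_{t=0}f(F_t(x))$. $G$ is a compact Lie group with normalised Haar measure $\mu_G$, identity $e_G$ and Lie algebra $\mathfrak g$, endowed with an $\mathrm{Ad}$-invariant scalar product $\langle\cdot,\cdot\rangle_{\mathfrak g}$, where $\mathrm{Ad}_gZ=gZg^{-1}$. $T_\phi:X\times G\to X\times G$, $T_\phi(x,g)=(F_1(x),g\phi(x))$; ''$T_\phi$ uniquely ergodic'' means that $\mu_X\otimes\mu_G$ is the only $T_\phi$-invariant Borel probability measure. $M_\phi:=\mathcal L_Y\phi\cdot\phi^{-1}:X\to\mathfrak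 g$ (right translation to $T_{e_G}G\simeq\mathfrak g$). $L^2(X,\mathfrak g)$ is the Hilbert space of measurable functions $X\to\mathfrak g$ with scalar product $\int_Xd\mu_X\langle f_1,f_2\rangle_{\mathfrak g}$; $W_\phi$ is the unitary operator in it given by $(W_\phi f)(x)=\mathrm{Ad}_{\phi(x)}f(F_1(x))$; $P_\phi$ is the orthogonal projection onto $\ker(1-W_\phi)$. $P_{\mathrm{Ad}}$ is the operator on $\mathfrak g$ given by $P_{\mathrm{Ad}}(Z)=\int_Gd\mu_G(g)\,\mathrm{Ad}_gZ$. $\pi:G\to\mathrm U(d_\pi)$ takes values in unitary matrices; $\mathfrak g_\pi$ is the Lie algebra of $\pi(G)$; $(d\pi)_{e_G}:\mathfrak g\to\mathfrak g_\pi$ is the differential of $\pi$ at $e_G$; $M_{\pi\circ\phi}:=\mathcal L_Y(\pi\circ\phi)\cdot(\pi\circ\phi)^{-1}$; $(W_{\pi\circ\phi}^nf)(x)=\pi(\phi^{(n)}(x))f(F_n(x))\pi(\phi^{(n)}(x))^{-1}$ for $f:X\to\mathfrak g_\pi$, with $\phi^{(0)}=e_G$ and $\phi^{(n)}(x)=\phi(x)\phi(F_1(x))\cdots\phi(F_{n-1}(x))$ for $n\ge1$. $\mathscr B(\mathbb C^{d_\pi})$ is the space of $d_\pi\times d_\pi$ complex matrices with operator norm. *)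

(* Defs.v *)
From HB Require Import structures.
From mathcomp Require Import all_boot all_order all_algebra.
From mathcomp Require Import all_classical all_reals all_analysis.
From mathcomp Require Import ess_sup_inf complex.

Set Implicit Arguments.
Unset Strict Implicit.
Unset Printing Implicit Defensive.

Import Order.TTheory GRing.Theory Num.Theory.
Import numFieldNormedType.Exports.

Local Open Scope classical_set_scope.
Local Open Scope ring_scope.

(** * C^k functions and smooth manifolds *)

(* Only meaningful for [U] open: derivatives are taken in the whole space. *)
Fixpoint Ck_on (R : realType) (n m k : nat) (U : set 'rV[R]_n)
    (f : 'rV[R]_n -> 'rV[R]_m) {struct k} : Prop :=
  match k with
  | 0 => forall x, U x -> {for x, continuous f}
  | k'.+1 => (forall x, U x -> differentiable f x) /\
             forall v, Ck_on k' U ('D_v f)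
  end.

(* [chart_inv c] is only relevant on the image of [chart_dom c]. *)
Record chart (R : realType) (X : topologicalType) (n : nat) := Chart {
  chart_dom : set X ;
  chart_fun :> X -> 'rV[R]_n ;
  chart_inv : 'rV[R]_n -> X }.

Definition is_chart (R : realType) (X : topologicalType) (n : nat)
    (c : chart R X n) : Prop :=
  [/\ open (chart_dom c),
      open (c @` chart_dom c),
      forall x, chart_dom c x -> chart_inv c (c x) = x,
      {within chart_dom c, continuous c} &
      {within c @` chart_dom c, continuous (chart_inv c)}].

Definition is_smooth_atlas (R : realType) (X : topologicalType) (n : nat)
    (A : set (chart R X n)) : Prop :=
  [/\ forall c, A c -> is_chart c,
      forall x, exists2 c, A c & chart_dom c x &
      forall c c', A c -> A c' -> forall k,
        Ck_on k (c @` (chart_dom c `&` chart_dom c')) (c' \o chart_inv c)].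

(* Smooth manifold without boundary, of dimension [n]. The tangent space at
   [x] is represented by 'rV[R]_n, a tangent vector being given by its
   coordinates in the preferred chart [chart_at x]. *)
Record smooth_manifold (R : realType) (X : topologicalType) (n : nat) :=
  SmoothManifold {
  atlas : set (chart R X n) ;
  chart_at : X -> chart R X n ;
  atlas_smooth : is_smooth_atlas atlas ;
  chart_at_atlas : forall x, atlas (chart_at x) ;
  chart_at_dom : forall x, chart_dom (chart_at x) x ;
  manifold_hausdorff : hausdorff_space X ;
  manifold_second_countable : @second_countable X }.

Definition line_atlas (R : realType) : set (chart R R 1) :=
  [set Chart setT (fun t : R => const_mx t) (fun u => u 0 0)].

Definition prod_chart (R : realType) (X Y : topologicalType) (n m : nat)
    (a : chart R X n) (b : chart R Y m) : chart R (X * Y)%type (n + m) :=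
  Chart (chart_dom a `*` chart_dom b)
    (fun p => row_mx (a p.1) (b p.2))
    (fun w => (chart_inv a (lsubmx w), chart_inv b (rsubmx w))).

Definition prod_atlas (R : realType) (X Y : topologicalType) (n m : nat)
    (A : set (chart R X n)) (B : set (chart R Y m)) :
    set (chart R (X * Y)%type (n + m)) :=
  [set c | exists a b, [/\ A a, B b & c = prod_chart a b]].

Definition Ck_map (R : realType) (X Y : topologicalType) (n m k : nat)
    (A : set (chart R X n)) (B : set (chart R Y m)) (f : X -> Y) : Prop :=
  continuous f /\
  forall a b, A a -> B b ->
    Ck_on k (a @` (chart_dom a `&` f @^-1` chart_dom b))
      (b \o f \o chart_inv a).

(* The differential of [f] at [p], from the tangent space at [p] to the
   tangent space at [f p]. *)
Definition tangent_map (R : realType) (X Y : topologicalType) (n m : nat)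
    (MX : smooth_manifold R X n) (MY : smooth_manifold R Y m)
    (f : X -> Y) (p : X) : 'rV[R]_n -> 'rV[R]_m :=
  'd (chart_at MY (f p) \o f \o chart_inv (chart_at MX p)) (chart_at MX p p).

(* The velocity at time 0 of a curve, in the tangent space at [c 0]. *)
Definition velocity (R : realType) (X : topologicalType) (n : nat)
    (MX : smooth_manifold R X n) (c : R -> X) : 'rV[R]_n :=
  derive1 (fun t => chart_at MX (c 0) (c t)) 0.

(** * Lie groups *)

(* A carrier with a group law and a topology; their compatibility is part of
   [lie_group]. *)
#[short(type="ptopologicalGroupType")]
HB.structure Definition PointedTopologicalGroup :=
  {G of Group G & PointedTopological G}.

Definition lie_group (R : realType) (G : ptopologicalGroupType) (m : nat)
    (MG : smooth_manifold R G m) : Prop :=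
  forall k,
    Ck_map k (prod_atlas (atlas MG) (atlas MG)) (atlas MG)
      (fun p : G * G => (p.1 * p.2)%g) /\
    Ck_map k (atlas MG) (atlas MG) (fun g : G => (g^-1)%g).

(* The Lie algebra is the tangent space at the identity, i.e. 'rV[R]_m read in
   [chart_at MG 1]. *)
Definition Ad (R : realType) (G : ptopologicalGroupType) (m : nat)
    (MG : smooth_manifold R G m) (g : G) : 'rV[R]_m -> 'rV[R]_m :=
  tangent_map MG MG (fun h : G => (g * h * g^-1)%g) 1%g.

Definition Ad_invariant_scalar_product (R : realType)
    (G : ptopologicalGroupType) (m : nat) (MG : smooth_manifold R G m)
    (dot : 'rV[R]_m -> 'rV[R]_m -> R) : Prop :=
  [/\ forall u v, dot u v = dot v u,
      forall a u v w, dot (a *: u + v) w = a * dot u w + dot v w,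
      forall u, u != 0 -> 0 < dot u u &
      forall g u v, dot (Ad MG g u) (Ad MG g v) = dot u v].

(** * Borel measures and ergodicity *)

(* [X] with its Borel sigma-algebra. For second countable [X] and [Y], the
   product sigma-algebra of [borel X * borel Y] is that of the Borel sets of
   the product space. *)
Notation borel X := (g_sigma_algebraType (@open X)).

Definition invariant_measure d (T : measurableType d) (R : realType)
    (mu : {measure set T -> \bar R}) (f : T -> T) : Prop :=
  forall A, measurable A -> mu (f @^-1` A) = mu A.

Definition uniquely_ergodic d (T : measurableType d) (R : realType)
    (mu : {measure set T -> \bar R}) (f : T -> T) : Prop :=
  invariant_measure mu f /\
  forall nu : probability T R, invariant_measure nu f ->
    forall A, measurable A -> nu A = mu A.

Definition normalised_haar (R : realType) (G : ptopologicalGroupType)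
    (mu : probability (borel G) R) : Prop :=
  forall g : G, invariant_measure mu (fun h : G => (g * h)%g).

(* Integral of a vector-valued function, coordinate by coordinate. *)
Definition vintegral d (T : measurableType d) (R : realType) (m : nat)
    (mu : {measure set T -> \bar R}) (f : T -> 'rV[R]_m) : 'rV[R]_m :=
  \row_j Rintegral mu setT (fun x => f x 0 j).

(** * The Hilbert space of square-integrable vector-valued functions *)

Section square_integrable.
Context d (T : measurableType d) (R : realType) (m : nat).
Context (mu : {measure set T -> \bar R}) (dot : 'rV[R]_m -> 'rV[R]_m -> R).
Implicit Types f p k : T -> 'rV[R]_m.

(* Elements are functions, not classes modulo almost everywhere equality. *)
Definition L2 : set (T -> 'rV[R]_m) :=
  [set f : T -> 'rV[R]_m | (forall j, measurable_fun setT (fun x => f x 0 j)) /\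
           mu.-integrable setT (fun x => (dot (f x) (f x))%:E)].

Definition L2_dot f1 f2 : R := Rintegral mu setT (fun x => dot (f1 x) (f2 x)).

Definition is_orth_proj (K : set (T -> 'rV[R]_m)) f p : Prop :=
  K p /\ forall k, K k -> L2_dot (fun x => f x - p x) k = 0.

(* For [K] a closed subspace of L2 and [f] in L2, such a [p] exists, and it is
   unique up to almost everywhere equality: [get] picks a representative. *)
Definition orth_proj (K : set (T -> 'rV[R]_m)) f : T -> 'rV[R]_m :=
  get (is_orth_proj K f).

End square_integrable.

(** * Flows and skew products *)

Definition C1_flow (R : realType) (X : topologicalType) (n : nat)
    (MX : smooth_manifold R X n) (F : R -> X -> X) : Prop :=
  [/\ forall x, F 0 x = x,
      forall s t x, F (s + t) x = F s (F t x) &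
      Ck_map 1 (prod_atlas (@line_atlas R) (atlas MX)) (atlas MX)
        (fun p : R * X => F p.1 p.2)].

Section skew_product.
Context (R : realType) (X : ptopologicalType) (G : ptopologicalGroupType).
Context (m : nat) (MG : smooth_manifold R G m).
Context (muX : probability (borel X) R) (muG : probability (borel G) R).
Context (dot : 'rV[R]_m -> 'rV[R]_m -> R).
Context (F : R -> X -> X) (phi : X -> G).

Definition skew_product (p : borel X * borel G) : borel X * borel G :=
  (F 1 p.1, (p.2 * phi p.1 : G)%g).

Definition lie_derivative (x : X) : 'rV[R]_m :=
  velocity MG (fun t => phi (F t x)).

(* [lie_derivative x] lies in the tangent space at [phi x]; right translation
   takes it to the Lie algebra. *)
Definition M_phi (x : borel X) : 'rV[R]_m :=
  tangent_map MG MG (fun h : G => (h * (phi x)^-1)%g) (phi x)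
    (lie_derivative x).

Definition W_phi (f : borel X -> 'rV[R]_m) (x : borel X) : 'rV[R]_m :=
  Ad MG (phi x) (f (F 1 x)).

Definition ker_1_sub_W : set (borel X -> 'rV[R]_m) :=
  [set f : borel X -> 'rV[R]_m | L2 muX dot f /\ {ae muX, forall x, W_phi f x = f x}].

Definition P_phi (f : borel X -> 'rV[R]_m) : borel X -> 'rV[R]_m :=
  orth_proj muX dot ker_1_sub_W f.

Definition P_Ad (Z : 'rV[R]_m) : 'rV[R]_m :=
  vintegral muG (fun g => Ad MG g Z).

Definition M_star : 'rV[R]_m :=
  vintegral (muX \x muG)%E (fun p => Ad MG p.2 (M_phi p.1)).

Fixpoint cocycle (n : nat) (x : X) : G :=
  if n is n'.+1 then (cocycle n' x * phi (F n'%:R x))%g else 1%g.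

End skew_product.

(** * Unitary representations *)

Section complex_matrices.
Context (R : realType) (d : nat).
Implicit Type A : 'M[R[i]]_d.

Definition euclidean_norm (v : 'cV[R[i]]_d) : R :=
  Num.sqrt (\sum_i (complex.Re (v i 0) ^+ 2 + complex.Im (v i 0) ^+ 2)).

Definition operator_norm A : R :=
  sup [set euclidean_norm (A *m v) | v in [set v | euclidean_norm v <= 1]].

Definition Linf_norm dT (T : measurableType dT)
    (mu : {measure set T -> \bar R}) (f : T -> 'M[R[i]]_d) : \bar R :=
  ess_sup mu (fun x => (operator_norm (f x))%:E).

Definition mx_derive1 (c : R -> 'M[R[i]]_d) (t : R) : 'M[R[i]]_d :=
  \matrix_(i, j) Complex (derive1 (fun s => complex.Re (c s i j)) t)
                         (derive1 (fun s => complex.Im (c s i j)) t).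

End complex_matrices.

Section representations.
Context (R : realType) (G : ptopologicalGroupType) (d : nat).
Context (rho : G -> 'M[R[i]]_d).

Definition unitary_representation : Prop :=
  [/\ rho 1%g = 1%:M,
      forall g h, rho (g * h)%g = rho g *m rho h,
      forall g, rho g \is unitarymx &
      forall i j, continuous (fun g : G => complex.Re (rho g i j) : R) /\
                  continuous (fun g : G => complex.Im (rho g i j) : R)].

Definition irreducible : Prop :=
  (0 < d)%N /\
  forall V : {vspace 'cV[R[i]]_d},
    (forall g v, v \in V -> rho g *m v \in V) -> V = 0%VS \/ V = fullv.

Definition rep_differential (m : nat) (MG : smooth_manifold R G m)
    (Z : 'rV[R]_m) : 'M[R[i]]_d :=
  let c := chart_at MG 1%g in
  \matrix_(i, j)
    Complex ('d (fun u => complex.Re (rho (chart_inv c u) i j) : R) (c 1%g) Z)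
            ('d (fun u => complex.Im (rho (chart_inv c u) i j) : R) (c 1%g) Z).

Context (X : ptopologicalType) (F : R -> X -> X) (phi : X -> G).

Definition M_rep (x : borel X) : 'M[R[i]]_d :=
  mx_derive1 (fun t => rho (phi (F t x))) 0 *m invmx (rho (phi x)).

Definition W_rep (n : nat) (f : borel X -> 'M[R[i]]_d) (x : borel X) :
    'M[R[i]]_d :=
  rho (cocycle F phi n x) *m f (F n%:R x) *m invmx (rho (cocycle F phi n x)).

End representations.

(* Main.v *)
Require Import Defs.
From HB Require Import structures.
From mathcomp Require Import all_boot all_order all_algebra.
From mathcomp Require Import all_classical all_reals all_analysis.
From mathcomp Require Import ess_sup_inf complex measurable_realfun.
From mathcomp Require Import ring lra.

(** Put Psi(x, g) = Ad g (M_phi x). This is a continuous function on the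
    compact space X * G, the orbit of (x, 1) under the skew product is
    (F k x, cocycle k x), and the integral of Psi is M_star. So the averages of
    Ad (cocycle k x) (M_phi (F k x)) over 0 <= k < N are the Birkhoff averages
    of Psi at the points (x, 1).

    Unique ergodicity makes Birkhoff averages of continuous functions converge
    uniformly ([birkhoff_uniform]). Otherwise there are arbitrarily long orbit
    segments on which the average stays away from the integral. The frequencies
    of visits along these segments converge along an ultrafilter to an invariant
    finitely additive probability m on all subsets. To obtain a Borel measure,
    points are coded by sequences of bits, which record the sets of a countable
    basis that contain them: on cylinders of the Cantor space finite additivity
    implies sigma-additivity. The measure that results dominates m on closed
    sets ([fin_additive_closed_measure]), which suffices for its invariance
    ([closed_measure_invariant]) and for its integral to contradict uniqueness
    ([birkhoff_invariant_measure]).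

    For the averages of M_rep, the differential of rho is linear,
    maps M_phi to M_rep ([M_repE]) and turns Ad g into conjugation by rho g
    ([rep_differential_Ad]); the first claim is the image of the uniform
    convergence under this bounded map. These formulas need rho to be
    differentiable, whereas it is only assumed to be continuous: rho is
    recovered from its integral against a C1 bump function near the identity,
    into which the variable can be moved by invariance of Haar measure
    ([representation_differentiable]). Continuity of Psi comes from continuity
    of partial derivatives with respect to a parameter in a manifold
    ([partial_derive]).

    The formula for M_star is Fubini's theorem and linearity of Ad g. By
    invariance of Haar measure it shows that Ad fixes M_star, which is therefore
    a constant in the kernel of 1 - W. If k lies in this kernel, invariance of
    the measure and of the scalar product show that M_phi and all its averages
    have the same scalar product with k; as the averages converge to M_star, so
    does M_star. Hence M_star is the orthogonal projection of M_phi
    ([is_orth_proj_M_star]). *)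

Set Implicit Arguments.
Unset Strict Implicit.
Unset Printing Implicit Defensive.

Import Order.TTheory GRing.Theory Num.Theory.
Import numFieldNormedType.Exports.

Local Open Scope classical_set_scope.
Local Open Scope ring_scope.

(** * Finitely additive probabilities on the Cantor space *)

Lemma second_countable_seq (T : topologicalType) : @second_countable T ->
  exists B : nat -> set T, (forall i, open (B i)) /\
    forall x A, nbhs x A -> exists2 i, B i x & B i `<=` A.
Proof.
move=> [BB /countable_injP [f finj] [Bo Bx]].
exists (fun i => \bigcup_(U in [set U | BB U /\ f U = i]) U); split.
  by move=> i; apply: bigcup_open => U [/Bo].
move=> x A /(Bx x) [U [BU Ux] UA]; exists (f U); first by exists U.
move=> y [V [BV fV] Vy]; apply: UA.
by rewrite -(finj _ _ _ _ fV) // inE.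
Qed.

(** A name of its own for the sequences of bits, so that they carry the
    algebra of cylinders. *)
Definition coding := nat -> bool.
HB.instance Definition _ := Pointed.on coding.

Definition cylinder (A : set coding) : Prop :=
  exists n, forall c c', (forall i, (i < n)%N -> c i = c' i) -> A c -> A c'.

Lemma cylinder0 : cylinder set0. Proof. by exists 0%N. Qed.

Lemma cylinderC : setC_closed cylinder.
Proof.
move=> A [n An]; exists n => c c' cc' NA A'; apply: NA.
by apply: (An c') => // i /cc'.
Qed.

Lemma cylinderU : setU_closed cylinder.
Proof.
move=> A B [n An] [p Bp]; exists (maxn n p) => c c' cc' [Ac|Bc].
  by left; apply: (An c) => // i ni; apply: cc'; rewrite leq_max ni.
by right; apply: (Bp c) => // i ni; apply: cc'; rewrite leq_max ni orbT.
Qed.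

Fact coding_display : measure_display. Proof. by []. Qed.
HB.instance Definition _ := isAlgebraOfSets.Build coding_display coding
  cylinder0 cylinderU cylinderC.

Lemma nbhs_prefix (c : cantor_space) n :
  nbhs c [set c' : cantor_space | forall i, (i < n)%N -> c' i = c i].
Proof.
elim: n => [|n IHn]; first by apply: filterS filterT.
have : nbhs c [set c' : cantor_space | c' n = c n].
  have := @proj_continuous nat (fun=> bool) n c [set c n].
  by apply; rewrite /nbhs /=.
apply: filterS2 IHn => c' cc' cn i; rewrite ltnS leq_eqVlt => /orP[/eqP->//|].
exact: cc'.
Qed.

(** A cylinder depends on finitely many bits, so it is clopen, and by
    compactness of the Cantor space a countable cover of a cylinder by
    cylinders is finite from some point on. A finitely additive set function
    is therefore automatically sigma-additive on cylinders. *)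
Lemma cylinder_cover (A : set coding) (F : (set coding)^nat) :
  cylinder A -> (forall k, cylinder (F k)) -> A `<=` \bigcup_k F k ->
  \forall n \near \oo, A `<=` \bigcup_(k < n) F k.
Proof.
move=> [n An] Fc AF.
have /compact_near_coveringP := cantor_space_compact.
move=> /(_ nat \oo (fun n c => A c -> (\bigcup_(k < n) F k) c) _).
case.
  move=> c _; have [Ac|NAc] := pselect (A c).
    have [k _ Fkc] := AF _ Ac; have [p Fp] := Fc k.
    exists ([set c' : cantor_space | forall i, (i < p)%N -> c' i = c i],
            [set n | (k < n)%N]).
      by split => /=; [exact: nbhs_prefix | exists k.+1].
    move=> [c' q] [/= cc' kq] _; exists k => //.
    by apply: (Fp c) => // i /cc'.
  exists ([set c' : cantor_space | forall i, (i < n)%N -> c' i = c i], setT).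
    by split => /=; [exact: nbhs_prefix | exact: filterT].
  move=> [c' q] [/= cc' _] Ac'; case: NAc.
  exact: (An c').
move=> N _ NP; exists N => // k /NP h c Ac; exact: h.
Qed.

Section fin_additive.
Context (R : realType).

(** Defined on all subsets, because its intended instances are ultralimits of
    empirical measures. *)
Definition fin_additive_prob (T : Type) (m : set T -> R) : Prop :=
  [/\ forall A, 0 <= m A, m setT = 1 &
      forall A B, A `&` B = set0 -> m (A `|` B) = m A + m B].

Context (T : Type) (m : set T -> R) (hm : fin_additive_prob m).

Lemma fin_additive_le A B : A `<=` B -> m A <= m B.
Proof.
move=> AB; have [m0 _ mU] := hm.
rewrite -(setDUK AB).
by rewrite mU ?lerDl// setDE setICA setICr setI0.
Qed.

Lemma fin_additive0 : m set0 = 0.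
Proof.
have [_ _ mU] := hm; have := mU set0 set0 (setI0 _).
by rewrite setU0 => /eqP; rewrite -subr_eq0 opprD addrA subrr sub0r oppr_eq0 => /eqP.
Qed.

Lemma fin_additive_bigcup (F : (set T)^nat) n : trivIset setT F ->
  m (\bigcup_(k < n) F k) = \sum_(0 <= k < n) m (F k).
Proof.
move=> tF; have [_ _ mU] := hm; elim: n => [|n IHn].
  by rewrite big_nil bigcup_mkord big_ord0 fin_additive0.
rewrite big_nat_recr//= -IHn !bigcup_mkord big_ord_recr/= mU//.
rewrite -bigcup_mkord; apply/seteqP; split => // x [[k /= kn Fk Fn]].
have := (trivIsetP.1 tF) k n I I.
by rewrite neq_ltn kn => /(_ isT); rewrite -subset0 => /(_ x); apply.
Qed.

End fin_additive.

Section cylinder_measure.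
Context (R : realType) (m : set coding -> R) (hm : fin_additive_prob m).

(** The proof is an argument so that the measure structure can be inferred
    from the term. *)
Definition cylinder_measure (_ : fin_additive_prob m) (A : set coding) : \bar R :=
  (m A)%:E.
Local Notation mu := (cylinder_measure hm).

Let mu0 : mu set0 = 0%E.
Proof. by rewrite /cylinder_measure (fin_additive0 hm). Qed.

Let mu_ge0 A : (0 <= mu A)%E.
Proof. by rewrite lee_fin; case: hm. Qed.

Let mu_sigma : semi_sigma_additive mu.
Proof.
move=> F mF tF mUF; rewrite /cylinder_measure.
have [N _ FN] := cylinder_cover mUF mF (@subset_refl _ _).
apply: cvg_near_cst; exists N => // n Nn /=.
rewrite sumEFin -(fin_additive_bigcup hm)//; congr (m _)%:E.
apply/seteqP; split; last exact: FN.
by move=> x [k _ Fk]; exists k.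
Qed.

HB.instance Definition _ := isMeasure.Build _ _ _ mu mu0 mu_ge0 mu_sigma.

End cylinder_measure.

Lemma cylinder_extension (R : realType) (m : set coding -> R) :
  fin_additive_prob m ->
  exists nu : probability (g_sigma_algebraType cylinder) R,
    forall A, cylinder A -> nu A = (m A)%:E.
Proof.
move=> hm.
pose mu : {measure set coding -> \bar R} := cylinder_measure hm.
have muE A : cylinder A -> measure_extension mu A = (m A)%:E.
  by move=> cA; rewrite /measure_extension measurable_mu_extE.
have mu1 : measure_extension mu setT = 1%E.
  by have [_ m1 _] := hm; rewrite muE ?m1//; exists 0%N.
pose P := @Measure_isProbability.Build _ _ R (measure_extension mu) mu1.
pose nu : probability _ R := HB.pack (measure_extension mu) P.
by exists nu; exact: muE.
Qed.

(** * From finitely additive probabilities to Borel measures *)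

Section decoding.
Context (K : ptopologicalType) (B : nat -> set K).
Hypotheses (cK : compact [set: K]) (hK : hausdorff_space K).
Hypotheses (oB : forall i, open (B i)).
Hypotheses (bB : forall x A, nbhs x A -> exists2 i, B i x & B i `<=` A).

Definition encode (p : K) : coding := fun i => `[< B i p >].

(** The closure makes compatibility of a point with a sequence of bits a
    closed condition on the point, which compactness arguments need. A point
    is compatible with its own code, but possibly with other sequences too. *)
Definition cell (c : coding) (i : nat) : set K :=
  if c i then closure (B i) else ~` B i.

Definition decode (c : coding) : K := get [set p | forall i, cell c i p].

Definition hit (E : set K) (n : nat) : set coding :=
  [set c | exists2 p, E p & forall i, (i < n)%N -> cell c i p].

Lemma closed_cell c i : closed (cell c i).
Proof.
rewrite /cell; case: ifP => _; first exact: closed_closure.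
exact: open_closedC.
Qed.

Lemma cell_encode p i : cell (encode p) i p.
Proof.
by rewrite /cell /encode; case: asboolP => // Bp; exact: subset_closure.
Qed.

(** Two distinct points have disjoint open neighbourhoods; a basic set inside
    the first one has a closure that misses the other point. *)
Lemma cell_inj c p q :
  (forall i, cell c i p) -> (forall i, cell c i q) -> p = q.
Proof.
move=> cp cq; apply: contrapT => /eqP pq.
move: hK; rewrite open_hausdorff => /(_ _ _ pq)[[U V] /= [Up Vq] [oU oV UV]].
have pU : nbhs p U by apply: open_nbhs_nbhs; split => //; rewrite inE in Up.
have [i Bp BU] := bB pU.
have := cp i; have := cq i; rewrite /cell; case: ifP => // _ + _.
have qV : nbhs q V by apply: open_nbhs_nbhs; split => //; rewrite inE in Vq.
move=> /(_ V qV) [x [/BU Ux Vx]].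
by move/eqP: UV; rewrite -subset0 => /(_ x); apply.
Qed.

Lemma decodeE c p : (forall i, cell c i p) -> decode c = p.
Proof.
move=> cp; apply: (@cell_inj c) => //.
exact: (@getPex _ [set p | forall i, cell c i p]) (ex_intro _ p cp).
Qed.

Lemma cylinder_hit E n : cylinder (hit E n).
Proof.
exists n => c c' cc' [p Ep cp]; exists p => // i ni.
by rewrite /cell -cc' //; exact: cp.
Qed.

(** If every point of E violated one of the conditions, it would do so on a
    neighbourhood, and by compactness a finite prefix of c would already
    exclude all of E. *)
Lemma hit_cap E c : closed E -> (\bigcap_n hit E n) c ->
  exists2 p, E p & forall i, cell c i p.
Proof.
move=> cE Ec; apply: contrapT => nE.
have kE : compact E.
  by rewrite -[E]setTI; exact: compact_closedI.
move/compact_near_coveringP: kE.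
move=> /(_ nat \oo (fun n p => exists2 i, (i < n)%N & ~ cell c i p) _) [].
  move=> p Ep.
  have [i ci] : exists i, ~ cell c i p.
    by apply/existsNP => cp; apply: nE; exists p.
  exists (~` cell c i, [set n | (i < n)%N]).
    split => /=; last by exists i.+1.
    by apply: open_nbhs_nbhs; split => //; exact/closed_openC/closed_cell.
  by move=> [q n] [/= cq ni]; exists i.
move=> N _ /(_ N (leqnn _)) NE; have [p Ep cp] := Ec N I.
have [i iN] := NE _ Ep; apply; exact: cp.
Qed.

Lemma decode_closed E : closed E -> \bigcap_n hit E n `<=` decode @^-1` E.
Proof. by move=> cE c /(hit_cap cE)[p Ep /decodeE]; rewrite /preimage /= => ->. Qed.

(** The sequences compatible with a point of a closed set E form a countable
    intersection of cylinders. *)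
Lemma measurable_decode :
  @measurable_fun _ _ (g_sigma_algebraType cylinder) (borel K) setT decode.
Proof.
have mhit E : @measurable _ (g_sigma_algebraType cylinder) (\bigcap_n hit E n).
  apply: bigcapT_measurable => n; apply: sub_sigma_algebra.
  exact: cylinder_hit.
have mE (E : set K) : closed E ->
    @measurable _ (g_sigma_algebraType cylinder) (decode @^-1` E).
  move=> cE; pose D := \bigcap_n hit setT n.
  (* The sequences compatible with no point at all are sent by decode to the
     default point of K, whence the second set when that point lies in E. *)
  have -> : decode @^-1` E = (\bigcap_n hit E n) `|`
      (if pselect (E point) is left _ then ~` D else set0).
    apply/seteqP; split => c.
      move=> Ec; have [Dc|NDc] := pselect (D c).
        left=> n _; have [p _ cp] := hit_cap closedT Dc.
        by exists p => //; rewrite -(decodeE cp).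
      right; case: pselect => // -[]; move: Ec; rewrite /preimage/= /decode.
      rewrite getPN // => p cp; apply: NDc => n _; exists p => //.
    move=> [/decode_closed|]; first exact.
    case: pselect => // Ept NDc; rewrite /preimage/= /decode getPN // => p cp.
    by apply: NDc => n _; exists p.
  apply: measurableU; first exact: mhit.
  by case: pselect => // _; apply: measurableC; exact: mhit.
apply: (@measurability _ _ _ (borel K) _ _ (@open K)) => //.
move=> _ [U oU <-]; rewrite setTI -[U]setCK preimage_setC.
by apply: measurableC; exact: (mE (~` U) (open_closedC oU)).
Qed.

End decoding.

Lemma pushforward_probability d d' (T : measurableType d) (U : measurableType d')
    (R : realType) (P : probability T R) (f : T -> U) :
  measurable_fun setT f ->
  exists nu : probability U R, forall A, measurable A -> nu A = P (f @^-1` A).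
Proof.
move=> mf; pose fM := isMeasurableFun.Build _ _ _ _ f mf.
pose X : {mfun T >-> U} := HB.pack f fM.
by exists (distribution P X).
Qed.

(** Transport m to the Cantor space along encode, extend it from cylinders to
    a probability, and push that forward along decode. For E closed the
    cylinders hit E n decrease to a set that decode maps into E, and each of
    them has mass at least m E because it contains the codes of the points of
    E. The converse inequality fails in general: mass of m close to E but
    outside of it may end up in E. *)
Lemma fin_additive_closed_measure (R : realType) (K : ptopologicalType)
    (m : set K -> R) : compact [set: K] -> hausdorff_space K ->
    @second_countable K -> fin_additive_prob m ->
  exists nu : probability (borel K) R,
    forall E : set K, closed E -> ((m E)%:E <= nu E)%E.
Proof.
move=> cK hK /second_countable_seq[B [oB bB]] hm.
pose m' A := m (encode B @^-1` A).
have hm' : fin_additive_prob m'.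
  have [m0 m1 mU] := hm; split; [by move=> A; exact: m0|exact: m1|].
  by move=> A A' AA'; rewrite /m' preimage_setU mU// -preimage_setI AA' preimage_set0.
have [nu' nu'E] := cylinder_extension hm'.
have md := measurable_decode cK hK oB bB.
have [nu nuE] := pushforward_probability nu' md.
exists nu => E cE.
have hitc n : cylinder (hit B E n) by exact: cylinder_hit.
have : (nu' (\bigcap_n hit B E n) <= nu E)%E.
  have mE : measurable (E : set (borel K)).
    by rewrite -[E]setCK; apply: measurableC; apply: sub_sigma_algebra; exact: closed_openC.
  rewrite nuE//; apply: le_measure; rewrite ?inE; last exact: decode_closed.
    by apply: bigcapT_measurable => n; exact: sub_sigma_algebra.
  by rewrite -[X in measurable X]setTI; exact: md.
apply: le_trans.
have /cvg_lim <- // : nu' \o hit B E @ \oo --> nu' (\bigcap_n hit B E n).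
  apply: nonincreasing_cvg_mu => //.
  - by rewrite (le_lt_trans (probability_le1 _ _)) ?ltry//; exact: sub_sigma_algebra.
  - by move=> n; exact: sub_sigma_algebra.
  - by apply: bigcapT_measurable => n; exact: sub_sigma_algebra.
  - apply/nonincreasing_seqP => n; apply/subsetPset => c [p Ep cp]; exists p => // i ni.
    by apply: cp; exact: ltnW.
apply: lime_ge.
  apply: ereal_nonincreasing_is_cvgn; apply/nonincreasing_seqP => n /=.
  apply: le_measure; rewrite ?inE; try exact: sub_sigma_algebra.
  by move=> c [p Ep cp]; exists p => // i ni; apply: cp; exact: ltnW.
apply: nearW => n /=; rewrite nu'E// lee_fin.
apply: (fin_additive_le hm) => p Ep; exists p => // i _; exact: cell_encode.
Qed.

(** * Invariance of the Borel measure *)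

Lemma borel_open (K : ptopologicalType) (A : set K) :
  open A -> measurable (A : set (borel K)).
Proof. exact: sub_sigma_algebra. Qed.

Lemma borel_closed (K : ptopologicalType) (A : set K) :
  closed A -> measurable (A : set (borel K)).
Proof.
by move=> cA; rewrite -[A]setCK; apply: measurableC; exact: (borel_open (closed_openC cA)).
Qed.

(** By regularity every point outside E lies in a basic set whose closure
    misses E. Removing the first n such basic sets from the space gives V n,
    removing their closures gives U n. *)
Lemma closed_sandwich (K : ptopologicalType) (E : set K) :
  compact [set: K] -> hausdorff_space K -> @second_countable K -> closed E ->
  exists U V : nat -> set K,
    [/\ forall n, open (U n), forall n, closed (V n), forall n, U n `<=` V n,
        (forall n, U n.+1 `<=` U n) /\ (forall n, V n.+1 `<=` V n) &
        \bigcap_n U n = E /\ \bigcap_n V n = E].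
Proof.
move=> cK hK /second_countable_seq[B [oB bB]] cE.
pose J n := [set i | (i < n)%N /\ closure (B i) `<=` ~` E].
have JS n : J n `<=` J n.+1 by move=> i [ni Ji]; split => //; exact: leqW.
have finJ n : finite_set (J n).
  by apply: (@sub_finite_set _ _ `I_n) => // i [].
have UV n : ~` (\bigcup_(i in J n) closure (B i)) `<=` ~` \bigcup_(i in J n) B i.
  by apply: subsetC => x [i Ji Bx]; exists i => //; exact: subset_closure.
have EU n : E `<=` ~` \bigcup_(i in J n) closure (B i).
  by move=> x Ex [i [_ Ji] /Ji].
have VE : \bigcap_n (~` \bigcup_(i in J n) B i) `<=` E.
  move=> x Vx; apply: contrapT => NEx.
  have Ex : nbhs x (~` E) by apply: open_nbhs_nbhs; split => //; exact: closed_openC.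
  have [W Wx cW] := @compact_regular K x setT hK cK (@filterT _ _ _) _ Ex.
  have [i Bx BW] := bB _ _ Wx.
  apply: (Vx i.+1 I); exists i => //; split => //.
  exact: subset_trans (closure_subset BW) cW.
exists (fun n => ~` \bigcup_(i in J n) closure (B i)),
       (fun n => ~` \bigcup_(i in J n) B i); split => //.
- move=> n; apply: closed_openC; apply: closed_bigcup => // i _.
  exact: closed_closure.
- by move=> n; apply: open_closedC; apply: bigcup_open => i _.
- by split=> n; apply: subsetC => x [i /JS]; exists i.
- split; apply/seteqP; split.
  + by move=> x Ux; apply: VE => n _; apply: UV; exact: Ux.
  + by move=> x Ex n _; exact: EU.
  + exact: VE.
  + by move=> x Ex n _; apply: UV; exact: EU.
Qed.

Lemma probability_capE (R : realType) (K : ptopologicalType)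
    (nu : probability (borel K) R) (S : nat -> set K) (E : set K) :
  (forall n, measurable (S n : set (borel K))) -> (forall n, S n.+1 `<=` S n) ->
  \bigcap_n S n = E -> fine (nu (S n)) @[n --> \oo] --> fine (nu E).
Proof.
move=> mS S_ SE; have mE : measurable (E : set (borel K)).
  by rewrite -SE; exact: bigcapT_measurable.
apply: fine_cvg; rewrite fineK ?fin_num_measure// -SE.
apply: nonincreasing_cvg_mu => //.
- by rewrite (le_lt_trans (probability_le1 _ _)) ?ltry.
- exact: bigcapT_measurable.
- by apply/nonincreasing_seqP => n; apply/subsetPset.
Qed.

Lemma continuous_closed_preimage (S T : topologicalType) (f : S -> T) (E : set T) :
  continuous f -> closed E -> closed (f @^-1` E).
Proof. by move=> /continuous_closedP cf; exact: cf. Qed.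

Section invariance.
Context (R : realType) (K : ptopologicalType).
Hypotheses (cK : compact [set: K]) (hK : hausdorff_space K)
  (sK : @second_countable K).
Context (m : set K -> R) (hm : fin_additive_prob m)
  (nu : probability (borel K) R).
Hypothesis mnu : forall E : set K, closed E -> ((m E)%:E <= nu E)%E.

Let nu_closed (E : set K) : closed E -> m E <= fine (nu E).
Proof.
move=> cE; have := mnu cE; rewrite -lee_fin fineK// fin_num_measure//.
exact: borel_closed.
Qed.

Let nu_open (U : set K) : open U -> fine (nu U) <= m U.
Proof.
move=> oU; have [_ m1 mU] := hm.
have mUc : m U = 1 - m (~` U).
  apply/eqP; rewrite -subr_eq opprK; apply/eqP.
  by rewrite -m1 -(mU _ _ (setICr U)) setUCr.
have := nu_closed (open_closedC oU).
rewrite mUc probability_setC; last exact: borel_open.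
rewrite fineB ?fin_num_measure//=; last exact: borel_open.
by move: (m _) (fine _) => a b; lra.
Qed.

(** The measure nu dominates m on closed sets, hence is dominated by m on open
    sets: m (U n) is squeezed between nu (U n) and nu (V n). Thus nu is
    determined by m, which is how invariance passes from m to nu. *)
Lemma closed_measure_lim (U V : nat -> set K) (E : set K) :
  (forall n, open (U n)) -> (forall n, closed (V n)) ->
  (forall n, U n `<=` V n) -> (forall n, U n.+1 `<=` U n) ->
  (forall n, V n.+1 `<=` V n) ->
  \bigcap_n U n = E -> \bigcap_n V n = E -> m (U n) @[n --> \oo] --> fine (nu E).
Proof.
move=> oU cV UV U_ V_ UE VE.
apply: (@squeeze_cvgr _ _ _ _ (fun n => fine (nu (U n))) (fun n => fine (nu (V n)))).
- apply: nearW => n; rewrite nu_open//= (le_trans (fin_additive_le hm (UV n)))//.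
  exact: nu_closed.
- by apply: probability_capE => // n; exact: borel_open.
- by apply: probability_capE => // n; exact: borel_closed.
Qed.

(** The preimages of a sandwich of E are a sandwich of the preimage of E, so
    the two measures are limits of the same sequence. *)
Lemma closed_measure_invariant (T : K -> K) : continuous T ->
  (forall A, m (T @^-1` A) = m A) ->
  forall E : set K, closed E -> nu (T @^-1` E) = nu E.
Proof.
move=> cT mT E cE.
have [U [V [oU cV UV [U_ V_] [UE VE]]]] := closed_sandwich cK hK sK cE.
have c1 := closed_measure_lim oU cV UV U_ V_ UE VE.
have c2 : m (T @^-1` U n) @[n --> \oo] --> fine (nu (T @^-1` E)).
  apply: (@closed_measure_lim (fun n => T @^-1` U n) (fun n => T @^-1` V n)).
  - by move=> n; have /continuousP := cT; apply.
  - by move=> n; exact: continuous_closed_preimage.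
  - by move=> n x /UV.
  - by move=> n x /U_.
  - by move=> n x /V_.
  - by rewrite -preimage_bigcap UE.
  - by rewrite -preimage_bigcap VE.
rewrite -[LHS]fineK; last first.
  by rewrite fin_num_measure//; exact: (borel_closed (continuous_closed_preimage cT cE)).
rewrite -[RHS]fineK; last by rewrite fin_num_measure//; exact: borel_closed.
have e : (fun n => m (T @^-1` U n)) = (fun n => m (U n)) by apply/funext.
by congr EFin; rewrite e in c2; exact: cvg_unique c2 c1.
Qed.

End invariance.

(** * Birkhoff averages and their ultralimits *)

Lemma ultra_fmap (S T : Type) (f : S -> T) (F : set_system S) :
  UltraFilter F -> UltraFilter (f @ F).
Proof.
move=> FU; split; first exact: fmap_proper_filter.
move=> G GF FG; apply/seteqP; split => // A GA.
have [//|FnA] := in_ultra_setVsetC (f @^-1` A) FU.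
have GnA : G (~` A) by exact: FG.
have GAA : G (A `&` ~` A) by exact: filterI.
by have [x []] := filter_ex GAA.
Qed.

Lemma ultra_bounded_cvg (R : realType) (S : Type) (F : set_system S) (M : R)
    (f : S -> R) : UltraFilter F -> (forall k, `|f k| <= M) -> cvg (f @ F).
Proof.
move=> FU fM; have : compact `[-M, M] by exact: segment_compact.
rewrite compact_ultra => /(_ (f @ F)) [].
- exact: ultra_fmap.
- by apply: nearW => k; rewrite /= in_itv/= -ler_norml.
by move=> l [_ fl]; apply/cvg_ex; exists l.
Qed.

Section birkhoff_average.
Context (R : realType) (K : Type) (T : K -> K).

Definition birkhoff (N : nat) (g : K -> R) (x : K) : R :=
  N%:R^-1 * \sum_(0 <= j < N) g (iter j T x).

Lemma birkhoff_le N g h x : (forall y, g y <= h y) ->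
  birkhoff N g x <= birkhoff N h x.
Proof.
by move=> gh; rewrite ler_wpM2l ?invr_ge0 ?ler0n// ler_sum.
Qed.

Lemma birkhoffD N g h x :
  birkhoff N (fun y => g y + h y) x = birkhoff N g x + birkhoff N h x.
Proof. by rewrite /birkhoff big_split mulrDr. Qed.

Lemma birkhoffZ N a g x : birkhoff N (fun y => a * g y) x = a * birkhoff N g x.
Proof. by rewrite /birkhoff -mulr_sumr mulrCA. Qed.

Lemma birkhoff_sum N n (g : nat -> K -> R) x :
  birkhoff N (fun y => \sum_(0 <= i < n) g i y) x =
  \sum_(0 <= i < n) birkhoff N (g i) x.
Proof. by rewrite /birkhoff exchange_big/= mulr_sumr. Qed.

Lemma birkhoff_cst N a x : (0 < N)%N -> birkhoff N (fun=> a) x = a.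
Proof.
move=> N0; rewrite /birkhoff sumr_const_nat subn0 -[a *+ N]mulr_natl mulrA mulVf.
  by rewrite mul1r.
by rewrite pnatr_eq0 -lt0n.
Qed.

Lemma birkhoff_comp N g x : birkhoff N (g \o T) x - birkhoff N g x =
  N%:R^-1 * (g (iter N T x) - g x).
Proof.
rewrite /birkhoff -mulrBr; congr (_ * _); rewrite -sumrB /=.
by rewrite (telescope_sumr (fun j => g (iter j T x))).
Qed.

Lemma birkhoff_normr N g M x : (forall y, `|g y| <= M) -> `|birkhoff N g x| <= M.
Proof.
move=> gM; have M0 : 0 <= M by exact: le_trans (gM x).
have [->|N0] := posnP N; first by rewrite /birkhoff big_nil mulr0 normr0.
rewrite ler_norml -{1}(birkhoff_cst (- M) x N0) -{2}(birkhoff_cst M x N0).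
by apply/andP; split; apply: birkhoff_le => y; have := gM y; rewrite ler_norml => /andP[].
Qed.

End birkhoff_average.

Section ultralimit.
Context (R : realType) (K : Type) (T : K -> K).
Context (x_ : nat -> K) (N_ : nat -> nat) (hN : forall k, (k < N_ k)%N).
Context (F : set_system nat) (FU : UltraFilter F) (Foo : \oo `<=` F).

(** An ultrafilter, rather than a subsequence, makes the frequencies of visits
    converge for all subsets simultaneously. *)
Definition ultramean (A : set K) : R :=
  lim (birkhoff T (N_ k) (\1_A) (x_ k) @[k --> F]).

Let N0 k : (0 < N_ k)%N. Proof. exact: leq_ltn_trans (hN k). Qed.

Lemma ultramean_cvg A :
  birkhoff T (N_ k) (\1_A) (x_ k) @[k --> F] --> ultramean A.
Proof.
apply: (@ultra_bounded_cvg _ _ _ 1) => k; apply: birkhoff_normr => y.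
by rewrite indicE; case: (_ \in _); rewrite ?normr1 ?normr0.
Qed.

Lemma ultramean_prob : fin_additive_prob ultramean.
Proof.
split.
- move=> A; apply: limr_ge; first by apply/cvg_ex; exists (ultramean A); exact: ultramean_cvg.
  apply: nearW => k; rewrite -(birkhoff_cst T (0 : R) (x_ k) (N0 k)).
  by apply: birkhoff_le => y; rewrite indicE.
- apply: cvg_lim => //; apply: cvg_near_cst; apply: nearW => k.
  by rewrite indicT; apply: birkhoff_cst.
- move=> A B AB; apply: cvg_lim => //.
  under eq_fun => k.
    rewrite (_ : \1_(A `|` B) = fun y => \1_A y + \1_B y :> R); last first.
      apply/funext => y; rewrite !indicE in_setU.
      case: (boolP (y \in A)) => Ay; case: (boolP (y \in B)) => By;
        rewrite /= ?addr0 ?add0r//.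
      by have : (A `&` B) y; [split; exact: set_mem | rewrite AB].
    rewrite birkhoffD; over.
  by apply: cvgD; exact: ultramean_cvg.
Qed.

(** Shifting an orbit segment of length N changes the average of an indicator
    by at most 1 / N, and the lengths tend to infinity. *)
Lemma ultramean_invariant A : ultramean (T @^-1` A) = ultramean A.
Proof.
apply: cvg_lim => //.
have -> : (fun k => birkhoff T (N_ k) (\1_(T @^-1` A)) (x_ k) : R) =
  (fun k => birkhoff T (N_ k) (\1_A) (x_ k) +
    (N_ k)%:R^-1 * (\1_A (iter (N_ k) T (x_ k)) - \1_A (x_ k))).
  by apply/funext => k; rewrite -birkhoff_comp addrC subrK.
rewrite -[ultramean A]addr0; apply: cvgD; first exact: ultramean_cvg.
have h : (k.+1%:R^-1 : R) @[k --> \oo] --> (0 : R) by exact: cvg_harmonic.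
have c : (N_ k)%:R^-1 * (\1_A (iter (N_ k) T (x_ k)) - \1_A (x_ k)) @[k --> \oo]
    --> (0 : R).
  apply: norm_cvg0; apply: (squeeze_cvgr _ (cvg_cst 0) h); apply: nearW => k.
  rewrite normr_ge0/= normrM -[leRHS]mulr1 ler_pM//.
    by rewrite ger0_norm ?invr_ge0// lef_pV2 ?posrE ?ltr0n// ler_nat.
  rewrite !indicE; case: (_ \in _); case: (_ \in _);
  by rewrite ?subrr ?subr0 ?sub0r ?normrN ?normr1 ?normr0.
by move=> B /c /Foo.
Qed.

End ultralimit.

(** * Integration of bounded and continuous functions *)

Section probability_integral.
Context d (S : measurableType d) (R : realType) (P : probability S R).

Lemma bounded_integrable (f : S -> R) (M : R) : measurable_fun setT f ->
  (forall x, `|f x| <= M) -> P.-integrable setT (EFin \o f).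
Proof.
move=> mf fM; apply: measurable_bounded_integrable => //.
  by rewrite (le_lt_trans (probability_le1 _ _)) ?ltry.
exists M; split; first exact: num_real.
by move=> N MN x _; exact: le_trans (fM x) (ltW MN).
Qed.

Lemma integrableDR (f g : S -> R) : P.-integrable setT (EFin \o f) ->
  P.-integrable setT (EFin \o g) ->
  P.-integrable setT (EFin \o (fun x => f x + g x)).
Proof.
move=> fi gi; have := integrableD measurableT fi gi.
by apply: eq_integrable.
Qed.

Lemma Rintegral_sum (I : Type) (s : seq I) (f : I -> S -> R) :
  (forall i, P.-integrable setT (EFin \o f i)) ->
  P.-integrable setT (EFin \o (fun x => \sum_(i <- s) f i x)) /\
  \int[P]_x (\sum_(i <- s) f i x) = \sum_(i <- s) \int[P]_x f i x.
Proof.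
move=> fi; elim: s => [|i s [IHi IHs]].
  under [EFin \o _]eq_fun => x do rewrite big_nil.
  split; first exact: integrable0.
  by under eq_Rintegral => x _ do rewrite big_nil; rewrite Rintegral_cst// mul0r big_nil.
have e : (fun x => \sum_(j <- i :: s) f j x) =
    (fun x => f i x + \sum_(j <- s) f j x).
  by apply/funext => x; rewrite big_cons.
rewrite e RintegralD// big_cons IHs; split => //.
exact: integrableDR.
Qed.

Lemma Rintegral_indic (A : set S) : measurable A ->
  \int[P]_x (\1_A x : R) = fine (P A).
Proof. by move=> mA; rewrite /Rintegral integral_indic// setIT. Qed.

Lemma normr_Rintegral_le (f : S -> R) (M : R) : measurable_fun setT f ->
  (forall x, `|f x| <= M) -> `|\int[P]_x f x| <= M.
Proof.
move=> mf fM; have fi := bounded_integrable mf fM.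
have ci : P.-integrable setT (EFin \o (fun=> M)).
  by apply: (@bounded_integrable _ `|M|).
apply: (le_trans (le_normr_Rintegral measurableT fi)).
apply: (@le_trans _ _ (\int[P]_(x in setT) M)); last first.
  rewrite Rintegral_cst//.
  have -> : fine (P setT) = 1 by have -> : P setT = 1%E by exact: probability_setT.
  by rewrite mulr1.
apply: le_Rintegral => //.
apply: (@bounded_integrable _ M); first exact: measurableT_comp.
by move=> x; rewrite normr_id.
Qed.

End probability_integral.

Lemma borel_continuous_real (R : realType) (K : ptopologicalType) (g : K -> R) :
  continuous g -> measurable_fun setT (g : borel K -> R).
Proof.
move=> cg; apply: (measurability _ (RGenOpens.measurableE R)).
move=> _ [_ [a [b ->]] <-]; rewrite setTI; apply: borel_open.
move/continuousP : cg; apply; exact: interval_open.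
Qed.

Lemma borel_continuous (K L : ptopologicalType) (g : K -> L) :
  continuous g -> measurable_fun setT (g : borel K -> borel L).
Proof.
move=> cg; apply: (@measurability _ _ _ (borel L) _ _ (@open L)) => //.
move=> _ [U oU <-]; rewrite setTI; apply: borel_open.
by move/continuousP : cg; apply.
Qed.

Lemma compact_continuous_bounded (R : realType) (K : topologicalType)
    (g : K -> R) : compact [set: K] -> continuous g ->
  exists M : R, 0 < M /\ forall x, `|g x| <= M.
Proof.
move=> cK cg; have cg' : {within [set: K], continuous g}.
  exact: continuous_subspaceT.
have /ex_strict_bound_gt0[M M0 gM] : bounded_set (g @` setT).
  exact/compact_bounded/continuous_compact.
by exists M; split => // x; apply/ltW/gM; exists x.
Qed.

Lemma continuous_integrable (R : realType) (K : ptopologicalType)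
    (P : probability (borel K) R) (f : K -> R) : compact [set: K] ->
  continuous f -> P.-integrable setT (EFin \o (f : borel K -> R)).
Proof.
move=> cK cf; have [M [M0 fM]] := compact_continuous_bounded cK cf.
by apply: (@bounded_integrable _ _ _ _ _ M) => //; exact: borel_continuous_real.
Qed.

Lemma continuous_funM (R : realType) (T : topologicalType) (f g : T -> R) :
  continuous f -> continuous g -> continuous (fun t => f t * g t).
Proof. by move=> cf cg t; apply: (@cvgM _ _ (nbhs t)); [exact: cf|exact: cg]. Qed.

Lemma continuous_funB (R : realType) (T : topologicalType) (f g : T -> R) :
  continuous f -> continuous g -> continuous (fun t => f t - g t).
Proof. by move=> cf cg t; apply: (@cvgB _ _ _ (nbhs t)); [exact: cf|exact: cg]. Qed.

Lemma Rintegral_image d d' (S : measurableType d) (S' : measurableType d')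
    (R : realType) (P : {measure set S -> \bar R}) (nu : {measure set S' -> \bar R})
    (f : S -> S') (g : S' -> R) : measurable_fun setT f ->
    (forall A, measurable A -> nu A = P (f @^-1` A)) ->
    measurable_fun setT g -> P.-integrable setT (EFin \o (g \o f)) ->
  \int[nu]_x g x = \int[P]_x g (f x).
Proof.
move=> mf nuE mg ig.
pose fM := isMeasurableFun.Build _ _ _ _ f mf.
pose X : {mfun S >-> S'} := HB.pack f fM.
rewrite /Rintegral; congr fine.
rewrite -(@integral_pushforward _ _ _ _ _ _ mf P setT (EFin \o g))//; last first.
  exact/measurable_EFinP.
by apply: eq_measure_integral => A mA _; exact: nuE.
Qed.

Section staircase.
Context (R : realType).
Implicit Types e h : R.

(** Rounding of h down to a multiple of e, with the cap r e, written so that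
    it becomes a combination of indicators of superlevel sets when h is a
    function. *)
Definition staircase e r h : R := \sum_(0 <= i < r) e * (e * i.+1%:R <= h)%R%:R.

Lemma staircaseS e r h :
  staircase e r.+1 h = staircase e r h + e * (e * r.+1%:R <= h)%R%:R.
Proof. by rewrite /staircase big_nat_recr. Qed.

Lemma staircase_le e r h : 0 < e -> 0 <= h ->
  staircase e r h <= h /\ staircase e r h <= e * r%:R.
Proof.
move=> e0 h0; elim: r => [|r [IH1 IH2]].
  by rewrite /staircase big_nil mulr0.
rewrite staircaseS; have [eh|he] := leP (e * r.+1%:R) h.
  suff H : staircase e r h + e * true%:R <= e * r.+1%:R.
    by split => //; exact: le_trans eh.
  by rewrite mulr1 -natr1 mulrDr mulr1 lerD2r.
by rewrite mulr0 addr0; split => //; rewrite (le_trans IH2)// ler_pM2l// ler_nat.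
Qed.

Lemma staircase_full e r h : 0 < e -> e * r%:R <= h -> staircase e r h = e * r%:R.
Proof.
move=> e0; elim: r => [|r IH] eh; first by rewrite /staircase big_nil mulr0.
rewrite staircaseS eh mulr1 IH.
  by rewrite -[in RHS]natr1 mulrDr mulr1.
by rewrite (le_trans _ eh)// ler_pM2l// ler_nat.
Qed.

Lemma staircase_ge e r h : 0 < e -> h < e * r.+1%:R -> h <= staircase e r h + e.
Proof.
move=> e0; elim: r => [|r IH] hr.
  by rewrite /staircase big_nil add0r; move: hr; rewrite mulr1 => /ltW.
have [hlt|hge] := ltP h (e * r.+1%:R).
  rewrite (le_trans (IH hlt))// lerD2r staircaseS lerDl.
  by rewrite mulr_ge0// ltW.
rewrite staircase_full//; move/ltW: hr => /le_trans; apply.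
by rewrite -[in leLHS]natr1 mulrDr mulr1.
Qed.

End staircase.

(** Open sets generate the Borel sets and are stable under intersection, so it
    is enough to compare the measure with its image on them. *)
Lemma closed_invariant_borel (R : realType) (K : ptopologicalType)
    (nu : probability (borel K) R) (T : K -> K) :
  measurable_fun setT (T : borel K -> borel K) ->
  (forall E : set K, closed E -> nu (T @^-1` E) = nu E) ->
  forall A : set K, measurable (A : set (borel K)) -> nu (T @^-1` A) = nu A.
Proof.
move=> mT nuT A mA; have [nu' nu'E] := pushforward_probability nu mT.
rewrite -nu'E//; apply: (@measure_unique _ _ (borel K) (@open K) (fun=> setT)) => //.
- exact: openI.
- by move=> _; exact: openT.
- by rewrite bigcup_const//; exists 0%N.
- move=> U oU; transitivity (nu (T @^-1` U)).
    exact: (nu'E U (borel_open oU)).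
  have mTU : measurable (T @^-1` U : set (borel K)).
    by rewrite -[X in measurable X]setTI; apply: mT => //; exact: borel_open.
  have := nuT _ (open_closedC oU).
  rewrite preimage_setC !probability_setC//; last exact: borel_open.
  have fTU := fin_num_measure nu _ mTU.
  have fU := fin_num_measure nu _ (borel_open oU).
  rewrite -(fineK fTU) -(fineK fU) -!EFinB => -[] h.
  have -> : fine (nu (T @^-1` U)) = fine (nu U) by lra.
  exact: fineK.
- by move=> _; rewrite (le_lt_trans (probability_le1 _ _)) ?ltry.
Qed.

(** * Unique ergodicity and uniform convergence *)

Section unique_ergodicity.
Context (R : realType) (K : ptopologicalType).
Hypotheses (cK : compact [set: K]) (hK : hausdorff_space K)
  (sK : @second_countable K).
Context (T : K -> K) (cT : continuous T).

(** The construction of Krylov and Bogoliubov, with control of the integral of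
    one function. The measure nu is only known to dominate the ultralimit m on
    closed sets; the superlevel sets of g are closed, so approximating g by a
    staircase on both sides still bounds the ultralimit of the averages of g
    by its integral against nu, up to e. *)
Lemma birkhoff_invariant_measure (x_ : nat -> K) (N_ : nat -> nat)
    (g : K -> R) (c : R) : (forall k, (k < N_ k)%N) -> continuous g ->
    (forall k, c <= birkhoff T (N_ k) g (x_ k)) ->
  exists nu : probability (borel K) R,
    (forall A : set K, measurable (A : set (borel K)) -> nu (T @^-1` A) = nu A) /\ c <= \int[nu]_x g x.
Proof.
move=> N_k cg cavg.
have [F [FU Foo]] := ultraFilterLemma eventually_filter.
pose m := ultramean R T x_ N_ F.
have hm : fin_additive_prob m by exact: ultramean_prob.
have [nu mnu] := fin_additive_closed_measure cK hK sK hm.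
exists nu; split.
  apply: closed_invariant_borel; first exact: borel_continuous.
  apply: (closed_measure_invariant cK hK sK hm mnu cT).
  exact: ultramean_invariant.
have mnuE (E : set K) : closed E -> m E <= fine (nu E).
  move=> cE; have := mnu E cE; rewrite -lee_fin fineK// fin_num_measure//.
  exact: borel_closed.
have [M [M0 gM]] := compact_continuous_bounded cK cg.
have gi := continuous_integrable nu cK cg.
suff H : forall e : R, 0 < e -> c <= \int[nu]_x g x + e.
  by apply/ler_addgt0Pr => e /H.
move=> e e0.
(* The values of g + M lie in [0, 2 M], so r steps of height e reach them all. *)
have [r rM] : exists r, 2 * M < e * r.+1%:R.
  exists (Num.truncn (2 * M / e)); rewrite -ltr_pdivrMl// mulrC.
  by rewrite truncnS_gt.
pose E (i : nat) := [set x | e * i.+1%:R <= g x + M].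
have cE i : closed (E i).
  apply: (@closed_comp _ _ (fun x => g x + M) [set y | e * i.+1%:R <= y]).
    by move=> x _; apply: cvgD; [exact: cg|exact: cvg_cst].
  exact: closed_ge.
have mE i : measurable (E i : set (borel K)) by exact: borel_closed.
have stE x : staircase e r (g x + M) = \sum_(0 <= i < r) e * \1_(E i) x.
  apply: eq_bigr => i _; congr (_ * _); rewrite indicE; congr (nat_of_bool _)%:R.
  by apply/idP/idP; rewrite inE.
have gM0 x : 0 <= g x + M by have := gM x; rewrite ler_norml => /andP[]; lra.
have up x : g x <= \sum_(0 <= i < r) e * \1_(E i) x + (e - M).
  rewrite -stE addrA lerBrDr; apply: staircase_ge => //.
  apply: le_lt_trans rM; have := gM x; rewrite ler_norml => /andP[_]; lra.
have lo x : \sum_(0 <= i < r) e * \1_(E i) x - M <= g x.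
  by rewrite lerBlDr -stE; case: (staircase_le r e0 (gM0 x)).
have ii i : nu.-integrable setT (EFin \o (fun x => e * \1_(E i) x)).
  apply: (@bounded_integrable _ _ _ _ _ e).
    by apply: measurable_funM => //; exact: measurable_indic.
  move=> x; rewrite indicE; case: (_ \in _); rewrite ?mulr0 ?mulr1 ?normr0.
    by rewrite gtr0_norm.
  exact: ltW.
have [si sE] := Rintegral_sum (index_iota 0 r) ii.
have mi : nu.-integrable setT (EFin \o (fun=> - M)).
  by apply: (@bounded_integrable _ _ _ _ _ M) => // x; rewrite normrN gtr0_norm.
have step1 : c <= \sum_(0 <= i < r) e * m (E i) + (e - M).
  have cv : \sum_(0 <= i < r) e * birkhoff T (N_ k) (\1_(E i)) (x_ k) + (e - M)
      @[k --> F] --> \sum_(0 <= i < r) e * m (E i) + (e - M).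
    apply: cvgD; last exact: cvg_cst.
    apply: cvg_big => [|i _]; first exact: add_continuous.
    apply: cvgM; first exact: cvg_cst.
    exact: ultramean_cvg.
  rewrite -(cvg_lim _ cv)//; apply: limr_ge; first by apply/cvg_ex; eexists; exact: cv.
  apply: nearW => k; apply: (le_trans (cavg k)).
  apply: (le_trans (birkhoff_le _ _ _ up)).
  rewrite birkhoffD birkhoff_cst ?(leq_ltn_trans _ (N_k k))// lerD2r.
  rewrite birkhoff_sum ler_sum// => i _; by rewrite birkhoffZ.
apply: (le_trans step1).
have step2 : \sum_(0 <= i < r) e * m (E i) - M <= \int[nu]_x g x.
  apply: (@le_trans _ _ (\int[nu]_x (\sum_(0 <= i < r) e * \1_(E i) x + - M))).
    rewrite RintegralD// sE Rintegral_cst//.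
    have -> : fine (nu setT) = 1 by have -> : nu setT = 1%E by exact: probability_setT.
    rewrite mulr1 lerD2r.
    apply: ler_sum => i _; rewrite RintegralZl//; last first.
      by apply: (@bounded_integrable _ _ _ _ _ 1) => // x; rewrite indicE;
        case: (_ \in _); rewrite ?normr1 ?normr0.
    by rewrite ler_pM2l// Rintegral_indic// mnuE.
  apply: le_Rintegral => //.
  exact: integrableDR.
move: step2; set a := \sum_(0 <= i < r) _; set b := Rintegral _ _ _; lra.
Qed.

(** If at arbitrarily late times some average exceeded the integral by e, an
    ultralimit along these orbit segments would produce an invariant
    probability that gives g too large an integral. The lower bound is the
    same statement for - g. *)
Theorem birkhoff_uniform (mu : probability (borel K) R) (g : K -> R) :
  (forall nu : probability (borel K) R,
    (forall A : set K, measurable (A : set (borel K)) -> nu (T @^-1` A) = nu A) ->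
    forall A, measurable A -> nu A = mu A) ->
  continuous g -> forall e, 0 < e ->
  \forall N \near \oo, forall x, `|birkhoff T N g x - \int[mu]_x g x| <= e.
Proof.
move=> mu_unique.
suff H h : continuous h -> forall e, 0 < e ->
    \forall N \near \oo, forall x, birkhoff T N h x <= \int[mu]_x h x + e.
  move=> cg e e0.
  have gi := continuous_integrable mu cK cg.
  have cNg : continuous (fun x => -1 * g x).
    by move=> x; apply: cvgM; [exact: cvg_cst|exact: cg].
  have := H _ cg e e0; have := H _ cNg e e0.
  apply: filterS2 => N H2 H1 x; move: (H1 x) (H2 x).
  rewrite birkhoffZ RintegralZl// ler_norml.
  by move: (birkhoff _ _ _ _) (Rintegral _ _ _) => a b; lra.
move=> ch e e0; apply: contrapT => nH.
have bad k : exists p : nat * K, (k < p.1)%N /\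
    \int[mu]_x h x + e <= birkhoff T p.1 h p.2.
  apply: contrapT => nk; apply: nH; exists k.+1 => // N kN x.
  rewrite leNgt; apply/negP => lt; apply: nk; exists (N, x); split => //.
  exact: ltW.
have [p pP] := choice bad.
have [nu [nuT ge]] := birkhoff_invariant_measure
  (x_ := fun k => (p k).2) (fun k => (pP k).1) ch (fun k => (pP k).2).
suff E : \int[nu]_x h x = \int[mu]_x h x by move: ge; rewrite E; lra.
rewrite /Rintegral; congr fine; apply: eq_measure_integral => A mA _.
exact: mu_unique.
Qed.

End unique_ergodicity.

(** * Borel sets of a product *)

HB.instance Definition _ (X Y : ptopologicalType) := Pointed.on (X * Y)%type.

Section product_borel.
Context (X Y : ptopologicalType).

Lemma open_prod_bigcup (B : nat -> set X) (C : nat -> set Y) :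
  (forall x A, nbhs x A -> exists2 i, B i x & B i `<=` A) ->
  (forall y A, nbhs y A -> exists2 i, C i y & C i `<=` A) ->
  forall (p : X * Y) W, nbhs p W ->
    exists i j, [/\ B i p.1, C j p.2 & B i `*` C j `<=` W].
Proof.
move=> bB bC p W [[U V] /= [Up Vp] UVW].
have [i Bp BU] := bB _ _ Up; have [j Cp CV] := bC _ _ Vp.
exists i, j; split => // q [/BU Uq /CV Vq]; exact: UVW.
Qed.

Lemma open_setX (A : set X) (B : set Y) : open A -> open B -> open (A `*` B).
Proof.
move=> oA oB; rewrite openE => -[x y] [/= Ax By].
by exists (A, B) => //; split; exact: open_nbhs_nbhs.
Qed.

Lemma second_countable_prod : @second_countable X -> @second_countable Y ->
  @second_countable (X * Y)%type.
Proof.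
move=> /second_countable_seq[B [oB bB]] /second_countable_seq[C [oC bC]].
exists (range (fun ij : nat * nat => B ij.1 `*` C ij.2)).
  exact: (card_le_trans (card_image_le _ _) (countableP _)).
split=> [_ [[i j] _ <-]|p W Wp]; first exact: open_setX.
have [i [j [Bp Cp BC]]] := open_prod_bigcup bB bC Wp.
by exists (B i `*` C j) => //; split => //; exists (i, j).
Qed.

(** By second countability every open set of the product is a countable union
    of open rectangles. *)
Lemma measurable_prod_borel_id : @second_countable X -> @second_countable Y ->
  measurable_fun setT (idfun : (borel X * borel Y)%type -> borel (X * Y)%type).
Proof.
move=> /second_countable_seq[B [oB bB]] /second_countable_seq[C [oC bC]].
apply: (@measurability _ _ _ (borel (X * Y)%type) _ _ (@open (X * Y)%type)) => //.
move=> _ [W oW <-]; rewrite setTI.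
have -> : idfun @^-1` W = \bigcup_i \bigcup_j
    (if `[< B i `*` C j `<=` W >] then B i `*` C j else set0).
  apply/seteqP; split => [p Wp|p [i _ [j _]]]; last first.
    by case: asboolP => // BC /BC.
  have [i [j [Bp Cp BC]]] := open_prod_bigcup bB bC (open_nbhs_nbhs (conj oW Wp)).
  by exists i => //; exists j => //; case: asboolP.
apply: bigcupT_measurable => i; apply: bigcupT_measurable => j.
by case: asboolP => // _; apply: measurableX; exact: borel_open.
Qed.

Lemma measurable_borel_prod_id :
  measurable_fun setT (idfun : borel (X * Y)%type -> (borel X * borel Y)%type).
Proof.
have m1 : measurable_fun setT (fst : borel (X * Y)%type -> borel X).
  by apply: borel_continuous => p; exact: cvg_fst.
have m2 : measurable_fun setT (snd : borel (X * Y)%type -> borel Y).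
  by apply: borel_continuous => p; exact: cvg_snd.
by apply/measurable_fun_pairP; split; [exact: m1|exact: m2].
Qed.

End product_borel.

Lemma compact_prodT (X Y : topologicalType) : compact [set: X] ->
  compact [set: Y] -> compact [set: X * Y].
Proof. by move=> cX cY; rewrite -setXTT; exact: compact_setX. Qed.

Lemma hausdorff_prodT (X Y : topologicalType) : hausdorff_space X ->
  hausdorff_space Y -> hausdorff_space (X * Y)%type.
Proof.
move=> hX hY [x y] [x' y'] xy; congr pair.
  apply: hX => A B Ax Bx.
  have nA : nbhs (x, y) (A `*` setT).
    by exists (A, setT) => //; split => //; exact: filterT.
  have nB : nbhs (x', y') (B `*` setT).
    by exists (B, setT) => //; split => //; exact: filterT.
  by have [[z w] [[/= Az _] [/= Bz _]]] := xy _ _ nA nB; exists z.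
apply: hY => A B Ay By.
have nA : nbhs (x, y) (setT `*` A).
  by exists (setT, A) => //; split => //; exact: filterT.
have nB : nbhs (x', y') (setT `*` B).
  by exists (setT, B) => //; split => //; exact: filterT.
by have [[z w] [[/= _ Az] [/= _ Bz]]] := xy _ _ nA nB; exists w.
Qed.

Section product_unique_ergodicity.
Context (R : realType) (X Y : ptopologicalType).
Hypotheses (cX : compact [set: X]) (hX : hausdorff_space X)
  (sX : @second_countable X).
Hypotheses (cY : compact [set: Y]) (hY : hausdorff_space Y)
  (sY : @second_countable Y).

Lemma product_continuous_measurable (g : X * Y -> R) : continuous g ->
  measurable_fun setT (g : (borel X * borel Y)%type -> R).
Proof.
move=> cg.
exact: (measurableT_comp (borel_continuous_real cg) (measurable_prod_borel_id sX sY)).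
Qed.

(** The Borel sets of the product are the product of the Borel sets, so
    measures are moved along the identity in both directions. *)
Lemma product_birkhoff_uniform (mu : probability (borel X * borel Y)%type R)
    (T : X * Y -> X * Y) (g : X * Y -> R) :
  continuous T ->
  (forall nu : probability (borel X * borel Y)%type R,
    invariant_measure nu (T : (borel X * borel Y)%type -> (borel X * borel Y)%type) ->
    forall A, measurable A -> nu A = mu A) ->
  continuous g -> forall e, 0 < e ->
  \forall N \near \oo, forall x, `|birkhoff T N g x - \int[mu]_x g x| <= e.
Proof.
move=> cT mu_unique cg e e0.
have m1 := measurable_prod_borel_id sX sY.
have m2 := @measurable_borel_prod_id X Y.
have [mu' mu'E] := pushforward_probability mu m1.
have -> : \int[mu]_x g x = \int[mu']_x g x.
  symmetry; apply: (Rintegral_image m1) => //; first exact: (borel_continuous_real cg).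
  have [M [M0 gM]] := compact_continuous_bounded (compact_prodT cX cY) cg.
  apply: (@bounded_integrable _ _ _ _ _ M) => //.
  exact: product_continuous_measurable.
apply: birkhoff_uniform => //.
- exact: compact_prodT.
- exact: hausdorff_prodT.
- exact: second_countable_prod.
move=> nu nuT A mA; rewrite mu'E//.
have [nu' nu'E] := pushforward_probability nu m2.
have mA' : measurable (A : set (borel X * borel Y)%type).
  by rewrite -[A]setTI; exact: (m1 measurableT _ mA).
transitivity (nu' A); first by rewrite nu'E.
apply: mu_unique => // B mB.
have mid (C : set (X * Y)) : measurable (C : set (borel X * borel Y)%type) ->
    measurable (C : set (borel (X * Y)%type)).
  by move=> mC; rewrite -[C]setTI; exact: (m2 measurableT _ mC).
have mTB : measurable (T @^-1` B : set (borel (X * Y)%type)).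
  by rewrite -[T @^-1` B]setTI; exact: (borel_continuous cT measurableT (mid B mB)).
have mTB' : measurable (T @^-1` B : set (borel X * borel Y)%type).
  by rewrite -[T @^-1` B]setTI; exact: (m1 measurableT _ mTB).
transitivity (nu (T @^-1` B)); first exact: (nu'E _ mTB').
by rewrite (nuT B (mid B mB)); symmetry; exact: (nu'E _ mB).
Qed.

End product_unique_ergodicity.

(** * Continuously differentiable germs *)

Section C1_germs.
Context (R : realType).
Implicit Types U V W : normedModType R.

(** Exhibiting a continuous linear map that satisfies the first order estimate
    proves differentiability and identifies the differential at the same time. *)
Lemma differentiable_epsP V W (f : V -> W) (x : V) (L : {linear V -> W}) :
  continuous L ->
  (forall e, 0 < e -> \forall h \near 0, `|f (h + x) - f x - L h| <= e * `|h|) ->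
  differentiable f x /\ 'd f x = L :> (V -> W).
Proof.
move=> cL fL.
have E : f \o shift x = cst (f x) + L +o_ 0 id.
  apply/eqaddoP => e e0; apply: filterS (fL e e0) => h /=.
  by rewrite opprD addrA.
split; last exact: diff_unique.
apply/diffP => /=.
apply: (@getPex _ (fun (df : {linear V -> W}) => continuous df /\
  forall y, f y = f (lim (nbhs x)) + df (y - lim (nbhs x))
                  +o_(y \near x) (y - lim (nbhs x)))).
exists L; split=> //; apply: eqaddoEx => z.
rewrite lim_id// -[in LHS](subrK x z).
have := congr1 (fun F => F (z - x)) E; rewrite /= => ->.
congr (_ + _).
rewrite -(comp_centerK x id) -[X in the_littleo _ _ _ X](comp_centerK x).
by rewrite -[_ (z - x)]/((_ \o (center x)) z) -littleo_center0.
Qed.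

Lemma differentiable_eps V W (f : V -> W) (x : V) : differentiable f x ->
  forall e, 0 < e ->
    \forall h \near 0, `|f (h + x) - f x - 'd f x h| <= e * `|h|.
Proof.
move=> /diff_locally/eqaddoP df e /df; apply: filterS => h /=.
by rewrite opprD addrA.
Qed.

Lemma near_eq_differentiable V W (f g : V -> W) x :
  (\forall y \near x, f y = g y) -> differentiable f x -> differentiable g x.
Proof.
move=> fg df.
suff : differentiable g x /\ 'd g x = 'd f x :> (V -> W) by case.
apply: differentiable_epsP => [|e e0].
  exact: diff_continuous.
have fg0 : \forall h \near (0 : V), f (h + x) = g (h + x).
  by move: fg; rewrite (near_shift 0 x) subr0.
apply: filterS2 fg0 (differentiable_eps df e0) => h fgh.
by rewrite fgh (nbhs_singleton fg).
Qed.

(** A condition at a single point, so that it can be tested in charts around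
    that point. *)
Definition C1at V W (f : V -> W) (x : V) : Prop :=
  (\forall y \near x, differentiable f y) /\ forall v, {for x, continuous ('D_v f)}.

Lemma C1at_differentiable V W (f : V -> W) x : C1at f x -> differentiable f x.
Proof. by move=> [/nbhs_singleton]. Qed.

Lemma C1at_near V W (f g : V -> W) x :
  (\forall y \near x, f y = g y) -> C1at f x -> C1at g x.
Proof.
move=> fg [df Df]; have fg' := nbhs_interior fg; split.
  apply: filterS2 fg' df => y; exact: near_eq_differentiable.
move=> v; have Dfg : \forall y \near x, 'D_v f y = 'D_v g y.
  apply: filterS fg' => y fgy; exact: near_eq_derive.
rewrite /prop_for /continuous_at -(nbhs_singleton Dfg).
apply: cvg_trans (Df v); apply: near_eq_cvg.
by apply: filterS Dfg => y ->.
Qed.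

Lemma cvg_coord (T : Type) (F : set_system T) (FF : Filter F) n
    (f : T -> 'rV[R]_n) (l : 'rV[R]_n) j :
  f @ F --> l -> (fun y => f y 0 j) @ F --> l 0 j.
Proof.
move=> fl; exact: (cvg_comp f (fun u : 'rV[R]_n => u 0 j) fl (@coord_continuous R 1 n 0 j l)).
Qed.

Lemma cvg_rowP (T : Type) (F : set_system T) (FF : Filter F) n
    (f : T -> 'rV[R]_n) (l : 'rV[R]_n) :
  (forall j, (fun y => f y 0 j) @ F --> l 0 j) -> f @ F --> l.
Proof.
move=> fl; rewrite [l]row_sum_delta.
have -> : f = fun y => \sum_j f y 0 j *: delta_mx 0 j.
  by apply/funext => y; rewrite -row_sum_delta.
apply: cvg_big => [|j _]; first exact: add_continuous.
by apply: cvgZr_tmp; exact: fl.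
Qed.

Lemma cvg_row_mx (T : Type) (F : set_system T) (FF : Filter F) n p
    (f : T -> 'rV[R]_n) (g : T -> 'rV[R]_p)
    (u : 'rV[R]_n) (v : 'rV[R]_p) :
  f @ F --> u -> g @ F --> v -> row_mx (f y) (g y) @[y --> F] --> row_mx u v.
Proof.
move=> fu gv; apply: cvg_rowP => j; case: (split_ordP j) => k ->.
  by rewrite row_mxEl; under eq_fun do rewrite row_mxEl; exact: cvg_coord.
by rewrite row_mxEr; under eq_fun do rewrite row_mxEr; exact: cvg_coord.
Qed.

Lemma derive_comp V U W (f : V -> U) (g : U -> W) (x v : V) :
  differentiable f x -> differentiable g (f x) ->
  'D_v (g \o f) x = 'D_('D_v f x) g (f x).
Proof.
move=> df dg.
rewrite (deriveE v (differentiable_comp df dg)) (deriveE _ dg) (deriveE v df).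
by rewrite (diff_comp df dg).
Qed.

Lemma derive_basis n W (g : 'rV[R]_n -> W) (x v : 'rV[R]_n) :
  differentiable g x -> 'D_v g x = \sum_j v 0 j *: 'D_(delta_mx 0 j) g x.
Proof.
move=> dg; rewrite (deriveE v dg) [in LHS](row_sum_delta v) linear_sum.
by apply: eq_bigr => j _; rewrite linearZ (deriveE _ dg).
Qed.

(** The middle space consists of row vectors because the derivatives of g are
    known to be continuous one direction at a time: the chain rule is expanded
    along the coordinates of the derivative of f. *)
Lemma C1at_comp V n W (f : V -> 'rV[R]_n) (g : 'rV[R]_n -> W) x :
  C1at f x -> C1at g (f x) -> C1at (g \o f) x.
Proof.
move=> [df Df] [dg Dg].
have cf : {for x, continuous f}.
  exact/differentiable_continuous/(nbhs_singleton df).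
have dgf : \forall y \near x, differentiable g (f y) by exact: (cf _ dg).
split.
  by apply: filterS2 df dgf => y ? ?; exact: differentiable_comp.
move=> v.
have DE : \forall y \near x, \sum_j ('D_v f y) 0 j *: 'D_(delta_mx 0 j) g (f y) = 'D_v (g \o f) y.
  apply: filterS2 df dgf => y fy gy.
  exact: (esym (etrans (derive_comp v fy gy) (derive_basis _ gy))).
rewrite /prop_for /continuous_at -(nbhs_singleton DE).
apply: cvg_trans; first by apply: near_eq_cvg; exact: DE.
apply: cvg_big => [|j _]; first exact: add_continuous.
apply: cvgZ; first by apply: cvg_coord; exact: Df.
exact: (cvg_comp f _ cf (Dg (delta_mx 0 j))).
Qed.

Lemma differentiable_rowP V n (f : V -> 'rV[R]_n) x :
  (forall j, differentiable (fun y => f y 0 j) x) -> differentiable f x.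
Proof.
move=> df.
have -> : f = \sum_j (fun y => f y 0 j *: (delta_mx 0 j : 'rV[R]_n)).
  by apply/funext => y; rewrite fct_sumE -row_sum_delta.
by apply: differentiable_sum => j; exact: differentiableZl.
Qed.

Lemma differentiable_row V n (f : V -> 'rV[R]_n) j x :
  differentiable f x -> differentiable (fun y => f y 0 j) x.
Proof.
move=> df; apply: (@differentiable_comp _ _ _ _ f (fun u : 'rV[R]_n => u 0 j)) => //.
exact: differentiable_coord.
Qed.

Lemma derive_row V n (f : V -> 'rV[R]_n) x v j :
  differentiable f x -> ('D_v f x) 0 j = 'D_v (fun y => f y 0 j) x.
Proof.
move=> df; rewrite derive_mx ?mxE//; exact: diff_derivable.
Qed.

Lemma C1at_rowP V n (f : V -> 'rV[R]_n) x :
  C1at f x <-> forall j, C1at (fun y => f y 0 j) x.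
Proof.
split=> [[df Df] j|Cf].
  split.
    by apply: filterS df => y; exact: differentiable_row.
  move=> v; have DE : \forall y \near x, 'D_v f y 0 j = 'D_v (fun y => f y 0 j) y.
    by apply: filterS df => y; exact: derive_row.
  rewrite /prop_for /continuous_at -(nbhs_singleton DE).
  apply: cvg_trans; first by apply: near_eq_cvg; exact: DE.
  by apply: cvg_coord; exact: Df.
have df : \forall y \near x, differentiable f y.
  have : \forall y \near x, forall j, differentiable (fun z => f z 0 j) y.
    by apply: filter_forall => j; case: (Cf j).
  by apply: filterS => y; exact: differentiable_rowP.
split=> // v.
have DE : \forall y \near x, \sum_j 'D_v (fun z => f z 0 j) y *: (delta_mx 0 j : 'rV[R]_n) = 'D_v f y.
  apply: filterS df => y fy; rewrite [RHS]row_sum_delta; apply: eq_bigr => j _.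
  by rewrite derive_row.
rewrite /prop_for /continuous_at -(nbhs_singleton DE).
apply: cvg_trans; first by apply: near_eq_cvg; exact: DE.
apply: cvg_big => [|j _]; first exact: add_continuous.
apply: cvgZr_tmp; have [_ Dfj] := Cf j; exact: Dfj.
Qed.

Lemma C1at_row_mx V n p (f : V -> 'rV[R]_n) (g : V -> 'rV[R]_p) x :
  C1at f x -> C1at g x -> C1at (fun y => row_mx (f y) (g y)) x.
Proof.
move=> /C1at_rowP Cf /C1at_rowP Cg; apply/C1at_rowP => j.
case: (split_ordP j) => k ->.
  by under eq_fun => y do rewrite row_mxEl; exact: Cf.
by under eq_fun => y do rewrite row_mxEr; exact: Cg.
Qed.

Lemma C1at_id V (x : V) : C1at (id : V -> V) x.
Proof.
split; first by apply: nearW => y; exact: (@ex_diff _ _ _ _ _ (id : V -> V) id (is_diff_id y)).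
move=> v; have -> : 'D_v (id : V -> V) = cst v.
  by apply/funext => y; rewrite derive_id.
exact: cst_continuous.
Qed.

Lemma C1at_coord n (u : 'rV[R]_n) j : C1at (fun w : 'rV[R]_n => w 0 j) u.
Proof. exact: (C1at_rowP _ _).1 (C1at_id u) j. Qed.

Lemma C1at_cst V W (a : W) (x : V) : C1at (cst a) x.
Proof.
split; first by apply: nearW => y; exact: differentiable_cst.
move=> v; have -> : 'D_v (cst a) = cst 0 :> (V -> W).
  by apply/funext => y; rewrite derive_cst.
exact: cst_continuous.
Qed.

Lemma C1at_lsubmx n p (u : 'rV[R]_(n + p)) : C1at (@lsubmx R 1 n p) u.
Proof.
apply/C1at_rowP => j; under eq_fun => y do rewrite mxE.
exact: C1at_coord.
Qed.

Lemma C1at_rsubmx n p (u : 'rV[R]_(n + p)) : C1at (@rsubmx R 1 n p) u.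
Proof.
apply/C1at_rowP => j; under eq_fun => y do rewrite mxE.
exact: C1at_coord.
Qed.

Lemma derive_row_mxl n p W (k : 'rV[R]_(n + p) -> W) (s : 'rV[R]_p) (u v : 'rV[R]_n) :
  'D_v (fun u' => k (row_mx u' s)) u = 'D_(row_mx v 0) k (row_mx u s).
Proof.
rewrite /derive /=; do 4 f_equal; apply/funext => h /=.
by rewrite scale_row_mx scaler0 add_row_mx add0r.
Qed.

End C1_germs.

(** * Maps that are C1 near a point of a manifold *)

Section manifold_C1.
Context (R : realType).

Lemma cvg_pairT (T : Type) (F : set_system T) (FF : Filter F)
    (X Y : topologicalType) (f : T -> X) (g : T -> Y) (x : X) (y : Y) :
  f @ F --> x -> g @ F --> y -> (f t, g t) @[t --> F] --> (x, y).
Proof.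
move=> fx gy W [[U V] /= [Ux Vy] UV].
have fU : F (f @^-1` U) by exact: fx.
have gV : F (g @^-1` V) by exact: gy.
have H : F [set t | W (f t, g t)].
  by apply: filterS2 fU gV => t Uf Vg; exact: (UV (f t, g t) (conj Uf Vg)).
exact: H.
Qed.

(** What a chart gives around one of its points, free of subspace topologies. *)
Definition chart_near (X : topologicalType) n (c : chart R X n) (p : X) : Prop :=
  [/\ nbhs p (chart_dom c), {in chart_dom c, cancel c (chart_inv c)},
      {for p, continuous c}, {for c p, continuous (chart_inv c)} &
      nbhs (c p) (c @` chart_dom c)].

Definition C1_near (X Y : topologicalType) n m (A : set (chart R X n))
    (B : set (chart R Y m)) (f : X -> Y) (p : X) : Prop :=
  {for p, continuous f} /\
  forall a b, A a -> B b -> chart_dom a p -> chart_dom b (f p) ->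
    C1at (b \o f \o chart_inv a) (a p).

(** Compatibility of the charts is left out, so that product atlases and the
    line qualify by direct inspection; it enters only in C1_near_id. *)
Definition charted (X : topologicalType) n (A : set (chart R X n)) : Prop :=
  (forall c p, A c -> chart_dom c p -> chart_near c p) /\
  (forall p, exists2 c, A c & chart_dom c p).

Lemma is_chart_near (X : topologicalType) n (c : chart R X n) p :
  is_chart c -> chart_dom c p -> chart_near c p.
Proof.
move=> [oD oI cK cc ci] Dp; split.
- exact: open_nbhs_nbhs.
- by move=> x; rewrite inE; exact: cK.
- by move: cc; rewrite continuous_open_subspace// => /(_ p); apply; rewrite inE.
- move: ci; rewrite continuous_open_subspace// => /(_ (c p)); apply.
  by rewrite inE; exists p.
- by apply: open_nbhs_nbhs; split => //; exists p.
Qed.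

Lemma smooth_atlas_charted (X : topologicalType) n (A : set (chart R X n)) :
  is_smooth_atlas A -> charted A.
Proof.
move=> [ch cov _]; split => // c p Ac; exact/is_chart_near/ch.
Qed.

Lemma chart_invK_near (X : topologicalType) n (c : chart R X n) p :
  chart_near c p -> chart_inv c (c p) = p.
Proof.
by move=> [/nbhs_singleton Dp cK _ _ _]; apply: cK; rewrite inE.
Qed.

Lemma chart_inv_cvg (X : topologicalType) n (c : chart R X n) p :
  chart_near c p -> chart_inv c x @[x --> c p] --> p.
Proof.
by move=> cp; have [_ _ _ + _] := cp; rewrite /prop_for /continuous_at (chart_invK_near cp).
Qed.

Lemma Ck1_C1_near (X Y : topologicalType) n m (A : set (chart R X n))
    (B : set (chart R Y m)) (f : X -> Y) :
  charted A -> charted B ->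
  Ck_map 1 A B f -> forall p, C1_near A B f p.
Proof.
move=> hA hB [cf Cf] p; split; first exact: cf.
move=> a b Aa Bb ap bp.
have [df Df] := Cf a b Aa Bb.
have an := hA.1 _ _ Aa ap.
have U : \forall u \near a p, (a @` (chart_dom a `&` f @^-1` chart_dom b)) u.
  have [_ aK _ _ h1] := an.
  have h2 : \forall u \near a p, chart_dom b (f (chart_inv a u)).
    have : nbhs p (f @^-1` chart_dom b).
      by apply: cf; have [] := hB.1 _ _ Bb bp.
    exact: (chart_inv_cvg an).
  apply: filterS2 h1 h2 => _ [x ax <-].
  by rewrite aK ?inE// => bfx; exists x.
split; first by apply: filterS U => u; exact: df.
by move=> v; apply: Df; exact: (nbhs_singleton U).
Qed.

Section comp.
Context (X Y Z : topologicalType) (n m k : nat).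
Context (A : set (chart R X n)) (B : set (chart R Y m)) (C : set (chart R Z k)).
Hypotheses (hA : charted A) (hB : charted B).

Lemma C1_near_comp (f : X -> Y) (g : Y -> Z) p :
  C1_near A B f p -> C1_near B C g (f p) -> C1_near A C (g \o f) p.
Proof.
move=> [cf Cf] [cg Cg]; split; first exact: continuous_comp.
move=> a c Aa Cc ap cp.
have [b Bb bp] := hB.2 (f p).
have an := hA.1 _ _ Aa ap; have bn := hB.1 _ _ Bb bp.
have CF := Cf a b Aa Bb ap bp; have CG := Cg b c Bb Cc bp cp.
have e : (b \o f \o chart_inv a) (a p) = b (f p) by rewrite /= (chart_invK_near an).
rewrite -e in CG; have := C1at_comp CF CG; apply: C1at_near.
have [bD bK _ _ _] := bn.
have : \forall u \near a p, chart_dom b (f (chart_inv a u)).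
  have : nbhs p (f @^-1` chart_dom b) by exact: cf.
  exact: (chart_inv_cvg an).
by apply: filterS => u bu /=; rewrite bK ?inE.
Qed.

Lemma C1_near_cst (y : Y) p : C1_near A B (cst y) p.
Proof.
split; first exact: cst_continuous.
by move=> a b Aa Bb ap bp; exact: (C1at_cst (b y)).
Qed.

End comp.

Section product.
Context (X Y : topologicalType) (n m : nat).
Context (A : set (chart R X n)) (B : set (chart R Y m)).
Hypotheses (hA : charted A) (hB : charted B).

Lemma chart_near_prod (a : chart R X n) (b : chart R Y m) p :
  chart_near a p.1 -> chart_near b p.2 -> chart_near (prod_chart a b) p.
Proof.
move=> [aD aK ac ai aI] [bD bK bc bi bI].
have cl : lsubmx w @[w --> row_mx (a p.1) (b p.2)] --> a p.1.
  have := differentiable_continuous (C1at_differentiable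
    (C1at_lsubmx (row_mx (a p.1) (b p.2)))).
  by rewrite /prop_for /continuous_at row_mxKl.
have cr : rsubmx w @[w --> row_mx (a p.1) (b p.2)] --> b p.2.
  have := differentiable_continuous (C1at_differentiable
    (C1at_rsubmx (row_mx (a p.1) (b p.2)))).
  by rewrite /prop_for /continuous_at row_mxKr.
split.
- by exists (chart_dom a, chart_dom b).
- move=> [x y]; rewrite inE => -[/= ax bY]; rewrite row_mxKl row_mxKr.
  by rewrite aK ?inE// bK ?inE.
- apply: cvg_row_mx.
    exact: (cvg_comp fst a cvg_fst ac).
  exact: (cvg_comp snd b cvg_snd bc).
- rewrite /prop_for /continuous_at /= row_mxKl row_mxKr.
  have c1 := cvg_comp _ (chart_inv a) cl ai.
  have c2 := cvg_comp _ (chart_inv b) cr bi.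
  apply: (@cvg_pairT _ _ (nbhs_filter (row_mx (a p.1) (b p.2))) X Y (chart_inv a \o @lsubmx R 1 n m)
    (chart_inv b \o @rsubmx R 1 n m)).
    exact: c1.
  exact: c2.
- have nl : \forall w \near row_mx (a p.1) (b p.2), (a @` chart_dom a) (lsubmx w).
    exact: cl.
  have nr : \forall w \near row_mx (a p.1) (b p.2), (b @` chart_dom b) (rsubmx w).
    exact: cr.
  apply: filterS2 nl nr => w [x ax xw] [y bY yw]; exists (x, y); first by split.
  by rewrite /= xw yw hsubmxK.
Qed.

Lemma charted_prod : charted (prod_atlas A B).
Proof.
split=> [c p [a [b [Aa Bb ->]]] [/= ap bp]|p].
  by apply: chart_near_prod; [exact: hA.1|exact: hB.1].
have [a Aa ap] := hA.2 p.1; have [b Bb bp] := hB.2 p.2.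
by exists (prod_chart a b) => //; exists a, b.
Qed.

Lemma C1_near_fst (p : X * Y) : (forall x, C1_near A A id x) ->
  C1_near (prod_atlas A B) A fst p.
Proof.
move=> hid; split; first exact: cvg_fst.
move=> _ a' [a [b [Aa Bb ->]]] Aa' [/= ap bp] ap'.
have Ca := (hid p.1).2 _ _ Aa Aa' ap ap'.
have e : lsubmx (row_mx (a p.1) (b p.2)) = a p.1 by rewrite row_mxKl.
rewrite -e in Ca.
exact: (C1at_comp (C1at_lsubmx _) Ca).
Qed.

Lemma C1_near_snd (p : X * Y) : (forall y, C1_near B B id y) ->
  C1_near (prod_atlas A B) B snd p.
Proof.
move=> hid; split; first exact: cvg_snd.
move=> _ b' [a [b [Aa Bb ->]]] Bb' [/= ap bp] bp'.
have Cb := (hid p.2).2 _ _ Bb Bb' bp bp'.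
have e : rsubmx (row_mx (a p.1) (b p.2)) = b p.2 by rewrite row_mxKr.
rewrite -e in Cb.
exact: (C1at_comp (C1at_rsubmx _) Cb).
Qed.

Lemma C1_near_pair (Z : topologicalType) (k : nat) (C : set (chart R Z k))
    (f : Z -> X) (g : Z -> Y) z :
  C1_near C A f z -> C1_near C B g z ->
  C1_near C (prod_atlas A B) (fun z => (f z, g z)) z.
Proof.
move=> [cf Cf] [cg Cg]; split; first exact: cvg_pair.
move=> c _ Cc [a [b [Aa Bb ->]]] cz [/= az bz].
by apply: C1at_row_mx; [exact: Cf|exact: Cg].
Qed.

End product.

(** In two charts the identity is a transition map. *)
Lemma C1_near_id (X : topologicalType) n (A : set (chart R X n)) :
  is_smooth_atlas A -> forall x, C1_near A A id x.
Proof.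
move=> sA; have hA := smooth_atlas_charted sA; have [_ _ tr] := sA.
apply: Ck1_C1_near => //; split; first by move=> x; exact: cvg_id.
by move=> a b Aa Ab; exact: (tr a b Aa Ab 1%N).
Qed.

Lemma charted_line : charted (line_atlas (R := R)).
Proof.
split=> [c p -> _|p]; last by exists (Chart setT (fun t : R => const_mx t) (fun u => u 0 0)).
split.
- exact: filterT.
- by move=> t _; rewrite /= mxE.
- apply: cvg_rowP => j /=; rewrite mxE.
  by under eq_fun do rewrite mxE; exact: cvg_id.
- exact: coord_continuous.
- apply: filterS (@filterT _ _ _) => u _; exists (u 0 0) => //.
  by apply/rowP => j; rewrite mxE ord1.
Qed.

(** In a chart of the product f is C1, and its partial derivative along v is
    the derivative in the direction (v, 0). The parameter stays in the
    manifold P, where continuity and compactness will be used. *)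
Lemma partial_derive_joint (Q P Y : topologicalType) (n m k : nat)
    (A : set (chart R Q n)) (B : set (chart R P m)) (C : set (chart R Y k))
    (f : Q * P -> Y) (q0 : Q) (p0 : P) (a : chart R Q n) (c : chart R Y k) :
  charted A -> charted B ->
  C1_near (prod_atlas A B) C f (q0, p0) -> A a -> C c -> chart_dom a q0 ->
  chart_dom c (f (q0, p0)) ->
  (\forall up \near (a q0, p0),
    differentiable (fun u => c (f (chart_inv a u, up.2))) up.1) /\
  forall v, {for (a q0, p0), continuous
    (fun up => 'D_v (fun u => c (f (chart_inv a u, up.2))) up.1)}.
Proof.
move=> hA hB [_ Cf] Aa Cc aq cq.
have [b Bb bp] := hB.2 p0.
have bn := hB.1 _ _ Bb bp.
have [bD bK bc bi _] := bn.
have Ck := Cf (prod_chart a b) c (ex_intro _ a (ex_intro _ b (And3 Aa Bb erefl))) Cc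
  (conj aq bp) cq.
pose k' := c \o f \o chart_inv (prod_chart a b).
have kE p : chart_dom b p ->
    (fun u => k' (row_mx u (b p))) = (fun u => c (f (chart_inv a u, p))).
  by move=> bp'; apply/funext => u; rewrite /k' /= row_mxKl row_mxKr bK ?inE.
have bD2 : \forall up \near (a q0, p0), chart_dom b up.2 by exact: cvg_snd.
have cr : row_mx up.1 (b up.2) @[up --> (a q0, p0)] --> row_mx (a q0) (b p0).
  apply: cvg_row_mx; first exact: cvg_fst.
  exact: (cvg_comp snd b cvg_snd bc).
split.
  have dk : \forall up \near (a q0, p0), differentiable k' (row_mx up.1 (b up.2)).
    exact: (cr _ Ck.1).
  apply: filterS2 bD2 dk => up bup dkup; rewrite -kE//.
  apply: (@differentiable_comp _ _ _ _ (fun u => row_mx u (b up.2)) k') => //.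
  by apply: C1at_differentiable; apply: C1at_row_mx; [exact: C1at_id|exact: C1at_cst].
move=> v.
have DE up : chart_dom b up.2 -> 'D_(row_mx v 0) k' (row_mx up.1 (b up.2)) =
    'D_v (fun u => c (f (chart_inv a u, up.2))) up.1.
  by move=> bup; rewrite -kE//; exact: (esym (derive_row_mxl k' (b up.2) up.1 v)).
rewrite /prop_for /continuous_at -(DE (a q0, p0) bp).
apply: cvg_trans; first by apply: near_eq_cvg; apply: filterS bD2 => up; exact: DE.
have Dk : 'D_(row_mx v 0) k' w @[w --> row_mx (a q0) (b p0)] -->
    'D_(row_mx v 0) k' (row_mx (a q0) (b p0)) by exact: (Ck.2 (row_mx v 0)).
exact: (cvg_comp _ _ cr Dk).
Qed.

Lemma partial_derive (Q P Y : topologicalType) (n m k : nat)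
    (A : set (chart R Q n)) (B : set (chart R P m)) (C : set (chart R Y k))
    (f : Q * P -> Y) (q0 : Q) (p0 : P) (a : chart R Q n) (c : chart R Y k) :
  charted A -> charted B ->
  C1_near (prod_atlas A B) C f (q0, p0) -> A a -> C c -> chart_dom a q0 ->
  chart_dom c (f (q0, p0)) ->
  differentiable (fun u => c (f (chart_inv a u, p0))) (a q0) /\
  forall v, {for p0, continuous
    (fun p => 'D_v (fun u => c (f (chart_inv a u, p))) (a q0))}.
Proof.
move=> hA hB Cf Aa Cc aq cq.
have [df Df] := partial_derive_joint hA hB Cf Aa Cc aq cq.
split; first exact: (nbhs_singleton df).
move=> v.
have cp : (a q0, p) @[p --> p0] --> (a q0, p0).
  by apply: cvg_pairT; [exact: cvg_cst|exact: cvg_id].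
exact: (cvg_comp _ _ cp (Df v)).
Qed.

End manifold_C1.

(** * The adjoint action and the function M_phi *)

Section lie_calculus.
Context (R : realType) (G : ptopologicalGroupType) (m : nat)
  (MG : smooth_manifold R G m) (hG : lie_group MG).

Let AG := atlas MG.
Let hAG : charted AG := smooth_atlas_charted (atlas_smooth MG).
Let hid := C1_near_id (atlas_smooth MG).
Let c1 := chart_at MG (1 : G)%g.

Lemma C1_near_mul p : C1_near (prod_atlas AG AG) AG (fun p : G * G => (p.1 * p.2)%g) p.
Proof. by apply: Ck1_C1_near => //; [exact: charted_prod|case: (hG 1)]. Qed.

Lemma C1_near_inv p : C1_near AG AG (fun g : G => (g^-1)%g) p.
Proof. by apply: Ck1_C1_near => //; case: (hG 1). Qed.

Section maps.
Context (Z : topologicalType) (k : nat) (A : set (chart R Z k)) (hA : charted A).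

Lemma C1_near_mul2 (f g : Z -> G) z : C1_near A AG f z -> C1_near A AG g z ->
  C1_near A AG (fun z => (f z * g z)%g) z.
Proof.
move=> Cf Cg.
apply: (@C1_near_comp _ _ _ _ _ _ _ A (prod_atlas AG AG) AG hA (charted_prod hAG hAG)
  (fun z => (f z, g z)) (fun p : G * G => (p.1 * p.2)%g)).
  exact: C1_near_pair.
exact: C1_near_mul.
Qed.

Lemma C1_near_inv2 (f : Z -> G) z : C1_near A AG f z ->
  C1_near A AG (fun z => (f z)^-1%g) z.
Proof.
move=> Cf; apply: (@C1_near_comp _ _ _ _ _ _ _ A AG AG hA hAG f
  (fun g : G => (g^-1)%g)) => //; exact: C1_near_inv.
Qed.

End maps.

Lemma lie_mul_continuous : continuous (fun p : G * G => (p.1 * p.2)%g).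
Proof. by move=> p; case: (C1_near_mul p). Qed.

(** The conjugated element comes first because partial derivatives are taken
    in the first variable and are continuous in the second one. *)
Lemma C1_near_conj p : C1_near (prod_atlas AG AG) AG
  (fun p : G * G => (p.2 * p.1 * p.2^-1)%g) p.
Proof.
have hA2 := charted_prod hAG hAG.
apply: C1_near_mul2 => //; last by apply: C1_near_inv2 => //; exact: C1_near_snd.
by apply: C1_near_mul2 => //; [exact: C1_near_snd|exact: C1_near_fst].
Qed.

Let conj1 (g : G) : (g * 1 * g^-1)%g = 1%g. Proof. by rewrite mulg1 mulgV. Qed.

Definition conj_chart (g : G) (u : 'rV[R]_m) : 'rV[R]_m :=
  c1 (g * chart_inv c1 u * g^-1)%g.

Lemma chart1_near : chart_near c1 1%g.
Proof. by apply: hAG.1; [exact: chart_at_atlas|exact: chart_at_dom]. Qed.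

Lemma conj_chart_partial (g : G) :
  differentiable (conj_chart g) (c1 1%g) /\
  forall v, {for g, continuous (fun g => 'D_v (conj_chart g) (c1 1%g))}.
Proof.
apply: (@partial_derive R G G G m m m AG AG AG
  (fun p : G * G => (p.2 * p.1 * p.2^-1)%g) 1%g g c1 c1 hAG hAG (C1_near_conj _));
  rewrite /= ?conj1; by [exact: chart_at_atlas|exact: chart_at_dom].
Qed.

Lemma AdE g Z : Ad MG g Z = 'D_Z (conj_chart g) (c1 1%g).
Proof.
rewrite (deriveE _ (conj_chart_partial g).1).
by rewrite /Ad /tangent_map conj1.
Qed.

Lemma Ad_diffE g : Ad MG g = 'd (conj_chart g) (c1 1%g) :> (_ -> _).
Proof. by rewrite /Ad /tangent_map conj1. Qed.

Lemma Ad_continuous Z : continuous (fun g => Ad MG g Z).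
Proof.
move=> g; have := (conj_chart_partial g).2 Z.
by under [in X in _ -> X]eq_fun do rewrite AdE.
Qed.

Lemma conj_chart_near g : \forall u \near c1 1%g, chart_dom c1 (g * chart_inv c1 u * g^-1)%g.
Proof.
have [cD _ _ _ _] := chart1_near.
have cc : continuous (fun h : G => (g * h * g^-1)%g).
  move=> h; have [cc _] := C1_near_conj (h, g).
  have cp : (h', g) @[h' --> h] --> (h, g).
    by apply: cvg_pairT; [exact: cvg_id|exact: cvg_cst].
  exact: (cvg_comp _ _ cp cc).
have : nbhs (1%g : G) ((fun h : G => (g * h * g^-1)%g) @^-1` chart_dom c1).
  by apply: cc; rewrite conj1.
exact: (chart_inv_cvg chart1_near).
Qed.

(** Conjugation by g h is the composite of two conjugations that fix the
    identity, so the chain rule applies in the chart at the identity. *)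
Lemma AdM g h Z : Ad MG (g * h)%g Z = Ad MG g (Ad MG h Z).
Proof.
have [cD cK _ _ _] := chart1_near.
have dh := (conj_chart_partial h).1; have dg := (conj_chart_partial g).1.
have e : conj_chart h (c1 1%g) = c1 1%g.
  by rewrite /conj_chart (chart_invK_near chart1_near) conj1.
have near_e : \forall u \near c1 1%g,
    (conj_chart g \o conj_chart h) u = conj_chart (g * h)%g u.
  apply: filterS (conj_chart_near h) => u hu.
  by rewrite /conj_chart /= cK ?inE// invgM !mulgA.
have dg' : differentiable (conj_chart g) (conj_chart h (c1 1%g)) by rewrite e.
rewrite [LHS]AdE -(near_eq_derive Z near_e) (derive_comp Z dh dg') e.
by rewrite [RHS]AdE [Ad MG h Z]AdE.
Qed.

End lie_calculus.

Lemma line_differentiable (R : realType) (V : normedModType R) (f : R -> V) (t : R) :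
  differentiable (fun u : 'rV[R]_1 => f (u 0 0)) (const_mx t) -> differentiable f t.
Proof.
move=> df; have -> : f = (fun u : 'rV[R]_1 => f (u 0 0)) \o (fun t => const_mx t).
  by apply/funext => s /=; rewrite mxE.
apply: differentiable_comp => //; apply: differentiable_rowP => j.
have -> : (fun s : R => (const_mx s : 'rV[R]_1) 0 j) = id.
  by apply/funext => s; rewrite mxE.
exact: (@ex_diff _ _ _ _ _ (id : R -> R) id (is_diff_id t)).
Qed.

Section M_phi_calculus.
Context (R : realType) (X : ptopologicalType) (n : nat) (MX : smooth_manifold R X n).
Context (F : R -> X -> X) (hF : C1_flow MX F).
Context (G : ptopologicalGroupType) (m : nat)
  (MG : smooth_manifold R G m) (hG : lie_group MG).
Context (phi : X -> G) (hphi : Ck_map 1 (atlas MX) (atlas MG) phi).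

Let AX := atlas MX.
Let AG := atlas MG.
Let AL := line_atlas (R := R).
Let hAX : charted AX := smooth_atlas_charted (atlas_smooth MX).
Let hAG : charted AG := smooth_atlas_charted (atlas_smooth MG).
Let hAL : charted AL := charted_line R.
Let c1 := chart_at MG (1 : G)%g.

(** The values of phi along an orbit, translated so that the curve starts at
    the identity. Its velocity, read in one fixed chart, is M_phi. *)
Definition displacement (t : R) (x : X) : G := (phi (F t x) * (phi x)^-1)%g.

Lemma C1_near_displacement p :
  C1_near (prod_atlas AL AX) AG (fun p : R * X => displacement p.1 p.2) p.
Proof.
have hA2 := charted_prod hAL hAX.
have Cphi x : C1_near AX AG phi x by apply: Ck1_C1_near.
have CF q : C1_near (prod_atlas AL AX) AX (fun p : R * X => F p.1 p.2) q.
  by apply: Ck1_C1_near => //; case: hF.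
apply: C1_near_mul2 => //.
  exact: (C1_near_comp hA2 hAX (CF p) (Cphi _)).
apply: C1_near_inv2 => //.
have Cs : C1_near (prod_atlas AL AX) AX snd p.
  by apply: C1_near_snd; exact: C1_near_id (atlas_smooth MX).
exact: (C1_near_comp hA2 hAX Cs (Cphi _)).
Qed.

Lemma displacement0 x : displacement 0 x = 1%g.
Proof. by rewrite /displacement; case: hF => -> _ _; rewrite mulgV. Qed.

Lemma displacement_partial x :
  differentiable (fun t => c1 (displacement t x)) 0 /\
  {for x, continuous (fun x => 'D_1 (fun t => c1 (displacement t x)) 0)}.
Proof.
pose a : chart R R 1 := Chart setT (fun t : R => const_mx t) (fun u => u 0 0).
have Cc : AG c1 by exact: chart_at_atlas.
have c1d : chart_dom c1 (displacement 0 x).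
  by rewrite displacement0; exact: chart_at_dom.
have [df cd] := @partial_derive R R X G 1 n m AL AX AG
  (fun p : R * X => displacement p.1 p.2) 0 x a c1 hAL hAX (C1_near_displacement _)
  erefl Cc I c1d.
have DE y : 'D_(const_mx 1) (fun u : 'rV[R]_1 => c1 (displacement (u 0 0) y)) (const_mx 0)
   = 'D_1 (fun t => c1 (displacement t y)) 0.
  by rewrite /derive /=; do 4 f_equal; apply/funext => h /=; rewrite !mxE.
split; last first.
  have := cd (const_mx 1); rewrite /prop_for /continuous_at /= DE.
  by under [in X in X -> _]eq_fun do rewrite DE.
exact: line_differentiable.
Qed.

(** The chain rule for the right translation by the inverse of phi x, from the
    chart at phi x to the chart at the identity. *)
Lemma M_phiE x : M_phi MG F phi x = 'D_1 (fun t => c1 (displacement t x)) 0.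
Proof.
have F0 : F 0 x = x by case: hF.
pose c := chart_at MG (phi x).
have Cc : AG c by exact: chart_at_atlas.
have cd : chart_dom c (phi x) by exact: chart_at_dom.
have Cc1 : AG c1 by exact: chart_at_atlas.
have cn := hAG.1 _ _ Cc cd.
have hA2 := charted_prod hAL hAX.
pose gam t := c (phi (F t x)).
pose k u := c1 (chart_inv c u * (phi x)^-1)%g.
have dk : differentiable k (c (phi x)).
  have Cr : C1_near AG AG (fun g : G => (g * (phi x)^-1)%g) (phi x).
    apply: C1_near_mul2 => //; first exact: C1_near_id (atlas_smooth MG) _.
    exact: C1_near_cst.
  apply: C1at_differentiable; apply: Cr.2 => //.
  by rewrite mulgV; exact: chart_at_dom.
have dgam : differentiable gam 0.
  apply: line_differentiable.
  have CF : C1_near (prod_atlas AL AX) AX (fun p : R * X => F p.1 p.2) (0, x).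
    by apply: Ck1_C1_near => //; case: hF.
  have Cphi y : C1_near AX AG phi y by apply: Ck1_C1_near.
  have Cg := C1_near_comp hA2 hAX CF (Cphi _).
  pose a : chart R R 1 := Chart setT (fun t : R => const_mx t) (fun u => u 0 0).
  have cd0 : chart_dom c ((phi \o (fun p : R * X => F p.1 p.2)) (0, x)).
    by rewrite /= F0.
  by have [] := @partial_derive R R X G 1 n m AL AX AG _ 0 x a c hAL hAX Cg
    erefl Cc I cd0.
have gam0 : gam 0 = c (phi x) by rewrite /gam F0.
have -> : M_phi MG F phi x = 'D_('D_1 gam 0) k (gam 0).
  rewrite gam0 (deriveE _ dk) /M_phi /tangent_map mulgV /lie_derivative /velocity F0.
  by rewrite derive1E.
have dk' : differentiable k (gam 0) by rewrite gam0.
rewrite -(derive_comp _ dgam dk'); apply: near_eq_derive.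
have [cD cK _ _ _] := cn.
have cF : (fun t => phi (F t x)) t @[t --> 0] --> phi (F 0 x).
  have cphi : continuous phi by case: hphi.
  have cFF : continuous (fun p : R * X => F p.1 p.2) by case: hF => _ _ [].
  have cp : (t, x) @[t --> (0 : R)] --> ((0 : R), x).
    by apply: cvg_pairT; [exact: cvg_id|exact: cvg_cst].
  exact: (cvg_comp _ _ (cvg_comp _ _ cp (cFF (0, x))) (cphi _)).
rewrite F0 in cF.
have : \forall t \near (0 : R), chart_dom c (phi (F t x)) by exact: cF.
by apply: filterS => t ct; rewrite /= /gam /k cK ?inE.
Qed.

(** In the formula of M_phiE the chart does not depend on x, and the
    displacement is C1 in t and x jointly. *)
Lemma M_phi_continuous : continuous (M_phi MG F phi : X -> 'rV[R]_m).
Proof.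
have -> : (M_phi MG F phi : X -> 'rV[R]_m) =
    (fun x => 'D_1 (fun t => c1 (displacement t x)) 0).
  by apply/funext => x; exact: M_phiE.
by move=> x; exact: (displacement_partial x).2.
Qed.

End M_phi_calculus.

(** * Differentiation under the integral sign *)

Lemma row_coord_norm (R : realType) n (w : 'rV[R]_n) j : `|w 0 j| <= `|w|.
Proof. by rewrite [leRHS]/Num.norm /= mx_normrE; exact: (le_bigmax _ (fun ij => `|w ij.1 ij.2|) (0, j)). Qed.

Lemma is_derive_line (R : realType) (V W : normedModType R) (f : V -> W)
    (x w : V) (t : R) : differentiable f (t *: w + x) ->
  is_derive t 1 (fun s : R => f (s *: w + x)) ('D_w f (t *: w + x)).
Proof.
move=> df.
have E : (fun h : R => h^-1 *: (f ((h *: 1 + t) *: w + x) - f (t *: w + x))) =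
    (fun h => h^-1 *: (f (h *: w + (t *: w + x)) - f (t *: w + x))).
  by apply/funext => h; rewrite addrA -scalerDl [h *: 1]mulr1.
have dv : derivable f (t *: w + x) w by exact: diff_derivable.
by split; [rewrite /derivable /= E | rewrite /derive /= E].
Qed.

Section differentiation_under_integral.
Context (R : realType) (K : ptopologicalType) (m : nat).
Hypothesis cK : compact [set: K].
Context (k : 'rV[R]_m -> K -> R) (u0 : 'rV[R]_m).
Hypothesis kc : forall u, continuous (k u).
Hypothesis kd : forall h : K, \forall up \near (u0, h), differentiable (k^~ up.2) up.1.
Hypothesis kD : forall (h : K) v, {for (u0, h), continuous (fun up => 'D_v (k^~ up.2) up.1)}.

Let D (j : 'I_m) (h : K) : R := 'D_(delta_mx 0 j) (k^~ h) u0.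

(** Each point of K has a neighbourhood on which the estimates hold for small
    w; compactness makes the smallness of w uniform. *)
Lemma partial_uniform (e : R) : 0 < e -> \forall w \near (0 : 'rV[R]_m), forall h,
  differentiable (k^~ h) (w + u0) /\
  forall j : 'I_m, `|'D_(delta_mx 0 j) (k^~ h) (w + u0) - D j h| <= e.
Proof.
move=> e0.
have H (h : K) : \forall h' \near h & w \near (0 : 'rV[R]_m),
    differentiable (k^~ h') (w + u0) /\
    forall j : 'I_m, `|'D_(delta_mx 0 j) (k^~ h') (w + u0) - D j h'| <= e.
  have c1 : ((hw : K * 'rV[R]_m).2 + u0, hw.1) @[hw --> (h, (0 : 'rV[R]_m))] --> (u0, h).
    apply: cvg_pairT; last exact: cvg_fst.
    rewrite -[X in _ --> X]add0r; apply: cvgD; [exact: cvg_snd|exact: cvg_cst].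
  have c2 : (u0, (hw : K * 'rV[R]_m).1) @[hw --> (h, (0 : 'rV[R]_m))] --> (u0, h).
    by apply: cvg_pairT; [exact: cvg_cst|exact: cvg_fst].
  have h1 : \forall hw \near (h, (0 : 'rV[R]_m)), differentiable (k^~ hw.1) (hw.2 + u0).
    exact: (c1 (fun up => differentiable (k^~ up.2) up.1) (@kd h)).
  have h2 : \forall hw \near (h, (0 : 'rV[R]_m)), forall j : 'I_m,
      `|'D_(delta_mx 0 j) (k^~ hw.1) (hw.2 + u0) - D j hw.1| <= e.
    have HH (j : 'I_m) : \forall hw \near (h, (0 : 'rV[R]_m)),
        `|'D_(delta_mx 0 j) (k^~ hw.1) (hw.2 + u0) - D j hw.1| <= e; last first.
      exact: filter_forall HH.
    have e1 := cvg_comp _ _ c1 (@kD h (delta_mx 0 j)).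
    have e2 := cvg_comp _ _ c2 (@kD h (delta_mx 0 j)).
    have E : ('D_(delta_mx 0 j) (k^~ hw.1) (hw.2 + u0) - D j hw.1)
        @[hw --> (h, (0 : 'rV[R]_m))] --> (0 : R).
      by rewrite -[X in _ --> X](subrr (D j h)); apply: cvgB; [exact: e1|exact: e2].
    move/cvgrPdist_le : E => /(_ e e0).
    by apply: filterS => hw; rewrite sub0r normrN.
  by apply: filterS2 h1 h2 => hw.
pose Q (w : 'rV[R]_m) (h : K) := differentiable (k^~ h) (w + u0) /\
    forall j : 'I_m, `|'D_(delta_mx 0 j) (k^~ h) (w + u0) - D j h| <= e.
have HQ : \forall w \near (0 : 'rV[R]_m), [set: K] `<=` Q w.
  exact: ((compact_near_coveringP [set: K]).1 cK 'rV[R]_m (nbhs (0 : 'rV[R]_m)) Q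
    (nbhs_filter _) (fun h _ => H h)).
by apply: filterS HQ => w Hw h; exact: Hw.
Qed.

(** The mean value theorem on the segment from u0 to w + u0. *)
Lemma partial_remainder (e : R) : 0 < e -> \forall w \near (0 : 'rV[R]_m), forall h,
  `|k (w + u0) h - k u0 h - \sum_j w 0 j * D j h| <= e * `|w|.
Proof.
(* The error e is shared between the m coordinates; m + 1 covers m = 0. *)
move=> e0; have e'0 : 0 < e / m.+1%:R by rewrite divr_gt0.
have /nbhs_ballP[r /= r0 Hr] := partial_uniform e'0.
apply/nbhs_ballP; exists r => // w wr h.
pose g (t : R) := k (t *: w + u0) h.
have tw (t : R) : 0 <= t <= 1 -> ball (0 : 'rV[R]_m) r (t *: w).
  move=> /andP[t0 t1]; move: wr; rewrite -!ball_normE /ball_ /= !sub0r !normrN normrZ.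
  by apply: le_lt_trans; rewrite ger0_norm// ler_piMl.
have gd (t : R) : 0 <= t <= 1 -> is_derive t 1 g ('D_w (k^~ h) (t *: w + u0)).
  move=> t01; have [dk _] := Hr _ (tw t t01) h.
  exact: is_derive_line.
have [t t01 tE] : exists2 t, 0 <= t <= 1 & g 1 - g 0 = 'D_w (k^~ h) (t *: w + u0).
  have cg : {within `[0, 1], continuous g}.
    apply: derivable_within_continuous => t; rewrite in_itv /= => t01.
    exact: (@ex_derive _ _ _ _ _ _ _ (gd t t01)).
  have gd' (t : R) : t \in `]0, 1[ -> is_derive t 1 g ('D_w (k^~ h) (t *: w + u0)).
    by rewrite in_itv /= => /andP[t0 t1]; apply: gd; rewrite !ltW.
  have [t t01 tE] := MVT ltr01 gd' cg; exists t.
    by move: t01; rewrite in_itv /= => /andP[t0 t1]; rewrite !ltW.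
  by rewrite tE subr0 mulr1.
have [dk Dk] := Hr _ (tw t t01) h.
have g1 : g 1 = k (w + u0) h by rewrite /g scale1r.
have g0 : g 0 = k u0 h by rewrite /g scale0r add0r.
rewrite -g1 -g0 tE (derive_basis w dk) -sumrB.
apply: (le_trans (ler_norm_sum _ _ _)).
apply: (@le_trans _ _ (\sum_(j < m) `|w| * (e / m.+1%:R))).
  apply: ler_sum => j _; rewrite -mulrBr normrM; apply: ler_pM => //.
  exact: row_coord_norm.
rewrite sumr_const card_ord -mulrnAr -[X in _ * X]mulr_natr mulrC ler_wpM2r//.
by rewrite -mulrA ler_piMr ?(ltW e0)// mulrC ler_pdivrMr ?ltr0n// mul1r ler_nat.
Qed.

Context (P : probability (borel K) R) (r : K -> R) (cr : continuous r).

Let Dc j : continuous (D j).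
Proof.
move=> h; have cp : (u0, h') @[h' --> h] --> (u0, h).
  by apply: cvg_pairT; [exact: cvg_cst|exact: cvg_id].
exact: (cvg_comp _ _ cp (@kD h (delta_mx 0 j))).
Qed.

Let D' (w : 'rV[R]_m) (h : K) : R := \sum_j w 0 j * D j h.

Let D'c w : continuous (D' w).
Proof.
move=> h; apply: cvg_big => [|j _]; first exact: add_continuous.
by apply: cvgM; [exact: cvg_cst|exact: Dc].
Qed.

Lemma differentiable_integral :
  differentiable (fun u => \int[P]_h (k u h * r h)) u0.
Proof.
pose L (w : 'rV[R]_m) := \int[P]_h (D' w h * r h).
have ir w : P.-integrable setT (EFin \o ((fun h => D' w h * r h) : borel K -> R)).
  by apply: (continuous_integrable P cK); apply: continuous_funM; [exact: D'c|exact: cr].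
have linL : linear L.
  move=> a u v; have -> : a *: L u + L v = a * L u + L v by [].
  rewrite /L -RintegralZl//.
  rewrite -RintegralD//; last first.
    by apply: (continuous_integrable P cK (f := fun h => a * (D' u h * r h))); apply: continuous_funM;
      [exact: cst_continuous|exact: continuous_funM].
  apply: eq_Rintegral => h _; rewrite mulrA -mulrDl; congr (_ * _).
  rewrite /D' mulr_sumr -big_split; apply: eq_bigr => j _.
  by rewrite !mxE mulrDl mulrA.
pose Lm := GRing.isLinear.Build _ _ _ _ L linL.
pose LL : {linear 'rV[R]_m -> R} := HB.pack L Lm.
have [M [M0 rM]] := compact_continuous_bounded cK cr.
have cL : continuous LL.
  have LE w : L w = \sum_j w 0 j * L (delta_mx 0 j).
    rewrite -[L w]/(LL w) [in LHS](row_sum_delta w) linear_sum.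
    by apply: eq_bigr => j _; rewrite linearZ.
  have -> : (LL : 'rV[R]_m -> R) = (fun w => \sum_j w 0 j * L (delta_mx 0 j)).
    by apply/funext.
  move=> w; rewrite /continuous_at.
  apply: (@cvg_big _ _ _ _ _ _ _ (nbhs w)) => [|j _]; first exact: add_continuous.
  by apply: cvgM; [exact: coord_continuous|exact: cvg_cst].
suff : differentiable (fun u => \int[P]_h (k u h * r h)) u0 /\
  'd (fun u => \int[P]_h (k u h * r h)) u0 = LL :> ('rV[R]_m -> R) by case.
apply: (differentiable_epsP cL) => e e0; have e'0 : 0 < e / M by rewrite divr_gt0.
apply: filterS (partial_remainder e'0) => w Hw /=.
have c1 := continuous_funM (@kc (w + u0)) cr; have c2 := continuous_funM (@kc u0) cr.
rewrite /L -RintegralB//; [|exact: (continuous_integrable P cK c1)|exact: (continuous_integrable P cK c2)].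
rewrite -RintegralB//; last exact: (continuous_integrable P cK (continuous_funB c1 c2)).
apply: normr_Rintegral_le.
  by apply: borel_continuous_real; apply: continuous_funB; [exact: continuous_funB|exact: continuous_funM].
move=> h; rewrite -!mulrBl normrM.
apply: (@le_trans _ _ (e / M * `|w| * M)); last by rewrite mulrAC divfK// gt_eqF.
by apply: ler_pM => //; exact: Hw.
Qed.

End differentiation_under_integral.

(** * Bump functions *)

Section C1_real.
Context (R : realType).
Implicit Types V W : normedModType R.

Lemma C1atD V W (f g : V -> W) x : C1at f x -> C1at g x -> C1at (fun y => f y + g y) x.
Proof.
move=> [df Df] [dg Dg]; split.
  by apply: filterS2 df dg => y fy gy; exact: differentiableD.
move=> v; have DE : \forall y \near x, 'D_v f y + 'D_v g y = 'D_v (fun y => f y + g y) y.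
  apply: filterS2 df dg => y fy gy; apply: esym; apply: deriveD; exact: diff_derivable.
rewrite /prop_for /continuous_at -(nbhs_singleton DE).
apply: cvg_trans; first by apply: near_eq_cvg; exact: DE.
by apply: (@cvgD _ _ _ (nbhs x)); [exact: Df|exact: Dg].
Qed.

Lemma C1at_sum V W (I : Type) (s : seq I) (f : I -> V -> W) x :
  (forall i, C1at (f i) x) -> C1at (fun y => \sum_(i <- s) f i y) x.
Proof.
move=> Cf; elim: s => [|i s IH].
  by under eq_fun do rewrite big_nil; exact: C1at_cst.
by under eq_fun do rewrite big_cons; exact: C1atD.
Qed.

Lemma C1atM V (f g : V -> R) x : C1at f x -> C1at g x -> C1at (fun y => f y * g y) x.
Proof.
move=> Cf Cg; have [df Df] := Cf; have [dg Dg] := Cg; split.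
  by apply: filterS2 df dg => y fy gy; exact: differentiableM.
have cf := differentiable_continuous (C1at_differentiable Cf).
have cg := differentiable_continuous (C1at_differentiable Cg).
move=> v; have DE : \forall y \near x,
    f y *: 'D_v g y + g y *: 'D_v f y = 'D_v (fun y => f y * g y) y.
  apply: filterS2 df dg => y fy gy; apply: esym; apply: deriveM; exact: diff_derivable.
rewrite /prop_for /continuous_at -(nbhs_singleton DE).
apply: cvg_trans; first by apply: near_eq_cvg; exact: DE.
by apply: (@cvgD _ _ _ (nbhs x)); apply: (@cvgZ _ _ _ (nbhs x)); [exact: cf|exact: Dg|exact: cg|exact: Df].
Qed.

Lemma derive_real W (g : R -> W) (t a : R) : differentiable g t ->
  'D_a g t = a *: 'D_1 g t.
Proof.
move=> dg; have ea : 'D_a g t = 'd g t a := deriveE a dg.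
have e1 : 'D_1 g t = 'd g t 1 := deriveE _ dg.
by rewrite ea e1 -linearZ; congr ('d g t _); rewrite [RHS]mulr1.
Qed.

Lemma C1at_compR V W (f : V -> R) (g : R -> W) x :
  C1at f x -> C1at g (f x) -> C1at (g \o f) x.
Proof.
move=> Cf Cg; have [df Df] := Cf; have [dg Dg] := Cg.
have cf : {for x, continuous f} by exact/differentiable_continuous/C1at_differentiable.
have dgf : \forall y \near x, differentiable g (f y) by exact: (cf _ dg).
split.
  by apply: filterS2 df dgf => y ? ?; exact: differentiable_comp.
move=> v.
have DE : \forall y \near x, 'D_v f y *: 'D_1 g (f y) = 'D_v (g \o f) y.
  apply: filterS2 df dgf => y fy gy.
  exact: (esym (etrans (derive_comp v fy gy) (derive_real _ gy))).
rewrite /prop_for /continuous_at -(nbhs_singleton DE).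
apply: cvg_trans; first by apply: near_eq_cvg; exact: DE.
apply: (@cvgZ _ _ _ (nbhs x)); first exact: Df.
exact: (cvg_comp f _ cf (Dg 1)).
Qed.

(** Squaring makes the positive part continuously differentiable. *)
Definition relu2 (s : R) : R := Num.max 0 s ^+ 2.

Lemma relu2_remainder (s h : R) :
  `|relu2 (h + s) - relu2 s - 2 * Num.max 0 s * h| <= h ^+ 2.
Proof.
rewrite /relu2 ler_norml; case: (leP 0 s) => s0; case: (leP 0 (h + s)) => hs0;
  apply/andP; split; nra.
Qed.

Lemma C1at_relu2 (s : R) : C1at relu2 s.
Proof.
have dr (t : R) : differentiable relu2 t /\
    'd relu2 t = (fun h => 2 * Num.max 0 t * h) :> (R -> R).
  have linL : linear (fun h : R => 2 * Num.max 0 t * h).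
    by move=> a u w; rewrite mulrDr mulrCA.
  pose Lm := GRing.isLinear.Build _ _ _ _ _ linL.
  pose L : {linear R -> R} := HB.pack (fun h : R => 2 * Num.max 0 t * h) Lm.
  apply: (@differentiable_epsP _ _ _ relu2 t L).
    by move=> h; apply: cvgM; [exact: cvg_cst|exact: cvg_id].
  move=> e e0; apply/nbhs_ballP; exists e => //= h.
  rewrite -ball_normE /= sub0r normrN => he.
  apply: (le_trans (relu2_remainder t h)).
  by rewrite -[h ^+ 2]ger0_norm ?sqr_ge0// normrX expr2 ler_pM//; exact: ltW.
split.
  exact: (@filterE _ (nbhs s) (nbhs_filter s) _ (fun t => (dr t).1)).
move=> v; have -> : 'D_v relu2 = fun t => 2 * Num.max 0 t * v.
  by apply/funext => t; have [dt dE] := dr t; rewrite (deriveE _ dt) dE.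
have cmax : continuous (fun t : R => Num.max 0 t).
  have -> : (fun t : R => Num.max 0 t) = (fun t => 2^-1 * (t + `|t|)).
    apply/funext => t; case: (leP 0 t) => t0; first by rewrite ger0_norm//; lra.
    by rewrite ltr0_norm// subrr mulr0.
  move=> t; apply: (@cvgM _ _ (nbhs t)); first exact: cvg_cst.
  by apply: (@cvgD _ _ _ (nbhs t)); [exact: cvg_id|exact: norm_continuous].
apply: (@cvgM _ _ (nbhs s)); last exact: cvg_cst.
by apply: (@cvgM _ _ (nbhs s)); [exact: cvg_cst|exact: cmax].
Qed.

End C1_real.

Section bump.
Context (R : realType) (G : ptopologicalType) (m : nat) (MG : smooth_manifold R G m).
Hypothesis cG : compact [set: G].

Let AG := atlas MG.
Let hAG : charted AG := smooth_atlas_charted (atlas_smooth MG).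
Let AL := line_atlas (R := R).

Lemma C1_near_local (X Y : topologicalType) n k (A : set (chart R X n))
    (B : set (chart R Y k)) (f g : X -> Y) p : charted A ->
  (\forall x \near p, f x = g x) -> C1_near A B f p -> C1_near A B g p.
Proof.
move=> hA fg [cf Cf]; have fgp := nbhs_singleton fg; split.
  rewrite /prop_for /continuous_at -fgp; apply: cvg_trans cf.
  by apply: near_eq_cvg; apply: filterS fg => x.
move=> a b Aa Bb ap; rewrite -fgp => bp.
apply: C1at_near (Cf a b Aa Bb ap bp).
have : \forall u \near a p, f (chart_inv a u) = g (chart_inv a u).
  exact: (chart_inv_cvg (hA.1 _ _ Aa ap) fg).
by apply: filterS => u /= ->.
Qed.

Lemma C1_near_real (X : topologicalType) n (A : set (chart R X n)) (f : X -> R) p :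
  {for p, continuous f} ->
  (forall a, A a -> chart_dom a p -> C1at (f \o chart_inv a) (a p)) ->
  C1_near A AL f p.
Proof.
move=> cf Cf; split => // a _ Aa -> ap _; apply/C1at_rowP => j.
by under eq_fun do rewrite /= mxE; exact: Cf.
Qed.

(** In a chart, the squared positive part of r ^ 2 - |w| ^ 2 is C1 and
    vanishes outside a ball. Extended by zero it remains C1 at points outside
    the chart, because it vanishes off a set W whose closure lies in the
    chart. *)
Lemma bump_exists (p0 : G) (V : set G) : nbhs p0 V ->
  exists f : G -> R, [/\ forall p, C1_near AG AL f p, forall p, 0 <= f p,
    0 < f p0 & forall p, f p != 0 -> V p].
Proof.
move=> Vp; pose c := chart_at MG p0.
have Ac : AG c by exact: chart_at_atlas.
have cp0 : chart_dom c p0 by exact: chart_at_dom.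
have cn := hAG.1 _ _ Ac cp0; have [cD cK cc ci cI] := cn.
have hG := manifold_hausdorff MG.
have [W Wp WV] := @compact_regular G p0 setT hG cG (@filterT _ _ _) _ (filterI cD Vp).
have N : \forall w \near c p0, (c @` chart_dom c) w /\ W (chart_inv c w).
  apply: filterI cI _; exact: (chart_inv_cvg cn Wp).
have /nbhs_ballP[r /= r0 rN] := N.
pose psi (w : 'rV[R]_m) := relu2 (r ^+ 2 + \sum_j (-1) * ((w 0 j - c p0 0 j) * (w 0 j - c p0 0 j))).
have Cpsi w : C1at psi w.
  apply: (@C1at_compR _ _ _ _ (@relu2 R)); last exact: C1at_relu2.
  apply: C1atD; first exact: C1at_cst.
  apply: C1at_sum => j; apply: C1atM; first exact: C1at_cst.
  have Cj : C1at (fun w : 'rV[R]_m => w 0 j - c p0 0 j) w.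
    by apply: C1atD; [exact: C1at_coord|exact: C1at_cst].
  exact: C1atM.
have psi_ball w : psi w != 0 -> ball (c p0) r w.
  move=> pw; have S : \sum_j (w 0 j - c p0 0 j) ^+ 2 < r ^+ 2.
    rewrite ltNge; apply/negP => le; move: pw; rewrite /psi /relu2.
    have -> : \sum_j -1 * ((w 0 j - c p0 0 j) * (w 0 j - c p0 0 j))
        = - \sum_j (w 0 j - c p0 0 j) ^+ 2.
      by rewrite -sumrN; apply: eq_bigr => j _; rewrite mulN1r expr2.
    rewrite max_l ?expr0n ?eqxx//; lra.
  split=> // i j; rewrite -ball_normE /= ord1 distrC.
  rewrite -(@ltr_pXn2r _ 2) ?nnegrE ?(ltW r0)// real_normK ?num_real//.
  apply: le_lt_trans S; rewrite (bigD1 j)//= lerDl sumr_ge0// => l _.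
  exact: sqr_ge0.
pose f p := if `[< chart_dom c p >] then psi (c p) else 0.
have fW p : f p != 0 -> W p.
  rewrite /f; case: asboolP; last by rewrite eqxx.
  move=> cp /psi_ball /rN[_]; by rewrite cK ?inE.
exists f; split.
- move=> p; have [cp|Ncp] := pselect (chart_dom c p).
    have [cDp cKp ccp _ _] := hAG.1 _ _ Ac cp.
    apply: (@C1_near_local _ _ _ _ _ _ (psi \o c)) => //.
      by apply: filterS cDp => q cq; rewrite /= /f asboolT.
    apply: C1_near_real.
      apply: continuous_comp => //.
      exact: differentiable_continuous (C1at_differentiable (Cpsi _)).
    move=> a Aa ap; have an := hAG.1 _ _ Aa ap.
    have Ca := (C1_near_id (atlas_smooth MG) p).2 a c Aa Ac ap cp.
    exact: (C1at_comp Ca (Cpsi _)).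
  apply: (@C1_near_local _ _ _ _ _ _ (cst (0 : R))) => //; last first.
    apply: C1_near_real; first exact: cst_continuous.
    by move=> a _ _; exact: (C1at_cst (0 : R)).
  have : nbhs p (~` closure W).
    apply: open_nbhs_nbhs; split; first exact: closed_openC (@closed_closure _ _).
    by move=> /WV[].
  apply: filterS => q nq; apply/eqP; rewrite eq_sym; apply: contrapT => /negP fq.
  by apply: nq; apply: subset_closure; exact: fW.
- move=> p; rewrite /f; case: ifP => // _; exact: sqr_ge0.
- rewrite /f asboolT// /psi big1 ?addr0 => [|j _].
    by rewrite /relu2 max_r ?sqr_ge0// !exprn_gt0.
  by rewrite subrr mulr0 mulr0.
- by move=> p /fW/subset_closure/WV[].
Qed.

End bump.

(** * Complex matrices and Haar measure *)

Section complex_aux.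
Context (R : realType).
Implicit Types z w : R[i].

Lemma ReM z w : complex.Re (z * w) = complex.Re z * complex.Re w - complex.Im z * complex.Im w.
Proof. by case: z => a b; case: w. Qed.

Lemma ImM z w : complex.Im (z * w) = complex.Re z * complex.Im w + complex.Im z * complex.Re w.
Proof. by case: z => a b; case: w. Qed.

Lemma ReD z w : complex.Re (z + w) = complex.Re z + complex.Re w.
Proof. by case: z => a b; case: w. Qed.

Lemma ImD z w : complex.Im (z + w) = complex.Im z + complex.Im w.
Proof. by case: z => a b; case: w. Qed.

Lemma Re_sum (I : Type) (s : seq I) (f : I -> R[i]) :
  complex.Re (\sum_(i <- s) f i) = \sum_(i <- s) complex.Re (f i).
Proof.
by elim: s => [|i s IH]; rewrite ?big_nil// !big_cons ReD IH.
Qed.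

Lemma Im_sum (I : Type) (s : seq I) (f : I -> R[i]) :
  complex.Im (\sum_(i <- s) f i) = \sum_(i <- s) complex.Im (f i).
Proof.
by elim: s => [|i s IH]; rewrite ?big_nil// !big_cons ImD IH.
Qed.

Lemma complexE z w : complex.Re z = complex.Re w -> complex.Im z = complex.Im w -> z = w.
Proof. by case: z => a b; case: w => c e /= -> ->. Qed.

(** A norm equivalent to the modulus, linear in the absolute values of the
    real and imaginary parts. *)
Definition taxi z : R := `|complex.Re z| + `|complex.Im z|.

Lemma taxi_ge0 z : 0 <= taxi z. Proof. by rewrite addr_ge0. Qed.

Lemma taxi0 z : taxi z <= 0 -> z = 0.
Proof.
case: z => a b; rewrite /taxi /= => h.
have a0 : `|a| = 0 by apply/eqP; rewrite eq_le normr_ge0 andbT; have := normr_ge0 b; lra.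
have b0 : `|b| = 0 by apply/eqP; rewrite eq_le normr_ge0 andbT; have := normr_ge0 a; lra.
by move/normr0_eq0 : a0 => ->; move/normr0_eq0 : b0 => ->.
Qed.

Lemma taxiD z w : taxi (z + w) <= taxi z + taxi w.
Proof.
case: z => a b; case: w => c e; rewrite /taxi /= addrACA; apply: lerD; exact: ler_normD.
Qed.

Lemma taxiM z w : taxi (z * w) <= taxi z * taxi w.
Proof.
rewrite /taxi ReM ImM; case: z => a b; case: w => c e /=.
rewrite mulrDl !mulrDr -!normrM.
have := ler_normB (a * c) (b * e); have := ler_normD (a * e) (b * c).
by move: `|_ - _| `|_ + _| `|a * c| `|a * e| `|b * c| `|b * e| => *; lra.
Qed.

Lemma taxi_sum (I : Type) (s : seq I) (f : I -> R[i]) :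
  taxi (\sum_(i <- s) f i) <= \sum_(i <- s) taxi (f i).
Proof.
elim: s => [|i s IH]; first by rewrite !big_nil /taxi /= normr0 addr0.
by rewrite !big_cons (le_trans (taxiD _ _))// lerD2l.
Qed.

(** Diagonal dominance: if v A = 0, the column of the largest coordinate of v
    gives a contradiction unless that coordinate vanishes. *)
Lemma diag_dominant_unit d (A : 'M[R[i]]_d) (c : R) : 0 < c ->
  (forall i j, d%:R * taxi (A i j - Complex (c *+ (i == j)) 0) < c) -> A \in unitmx.
Proof.
move=> c0 Ac; rewrite -row_free_unit -kermx_eq0; apply/rowV0P => v.
move=> /sub_kermxP vA; apply/rowP => j; rewrite mxE.
have [i0 _ i0max] := @arg_maxP _ _ _ j xpredT (fun i => taxi (v 0 i)) isT.
have {}i0max l : taxi (v 0 l) <= taxi (v 0 i0) by exact: i0max.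
have d0 : (0 < d)%N by apply: leq_ltn_trans (ltn_ord j).
suff v0 : taxi (v 0 i0) <= 0.
  by apply: taxi0; rewrite (le_trans (i0max j)).
have E : \sum_l v 0 l * (A l i0 - Complex (c *+ (l == i0)) 0) = - (Complex c 0 * v 0 i0).
  have S1 : \sum_l v 0 l * A l i0 = 0.
    by have := congr1 (fun B : 'rV_d => B 0 i0) vA; rewrite [in LHS]mxE [in RHS]mxE.
  have S2 : \sum_l v 0 l * Complex (c *+ (l == i0)) 0 = Complex c 0 * v 0 i0.
    rewrite (bigD1 i0)//= eqxx mulr1n mulrC big1; first by rewrite addr0.
    by move=> l /negPf ->; rewrite mulr0n; exact: mulr0.
  transitivity (\sum_l (v 0 l * A l i0 - v 0 l * Complex (c *+ (l == i0)) 0)).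
    by apply: eq_bigr => l _; exact: mulrBr.
  by rewrite sumrB S1 S2 sub0r.
have tE : taxi (- (Complex c 0 * v 0 i0)) = c * taxi (v 0 i0).
  case: (v 0 i0) => a b; rewrite /taxi /= !mul0r subr0 addr0 !normrN !normrM.
  by rewrite gtr0_norm// -mulrDr.
have := congr1 taxi E; rewrite tE => cE.
have : c * taxi (v 0 i0) <= \sum_l taxi (v 0 i0) * taxi (A l i0 - Complex (c *+ (l == i0)) 0).
  rewrite -cE (le_trans (taxi_sum _ _))//; apply: ler_sum => l _.
  by rewrite (le_trans (taxiM _ _))// ler_wpM2r ?taxi_ge0// i0max.
rewrite leNgt => H; rewrite leNgt; apply/negP => v0; move: H => /negP; apply.
have -> : c * taxi (v 0 i0) = \sum_(l < d) taxi (v 0 i0) * (c / d%:R).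
  rewrite sumr_const card_ord -mulrnAr -[(c / _) *+ d]mulr_natr divfK ?pnatr_eq0 -?lt0n//.
  by rewrite mulrC.
apply: ltr_sum => [|l _]; first by apply/hasP; exists i0; rewrite ?mem_index_enum.
by rewrite ltr_pM2l// ltr_pdivlMr ?ltr0n// mulrC.
Qed.

End complex_aux.

Section haar.
Context (R : realType) (G : ptopologicalGroupType) (m : nat)
  (MG : smooth_manifold R G m) (hG : lie_group MG) (cG : compact [set: G]).
Context (muG : probability (borel G) R) (hmu : normalised_haar muG).

Lemma lie_mull_continuous (g : G) : continuous (fun h : G => (g * h)%g).
Proof.
move=> h; have cp : (g, h') @[h' --> h] --> (g, h).
  by apply: cvg_pairT; [exact: cvg_cst|exact: cvg_id].
exact: (cvg_comp _ _ cp (@lie_mul_continuous _ _ _ _ hG (g, h))).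
Qed.

(** Translates of a null neighbourhood would give every point a basic null
    neighbourhood, and countably many of these would cover G. *)
Lemma haar_open_gt0 (O : set G) (x : G) : open O -> O x -> (0 < muG O)%E.
Proof.
move=> oO Ox; rewrite lt0e measure_ge0 andbT; apply/eqP => O0.
have [B [oB bB]] := second_countable_seq (manifold_second_countable MG).
have null (g : G) : exists2 i, B i g & muG (B i) = 0%E.
  have cg := @lie_mull_continuous (x * g^-1)%g.
  have : nbhs g ((fun h : G => (x * g^-1 * h)%g) @^-1` O).
    by apply: cg; rewrite -mulgA mulVg mulg1; apply: open_nbhs_nbhs.
  move=> /bB[i Bg BO]; exists i => //; apply/eqP; rewrite eq_le measure_ge0 andbT.
  rewrite -O0 -(hmu (x * g^-1)%g (borel_open oO)).
  have mB : measurable (B i : set (borel G)) by apply: borel_open; exact: oB.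
  have mO : measurable ((fun h : G => (x * g^-1 * h)%g) @^-1` O : set (borel G)).
    by apply: borel_open; move/continuousP : cg; apply.
  exact: (le_measure muG (mem_set mB) (mem_set mO) BO).
pose C i := if muG (B i) == 0%E then B i else set0.
have CT : \bigcup_i C i = setT.
  apply/seteqP; split => // g _; have [i Bg Bi] := null g.
  by exists i => //; rewrite /C Bi eqxx.
have : muG (\bigcup_i C i) = 0%E.
  have mC i : measurable (C i : set (borel G)).
    by rewrite /C; case: ifPn => // _; exact: borel_open.
  apply: measure_negligible; first exact: bigcupT_measurable.
  apply: negligible_bigcup => i; apply/negligibleP; first exact: mC.
  by rewrite /C; case: ifPn => [/eqP//|_]; exact: measure0.
rewrite CT; have -> : muG setT = 1%E by exact: probability_setT.
by move=> /eqP; rewrite onee_eq0.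
Qed.

Lemma haar_Rintegral (g : G) (f : G -> R) : continuous f ->
  \int[muG]_h f (g * h)%g = \int[muG]_h f h.
Proof.
move=> cf; have cg := @lie_mull_continuous g.
apply: esym; apply: (@Rintegral_image _ _ (borel G) (borel G) R muG muG (fun h : G => (g * h)%g)).
- exact: borel_continuous.
- by move=> A mA; rewrite hmu.
- exact: borel_continuous_real.
- apply: (continuous_integrable muG cG (f := fun h => f (g * h)%g)) => h.
  exact: (continuous_comp (cg h) (cf _)).
Qed.

End haar.

(** * Differentiability of continuous representations *)

Section representation_smooth.
Context (R : realType) (G : ptopologicalGroupType) (m : nat)
  (MG : smooth_manifold R G m) (hG : lie_group MG) (cG : compact [set: G]).
Context (muG : probability (borel G) R) (hmu : normalised_haar muG).
Context (d : nat) (rho : G -> 'M[R[i]]_d) (hrho : unitary_representation rho).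

Let AG := atlas MG.
Let AL := line_atlas (R := R).
Let hAG : charted AG := smooth_atlas_charted (atlas_smooth MG).
Let c1 := chart_at MG (1 : G)%g.

Let cRe i j : continuous (fun g : G => complex.Re (rho g i j) : R).
Proof. by case: hrho => _ _ _ /(_ i j)[]. Qed.

Let cIm i j : continuous (fun g : G => complex.Im (rho g i j) : R).
Proof. by case: hrho => _ _ _ /(_ i j)[]. Qed.

(** The integral of w(h) rho(h) over G, that is, the action of w as an element
    of the convolution algebra of G. *)
Definition weighted (w : G -> R) : 'M[R[i]]_d := \matrix_(i, j)
  Complex (\int[muG]_h (w h * complex.Re (rho h i j)))
          (\int[muG]_h (w h * complex.Im (rho h i j))).

Section weight.
Context (f : G -> R) (Cf : forall p, C1_near AG AL f p).

Let cf : continuous f. Proof. by move=> p; case: (Cf p). Qed.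

(** Translation invariance moves the variable g from rho, about which only
    continuity is known, to the weight f, which is C1. *)
Lemma weighted_translate (g : G) :
  weighted (fun h => f (g^-1 * h)%g) = rho g *m weighted f.
Proof.
have [_ rhoM _ _] := hrho.
have cinv : continuous (fun h : G => f (g^-1 * h)%g).
  by move=> h; exact: (continuous_comp (@lie_mull_continuous _ _ _ _ hG g^-1%g h) (@cf _)).
have shift (r : G -> R) : continuous r ->
    \int[muG]_h (f (g^-1 * h)%g * r h) = \int[muG]_h (f h * r (g * h)%g).
  move=> cr; rewrite -(haar_Rintegral hG cG hmu g (f := fun h => f (g^-1 * h)%g * r h)).
    by apply: eq_Rintegral => h _; rewrite mulgA mulVg mul1g.
  exact: continuous_funM.
have iRe i j := continuous_integrable muG cG (continuous_funM cf (@cRe i j)).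
have iIm i j := continuous_integrable muG cG (continuous_funM cf (@cIm i j)).
have iaRe (a : R) i j : muG.-integrable setT
    (EFin \o ((fun h => a * (f h * complex.Re (rho h i j))) : borel G -> R)).
  by apply: (continuous_integrable muG cG); apply: continuous_funM; [exact: cst_continuous|exact: continuous_funM].
have iaIm (a : R) i j : muG.-integrable setT
    (EFin \o ((fun h => a * (f h * complex.Im (rho h i j))) : borel G -> R)).
  by apply: (continuous_integrable muG cG); apply: continuous_funM; [exact: cst_continuous|exact: continuous_funM].
apply/matrixP => i j; rewrite [LHS]mxE [RHS]mxE; apply: complexE => /=.
  rewrite shift// Re_sum.
  have -> : (fun h => f h * complex.Re (rho (g * h)%g i j)) =
      (fun h => \sum_l (complex.Re (rho g i l) * (f h * complex.Re (rho h l j)) -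
                        complex.Im (rho g i l) * (f h * complex.Im (rho h l j)))).
    apply/funext => h; rewrite rhoM mxE Re_sum mulr_sumr; apply: eq_bigr => l _.
    by rewrite ReM mulrBr !(mulrCA (f h)).
  have [|_ ->] := @Rintegral_sum _ _ _ muG 'I_d (index_enum _)
    (fun l h => complex.Re (rho g i l) * (f h * complex.Re (rho h l j)) -
                        complex.Im (rho g i l) * (f h * complex.Im (rho h l j))); last first.
    apply: eq_bigr => l _; rewrite ReM !mxE /= RintegralB// !RintegralZl//.
  move=> l; apply: (continuous_integrable muG cG); apply: continuous_funB; (apply: continuous_funM; first exact: cst_continuous);
    exact: continuous_funM.
rewrite shift// Im_sum.
have -> : (fun h => f h * complex.Im (rho (g * h)%g i j)) =
    (fun h => \sum_l (complex.Re (rho g i l) * (f h * complex.Im (rho h l j)) +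
                      complex.Im (rho g i l) * (f h * complex.Re (rho h l j)))).
  apply/funext => h; rewrite rhoM mxE Im_sum mulr_sumr; apply: eq_bigr => l _.
  by rewrite ImM mulrDr !(mulrCA (f h)).
have [|_ ->] := @Rintegral_sum _ _ _ muG 'I_d (index_enum _)
  (fun l h => complex.Re (rho g i l) * (f h * complex.Im (rho h l j)) +
                      complex.Im (rho g i l) * (f h * complex.Re (rho h l j))); last first.
  by apply: eq_bigr => l _; rewrite ImM !mxE /= RintegralD// !RintegralZl//.
by move=> l; apply: integrableDR.
Qed.

Lemma weighted_differentiable (r : G -> R) : continuous r ->
  differentiable (fun u => \int[muG]_h (f ((chart_inv c1 u)^-1 * h)%g * r h)) (c1 1%g).
Proof.
move=> cr.
pose k (u : 'rV[R]_m) (h : G) : R := f ((chart_inv c1 u)^-1 * h)%g.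
have hA2 := charted_prod hAG hAG.
have Ac1 : AG c1 by exact: chart_at_atlas.
have c11 : chart_dom c1 1%g by exact: chart_at_dom.
have Ck p : C1_near (prod_atlas AG AG) AL (fun p : G * G => f (p.1^-1 * p.2)%g) p.
  apply: (@C1_near_comp _ _ _ _ _ _ _ _ AG AL hA2 hAG (fun p : G * G => (p.1^-1 * p.2)%g) f) => //.
  apply: (C1_near_mul2 hG) => //; last first.
    by apply: C1_near_snd; exact: C1_near_id (atlas_smooth MG).
  apply: (C1_near_inv2 hG) => //.
  by apply: C1_near_fst; exact: C1_near_id (atlas_smooth MG).
pose a : chart R R 1 := Chart setT (fun t : R => const_mx t) (fun u => u 0 0).
have PD (h : G) := partial_derive_joint (c := a) hAG hAG (Ck (1%g, h)) Ac1 erefl c11 I.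
have kE (h : G) : k^~ h = (fun u => (const_mx (f ((chart_inv c1 u)^-1 * h)%g) : 'rV[R]_1) 0 0).
  by apply/funext => u; rewrite mxE.
have kd (h : G) : \forall up \near (c1 1%g, h), differentiable (k^~ up.2) up.1.
  have [H _] := PD h; apply: filterS H => up H.
  by rewrite kE; exact: differentiable_row.
apply: (@differentiable_integral R G m cG k (c1 1%g) _ kd _ muG r cr).
  move=> u h; exact: (continuous_comp (@lie_mull_continuous _ _ _ _ hG (chart_inv c1 u)^-1%g h) (@cf _)).
move=> h v; have [H Dv] := PD h.
have DE : \forall up \near (c1 1%g, h),
    ('D_v (fun u => a (f ((chart_inv c1 u)^-1 * up.2)%g)) up.1) 0 0 = 'D_v (k^~ up.2) up.1.
  apply: filterS H => up Hd; rewrite kE; exact: derive_row.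
rewrite /prop_for /continuous_at -(nbhs_singleton DE).
apply: cvg_trans; first by apply: near_eq_cvg; exact: DE.
by apply: cvg_coord; exact: Dv.
Qed.

End weight.

(** A weight concentrated near the identity yields a matrix close to a
    multiple of rho 1, the identity matrix. *)
Lemma weighted_unit : exists2 f : G -> R,
  (forall p, C1_near AG AL f p) & weighted f \in unitmx.
Proof.
(* Each entry of the weighted matrix is off by at most 2 e c from that of c
   times the identity, where c is the total weight, and d * 2 e < 1. *)
pose e : R := (4 * d.+1%:R)^-1.
have e0 : 0 < e by rewrite invr_gt0 mulr_gt0 ?ltr0n.
have [rho1 _ _ _] := hrho.
pose V : set G := [set h | forall i j, `|complex.Re (rho h i j) - (i == j)%:R| <= e /\
  `|complex.Im (rho h i j)| <= e].
have nV : nbhs (1%g : G) V.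
  have H (i j : 'I_d) : \forall h \near (1%g : G), `|complex.Re (rho h i j) - (i == j)%:R| <= e /\
      `|complex.Im (rho h i j)| <= e.
    have h1 : \forall h \near (1%g : G), `|complex.Re (rho h i j) - (i == j)%:R| <= e.
      have /cvgrPdist_le /(_ e e0) := @cRe i j 1%g.
      apply: filterS => h; rewrite rho1 mxE distrC.
      by case: (i == j).
    have h2 : \forall h \near (1%g : G), `|complex.Im (rho h i j)| <= e.
      have /cvgrPdist_le /(_ e e0) := @cIm i j 1%g.
      apply: filterS => h; rewrite rho1 mxE distrC.
      by case: (i == j); rewrite subr0.
    exact: filterI h1 h2.
  have H' (i : 'I_d) : \forall h \near (1%g : G), forall j : 'I_d,
      `|complex.Re (rho h i j) - (i == j)%:R| <= e /\ `|complex.Im (rho h i j)| <= e.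
    exact: filter_forall (H i).
  exact: filter_forall H'.
have [f [Cf f0 f1 fV]] := bump_exists MG cG nV.
exists f => //.
have cf : continuous f by move=> p; case: (Cf p).
pose c := \int[muG]_h f h.
have c0 : 0 < c.
  pose O := [set h | f 1%g / 2 < f h].
  have oO : open O.
    have /continuousP cfo := cf.
    exact: (cfo [set y | f 1%g / 2 < y] (@open_gt _ _)).
  have O1 : O 1%g by rewrite /O /=; lra.
  have O0 := haar_open_gt0 hG hmu oO O1.
  have mO := borel_open oO.
  have : \int[muG]_h (f 1%g / 2 * \1_O h) <= c.
    apply: le_Rintegral => //; last 1 first.
    - move=> h _; rewrite indicE; case: (boolP (h \in O)) => [|_]; last by rewrite mulr0.
      by rewrite inE mulr1 => /ltW.
    - apply: (@bounded_integrable _ _ _ _ _ (f 1%g / 2)).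
        by apply: measurable_funM => //; exact: measurable_indic.
      move=> h; rewrite indicE; case: (_ \in _); rewrite ?mulr1 ?mulr0 ?normr0 ?gtr0_norm//; lra.
    - exact: (continuous_integrable muG cG).
  rewrite RintegralZl// ?Rintegral_indic//; last first.
    apply: (@bounded_integrable _ _ _ _ _ 1); first exact: measurable_indic.
    by move=> h; rewrite indicE; case: (_ \in _); rewrite ?normr1 ?normr0.
  apply: lt_le_trans; rewrite mulr_gt0 ?divr_gt0// fine_gt0// O0 /=.
  by rewrite (le_lt_trans (probability_le1 _ mO)) ?ltry.
have bound (r : G -> R) (a : R) : continuous r -> (forall h, V h -> `|r h - a| <= e) ->
    `|\int[muG]_h (f h * r h) - c * a| <= e * c.
  move=> cr ra.
  have ifr := continuous_integrable muG cG (continuous_funM cf cr).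
  have ifa : muG.-integrable setT (EFin \o ((fun h => f h * a) : borel G -> R)).
    by apply: (continuous_integrable muG cG); apply: continuous_funM => //; exact: cst_continuous.
  have ief : muG.-integrable setT (EFin \o ((fun h => e * f h) : borel G -> R)).
    by apply: (continuous_integrable muG cG); apply: continuous_funM => //; exact: cst_continuous.
  rewrite -RintegralZr//; last exact: (continuous_integrable muG cG).
  rewrite -RintegralZl//; last exact: (continuous_integrable muG cG).
  rewrite -RintegralB//.
  have idiff : muG.-integrable setT (EFin \o ((fun h => f h * r h - f h * a) : borel G -> R)).
    by apply: (continuous_integrable muG cG); apply: continuous_funB; apply: continuous_funM => //; exact: cst_continuous.
  apply: (le_trans (le_normr_Rintegral measurableT idiff)).
  apply: le_Rintegral => //.
    apply: (continuous_integrable muG cG (f := fun h => `|f h * r h - f h * a|)) => h.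
    apply: cvg_norm; apply: (continuous_funB (f := fun h => f h * r h) (g := fun h => f h * a)).
      exact: continuous_funM.
    by apply: continuous_funM => //; exact: cst_continuous.
  move=> h _; rewrite -mulrBr normrM ger0_norm// mulrC.
  have [->|fh] := eqVneq (f h) 0; first by rewrite !mulr0.
  by rewrite ler_wpM2r// ra//; exact: fV.
have de : d%:R * (e * c + e * c) < c.
  rewrite -mulrDl mulrA -[ltRHS]mul1r ltr_pM2r//.
  have : d.+1%:R * e = 4^-1 by rewrite /e invfM mulrCA divff ?mulr1// pnatr_eq0.
  by rewrite -natr1 mulrDl mul1r mulrDr; move: e0; set x := d%:R * e; lra.
apply: (diag_dominant_unit c0) => i j; rewrite mxE.
have bR := @bound _ (i == j)%:R (@cRe i j) (fun h Vh => (Vh i j).1).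
have bI : `|\int[muG]_h (f h * complex.Im (rho h i j))| <= e * c.
  have := @bound _ 0 (@cIm i j); rewrite mulr0 subr0; apply => h Vh.
  by rewrite subr0; exact: (Vh i j).2.
apply: le_lt_trans de; rewrite ler_wpM2l//.
by rewrite /taxi /= subr0 -mulr_natr lerD.
Qed.

(** With f as in weighted_unit, rho g is the product of weighted (h |-> f
    (g^-1 h)), which is differentiable in g, and the inverse of the fixed
    matrix weighted f. *)
Theorem representation_differentiable i j :
  differentiable (fun u => complex.Re (rho (chart_inv c1 u) i j) : R) (c1 1%g) /\
  differentiable (fun u => complex.Im (rho (chart_inv c1 u) i j) : R) (c1 1%g).
Proof.
have [f Cf uf] := weighted_unit.
pose B := invmx (weighted f).
pose S u := weighted (fun h => f ((chart_inv c1 u)^-1 * h)%g).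
have rhoE u : rho (chart_inv c1 u) = S u *m B.
  by rewrite /S weighted_translate// mulmxK.
have dRe k l : differentiable (fun u => complex.Re (S u k l)) (c1 1%g).
  rewrite (_ : (fun u => _) = (fun u => \int[muG]_h
    (f ((chart_inv c1 u)^-1 * h)%g * complex.Re (rho h k l)))).
    exact: weighted_differentiable.
  by apply/funext => u; rewrite /S mxE.
have dIm k l : differentiable (fun u => complex.Im (S u k l)) (c1 1%g).
  rewrite (_ : (fun u => _) = (fun u => \int[muG]_h
    (f ((chart_inv c1 u)^-1 * h)%g * complex.Im (rho h k l)))).
    exact: weighted_differentiable.
  by apply/funext => u; rewrite /S mxE.
have dM (g : 'rV[R]_m -> R) (a : R) : differentiable g (c1 1%g) ->
    differentiable (fun u => g u * a) (c1 1%g).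
  by move=> dg; apply: differentiableM.
split.
  have -> : (fun u => complex.Re (rho (chart_inv c1 u) i j)) =
      \sum_l (fun u => complex.Re (S u i l) * complex.Re (B l j) -
                       complex.Im (S u i l) * complex.Im (B l j)).
    apply/funext => u; rewrite rhoE mxE Re_sum fct_sumE; apply: eq_bigr => l _.
    exact: ReM.
  apply: differentiable_sum => l; apply: differentiableB; exact: dM.
have -> : (fun u => complex.Im (rho (chart_inv c1 u) i j)) =
    \sum_l (fun u => complex.Re (S u i l) * complex.Im (B l j) +
                     complex.Im (S u i l) * complex.Re (B l j)).
  apply/funext => u; rewrite rhoE mxE Im_sum fct_sumE; apply: eq_bigr => l _.
  exact: ImM.
apply: differentiable_sum => l; apply: differentiableD; exact: dM.
Qed.

End representation_smooth.

(** * The differential of a representation *)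

Section matrix_derivative.
Context (R : realType).

Definition mx_is_derive p q (A : R -> 'M[R[i]]_(p, q)) (t : R) (D : 'M[R[i]]_(p, q)) :=
  forall i j,
    is_derive t 1 (fun s => complex.Re (A s i j) : R) (complex.Re (D i j)) /\
    is_derive t 1 (fun s => complex.Im (A s i j) : R) (complex.Im (D i j)).

Lemma mx_is_derive_unique p q (A : R -> 'M[R[i]]_(p, q)) t D D' :
  mx_is_derive A t D -> mx_is_derive A t D' -> D = D'.
Proof.
move=> AD AD'; apply/matrixP => i j.
have [[_ a1] [_ a2]] := AD i j; have [[_ b1] [_ b2]] := AD' i j.
by apply: complexE; [rewrite -a1 -b1|rewrite -a2 -b2].
Qed.

Lemma mx_is_derive_near p q (A B : R -> 'M[R[i]]_(p, q)) t D :
  (\forall s \near t, A s = B s) -> mx_is_derive A t D -> mx_is_derive B t D.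
Proof.
move=> AB AD i j; have [a1 a2] := AD i j; split.
  by apply: near_eq_is_derive a1; apply: filterS AB => s ->.
by apply: near_eq_is_derive a2; apply: filterS AB => s ->.
Qed.

Lemma mx_derive1E d (A : R -> 'M[R[i]]_d) t D :
  mx_is_derive A t D -> mx_derive1 A t = D.
Proof.
move=> AD; apply/matrixP => i j; have [[_ a1] [_ a2]] := AD i j.
by rewrite mxE !derive1E a1 a2; case: (D i j).
Qed.

Let isdZ (f : R -> R) (t a df : R) : is_derive t 1 f df ->
  is_derive t 1 (fun s => a * f s) (a * df).
Proof. by move=> fd; apply: is_deriveZ. Qed.

Lemma mx_is_derive_mull p q r (P : 'M[R[i]]_(p, q)) (A : R -> 'M[R[i]]_(q, r)) t D :
  mx_is_derive A t D -> mx_is_derive (fun s => P *m A s) t (P *m D).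
Proof.
move=> AD i j; split.
  have -> : (fun s => complex.Re ((P *m A s) i j)) =
    \sum_l ((fun s => complex.Re (P i l) * complex.Re (A s l j)) -
            (fun s => complex.Im (P i l) * complex.Im (A s l j))).
    apply/funext => s; rewrite mxE Re_sum fct_sumE; apply: eq_bigr => l _.
    exact: ReM.
  have -> : complex.Re ((P *m D) i j) = \sum_l (complex.Re (P i l) * complex.Re (D l j) -
      complex.Im (P i l) * complex.Im (D l j)).
    by rewrite mxE Re_sum; apply: eq_bigr => l _; exact: ReM.
  apply: is_derive_sum => l; have [a1 a2] := AD l j.
  by apply: is_deriveB; exact: isdZ.
have -> : (fun s => complex.Im ((P *m A s) i j)) =
  \sum_l ((fun s => complex.Re (P i l) * complex.Im (A s l j)) +
          (fun s => complex.Im (P i l) * complex.Re (A s l j))).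
  apply/funext => s; rewrite mxE Im_sum fct_sumE; apply: eq_bigr => l _.
  exact: ImM.
have -> : complex.Im ((P *m D) i j) = \sum_l (complex.Re (P i l) * complex.Im (D l j) +
    complex.Im (P i l) * complex.Re (D l j)).
  by rewrite mxE Im_sum; apply: eq_bigr => l _; exact: ImM.
apply: is_derive_sum => l; have [a1 a2] := AD l j.
by apply: is_deriveD; exact: isdZ.
Qed.

Lemma mx_is_derive_tr p q (A : R -> 'M[R[i]]_(p, q)) t D :
  mx_is_derive A t D -> mx_is_derive (fun s => (A s)^T) t D^T.
Proof.
move=> AD i j; have [a1 a2] := AD j i; rewrite mxE; split.
  by under eq_fun do rewrite mxE.
by under eq_fun do rewrite mxE.
Qed.

Lemma mx_is_derive_mulr p q r (A : R -> 'M[R[i]]_(p, q)) (Q : 'M[R[i]]_(q, r)) t D :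
  mx_is_derive A t D -> mx_is_derive (fun s => A s *m Q) t (D *m Q).
Proof.
move=> /mx_is_derive_tr/(mx_is_derive_mull Q^T)/mx_is_derive_tr.
rewrite trmx_mul !trmxK.
by under eq_fun do rewrite trmx_mul !trmxK.
Qed.

End matrix_derivative.

Section representation_calculus.
Context (R : realType) (G : ptopologicalGroupType) (m : nat)
  (MG : smooth_manifold R G m) (hG : lie_group MG) (cG : compact [set: G]).
Context (muG : probability (borel G) R) (hmu : normalised_haar muG).
Context (d : nat) (rho : G -> 'M[R[i]]_d) (hrho : unitary_representation rho).

Let c1 := chart_at MG (1 : G)%g.

Lemma rep_curve (gam : R -> 'rV[R]_m) : gam 0 = c1 1%g -> differentiable gam 0 ->
  mx_is_derive (fun t => rho (chart_inv c1 (gam t))) 0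
    (rep_differential rho MG ('D_1 gam 0)).
Proof.
move=> g0 dg i j.
have [dRe dIm] := representation_differentiable hG cG hmu hrho i j.
rewrite mxE /=.
have H (psi : 'rV[R]_m -> R) : differentiable psi (c1 1%g) ->
    is_derive (0 : R) 1 (psi \o gam) ('d psi (c1 1%g) ('D_1 gam 0)).
  move=> dp; have dp' : differentiable psi (gam 0) by rewrite g0.
  split; first by apply: diff_derivable; exact: differentiable_comp.
  have e := derive_comp _ dg dp'.
  by rewrite e g0 (deriveE _ dp).
by split; [exact: (H _ dRe)|exact: (H _ dIm)].
Qed.

Lemma rep_unit g : rho g \in unitmx /\ invmx (rho g) = rho g^-1%g.
Proof.
have [rho1 rhoM _ _] := hrho.
have e : rho g *m rho g^-1%g = 1%:M by rewrite -rhoM mulgV.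
have [u _] := mulmx1_unit e; split=> //.
by rewrite -[invmx _]mulmx1 -e mulKmx.
Qed.

(** Differentiate rho (g h g^-1) = rho g rho h (rho g)^-1 as h runs through a
    line in the chart at the identity. *)
Lemma rep_differential_Ad g Z :
  rep_differential rho MG (Ad MG g Z) = rho g *m rep_differential rho MG Z *m invmx (rho g).
Proof.
have [rho1 rhoM _ _] := hrho.
pose lin (t : R) := t *: Z + c1 1%g.
have lin0 : lin 0 = c1 1%g by rewrite /lin scale0r add0r.
have dlin : differentiable lin 0.
  by apply: differentiableD => //; apply: differentiableZl.
have Dlin : 'D_1 lin 0 = Z.
  have did : differentiable (id : 'rV[R]_m -> 'rV[R]_m) ((0 : R) *: Z + c1 1%g).
    exact: (C1at_differentiable (C1at_id _)).
  by have [_ e] := is_derive_line did; rewrite derive_id in e.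
have dc := (conj_chart_partial hG g).1.
have dc' : differentiable (conj_chart MG g) (lin 0) by rewrite lin0.
have dgam : differentiable (conj_chart MG g \o lin) 0 by exact: differentiable_comp.
have g0 : (conj_chart MG g \o lin) 0 = c1 1%g.
  by rewrite /= lin0 /conj_chart (chart_invK_near (chart1_near MG)) mulg1 mulgV.
have Dgam : 'D_1 (conj_chart MG g \o lin) 0 = Ad MG g Z.
  have e := derive_comp _ dlin dc'; rewrite e Dlin lin0; exact: (esym (AdE hG g Z)).
have := rep_curve g0 dgam; rewrite Dgam => D1.
have := rep_curve lin0 dlin; rewrite Dlin => D2.
have D3 := mx_is_derive_mulr (rho g^-1%g) (mx_is_derive_mull (rho g) D2).
rewrite (rep_unit g).2; apply: (mx_is_derive_unique D1).
apply: mx_is_derive_near D3.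
have clin : {for 0, continuous lin} by exact: differentiable_continuous.
have : \forall t \near (0 : R), chart_dom c1 (g * chart_inv c1 (lin t) * g^-1)%g.
  have cc := conj_chart_near hG g.
  apply: (clin (fun u => chart_dom c1 (g * chart_inv c1 u * g^-1)%g)).
  by rewrite lin0.
have [_ cK _ _ _] := chart1_near MG.
apply: filterS => t ht.
by rewrite /= /conj_chart cK ?inE// !rhoM.
Qed.

Lemma rep_differentialD Z Z' : rep_differential rho MG (Z + Z') =
  rep_differential rho MG Z + rep_differential rho MG Z'.
Proof. by apply/matrixP => i j; rewrite !mxE !linearD. Qed.

Lemma rep_differentialZ a Z : rep_differential rho MG (a *: Z) =
  Complex a 0 *: rep_differential rho MG Z.
Proof.
apply/matrixP => i j; rewrite !mxE !linearZ; apply: complexE => /=.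
  by rewrite mul0r subr0.
by rewrite mul0r addr0.
Qed.

Context (X : ptopologicalType) (n : nat) (MX : smooth_manifold R X n).
Context (F : R -> X -> X) (hF : C1_flow MX F).
Context (phi : X -> G) (hphi : Ck_map 1 (atlas MX) (atlas MG) phi).

(** Along the orbit of x, rho (phi (F t x)) is rho of the displacement times
    the constant matrix rho (phi x). *)
Lemma M_repE x : M_rep rho F phi x = rep_differential rho MG (M_phi MG F phi x).
Proof.
have [rho1 rhoM _ _] := hrho.
pose gam t := c1 (displacement F phi t x).
have dgam : differentiable gam 0 := (displacement_partial hF hG hphi x).1.
have g0 : gam 0 = c1 1%g by rewrite /gam (displacement0 hF).
have := rep_curve g0 dgam; rewrite -(M_phiE hF hG hphi x) => D1.
have D2 := mx_is_derive_mulr (rho (phi x)) D1.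
rewrite /M_rep (_ : mx_derive1 _ _ = rep_differential rho MG (M_phi MG F phi x) *m rho (phi x)).
  by rewrite mulmxK//; case: (rep_unit (phi x)).
apply: mx_derive1E; apply: mx_is_derive_near D2.
have [cD cK _ _ _] := chart1_near MG.
have [cd _] := C1_near_displacement hF hG hphi (0, x).
have cp : (t, x) @[t --> (0 : R)] --> ((0 : R), x).
  by apply: cvg_pairT; [exact: cvg_id|exact: cvg_cst].
have ct := cvg_comp _ _ cp cd; rewrite /= (displacement0 hF) in ct.
have : \forall t \near (0 : R), chart_dom c1 (displacement F phi t x) by exact: ct.
apply: filterS => t ht; rewrite /gam cK ?inE// -rhoM /displacement.
by rewrite -mulgA mulVg mulg1.
Qed.

End representation_calculus.

(** * Operator norm bounds *)

Section operator_norm.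
Context (R : realType).

Lemma sum_sqr_le (I : Type) (s : seq I) (a : I -> R) : (forall i, 0 <= a i) ->
  \sum_(i <- s) a i ^+ 2 <= (\sum_(i <- s) a i) ^+ 2.
Proof.
move=> a0; elim: s => [|i s IH]; first by rewrite !big_nil sqr_ge0.
rewrite !big_cons sqrrD -addrA lerD2l (le_trans IH)// lerDr mulrn_wge0// mulr_ge0//.
exact: sumr_ge0.
Qed.

Lemma euclidean_norm_le_sum d (v : 'cV[R[i]]_d) :
  euclidean_norm v <= \sum_i taxi (v i 0).
Proof.
have s0 (P : pred 'I_d) : 0 <= \sum_(i | P i) taxi (v i 0).
  by apply: sumr_ge0 => i _; exact: taxi_ge0.
rewrite /euclidean_norm -[leRHS]ger0_norm// -sqrtr_sqr ler_sqrt ?sqr_ge0//.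
have step (z : R[i]) : complex.Re z ^+ 2 + complex.Im z ^+ 2 <= taxi z ^+ 2.
  rewrite /taxi sqrrD !real_normK ?num_real//.
  have : 0 <= `|complex.Re z| * `|complex.Im z| by rewrite mulr_ge0.
  rewrite mulr2n; lra.
apply: (@le_trans _ _ (\sum_i taxi (v i 0) ^+ 2)); first exact: ler_sum.
by apply: sum_sqr_le => i; exact: taxi_ge0.
Qed.

Lemma euclidean_norm_coord d (v : 'cV[R[i]]_d) i : taxi (v i 0) <= 2 * euclidean_norm v.
Proof.
have S0 : 0 <= \sum_i (complex.Re (v i 0) ^+ 2 + complex.Im (v i 0) ^+ 2).
  by apply: sumr_ge0 => j _; rewrite addr_ge0 ?sqr_ge0.
have le (a : R) : a ^+ 2 <= complex.Re (v i 0) ^+ 2 + complex.Im (v i 0) ^+ 2 ->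
    `|a| <= euclidean_norm v.
  move=> h; rewrite /euclidean_norm -sqrtr_sqr ler_sqrt//; apply: (le_trans h).
  by rewrite [leRHS](bigD1 i)//= lerDl sumr_ge0// => j _; rewrite addr_ge0 ?sqr_ge0.
have h1 := le (complex.Re (v i 0)) _; have h2 := le (complex.Im (v i 0)) _.
rewrite /taxi mulr2n mulrDl mul1r lerD ?h1 ?h2 ?lerDl ?lerDr ?sqr_ge0//.
Qed.

Lemma operator_norm_bound d (A : 'M[R[i]]_d) a : (forall i j, taxi (A i j) <= a) ->
  0 <= operator_norm A /\ operator_norm A <= d%:R * (d%:R * (a * 2)).
Proof.
move=> Aa; rewrite /operator_norm; set S := [set _ | _ in _].
have v0 : euclidean_norm (0 : 'cV[R[i]]_d) = 0.
  rewrite /euclidean_norm big1 ?sqrtr0// => i _.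
  by rewrite mxE -[complex.Re 0]/(0 : R) -[complex.Im 0]/(0 : R) expr0n addr0.
have S0 : S 0.
  exists 0; last by rewrite mulmx0 v0.
  by rewrite /= v0.
have dE (b : R) : d%:R * b = \sum_(i < d) b by rewrite sumr_const card_ord mulr_natl.
have Sub : ubound S (d%:R * (d%:R * (a * 2))).
  move=> _ [v /= v1 <-]; apply: (le_trans (euclidean_norm_le_sum _)).
  rewrite dE; apply: ler_sum => i _.
  rewrite mxE; apply: (le_trans (taxi_sum _ _)).
  rewrite dE; apply: ler_sum => j _.
  apply: (le_trans (taxiM _ _)); apply: ler_pM; rewrite ?taxi_ge0//.
  apply: (le_trans (euclidean_norm_coord v j)); rewrite -[leRHS]mulr1.
  exact: ler_wpM2l.
split; first by apply: ub_le_sup => //; exists (d%:R * (d%:R * (a * 2))).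
by apply: ge_sup => //; exists 0.
Qed.

End operator_norm.

Section rep_bound.
Context (R : realType) (G : ptopologicalGroupType) (m : nat)
  (MG : smooth_manifold R G m).
Context (d : nat) (rho : G -> 'M[R[i]]_d).

Lemma rep_differential0 : rep_differential rho MG 0 = 0.
Proof. by apply/matrixP => i j; rewrite !mxE !linear0. Qed.

Lemma rep_differential_sum (I : Type) (s : seq I) (f : I -> 'rV[R]_m) :
  rep_differential rho MG (\sum_(i <- s) f i) =
  \sum_(i <- s) rep_differential rho MG (f i).
Proof.
elim: s => [|i s IH]; first by rewrite !big_nil rep_differential0.
by rewrite !big_cons rep_differentialD IH.
Qed.

(** A linear map out of a finite-dimensional space is bounded; this turns
    uniform convergence in the Lie algebra into convergence in operator norm. *)
Lemma rep_differential_bounded : exists2 C : R, 0 <= C & forall Z,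
  0 <= operator_norm (rep_differential rho MG Z) /\
  operator_norm (rep_differential rho MG Z) <= C * `|Z|.
Proof.
pose B := \sum_i \sum_j \sum_l taxi (rep_differential rho MG (delta_mx 0 l) i j).
have B0 : 0 <= B.
  by apply: sumr_ge0 => i _; apply: sumr_ge0 => j _; apply: sumr_ge0 => l _; exact: taxi_ge0.
exists (d%:R * (d%:R * (B * 2))) => [|Z]; first by rewrite !mulr_ge0.
have H i j : taxi (rep_differential rho MG Z i j) <= B * `|Z|.
  rewrite {1}[Z]row_sum_delta rep_differential_sum summxE (le_trans (taxi_sum _ _))//.
  apply: (@le_trans _ _ (\sum_l taxi (rep_differential rho MG (delta_mx 0 l) i j) * `|Z|)).
    apply: ler_sum => l _; rewrite rep_differentialZ mxE (le_trans (taxiM _ _))// mulrC.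
    by rewrite ler_wpM2l ?taxi_ge0// /taxi /= normr0 addr0 row_coord_norm.
  rewrite -mulr_suml ler_wpM2r// /B (bigD1 i)//= -[leLHS]addr0 lerD//.
    rewrite (bigD1 j)//= lerDl sumr_ge0// => j' _; apply: sumr_ge0 => l _; exact: taxi_ge0.
  by apply: sumr_ge0 => i' _; apply: sumr_ge0 => j' _; apply: sumr_ge0 => l _; exact: taxi_ge0.
have [h1 h2] := operator_norm_bound H; split => //.
by rewrite (le_trans h2)// -!mulrA [X in _ * (_ * (B * X))]mulrC.
Qed.

End rep_bound.

(** * Uniform convergence of the averages *)

Lemma cvge_to0 (R : realType) (u : nat -> \bar R) :
  (forall e : R, 0 < e -> \forall N \near \oo, (0 <= u N <= e%:E)%E) ->
  u @ \oo --> 0%E.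
Proof.
move=> H; apply/fine_cvgP; split.
  apply: filterS (H 1 ltr01) => N /andP[u0 u1].
  by rewrite ge0_fin_numE// (le_lt_trans u1)// ltry.
apply/cvgrPdist_le => e e0; apply: filterS (H e e0) => N /andP[u0 ue].
have uf : u N \is a fin_num by rewrite ge0_fin_numE// (le_lt_trans ue)// ltry.
rewrite sub0r normrN /= ger0_norm ?fine_ge0//.
by rewrite -lee_fin fineK.
Qed.

Lemma row_norm_le (R : realType) n (w : 'rV[R]_n) e : 0 <= e ->
  (forall j, `|w 0 j| <= e) -> `|w| <= e.
Proof.
move=> e0 we; rewrite [leLHS]/Num.norm /= mx_normrE; apply: bigmax_le => // -[i j] _.
by rewrite ord1.
Qed.

Section Ad_facts.
Context (R : realType) (G : ptopologicalGroupType) (m : nat)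
  (MG : smooth_manifold R G m) (hG : lie_group MG).

Lemma Ad_basis g Z : Ad MG g Z = \sum_i Z 0 i *: Ad MG g (delta_mx 0 i).
Proof.
rewrite {1}[Z]row_sum_delta Ad_diffE linear_sum; apply: eq_bigr => i _.
by rewrite linearZ.
Qed.

Lemma Ad_continuous2 (T : topologicalType) (g : T -> G) (Z : T -> 'rV[R]_m) :
  continuous g -> continuous Z -> continuous (fun t => Ad MG (g t) (Z t)).
Proof.
move=> cg cZ.
have -> : (fun t => Ad MG (g t) (Z t)) =
    (fun t => \sum_i Z t 0 i *: Ad MG (g t) (delta_mx 0 i)).
  by apply/funext => t; exact: Ad_basis.
move=> t; apply: (@cvg_big _ _ _ _ _ _ _ (nbhs t)) => [|i _]; first exact: add_continuous.
apply: (@cvgZ _ _ _ (nbhs t)); first by apply: cvg_coord; exact: cZ.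
exact: (continuous_comp (cg t) (@Ad_continuous _ _ _ _ hG (delta_mx 0 i) (g t))).
Qed.

Lemma Ad1 Z : Ad MG 1%g Z = Z.
Proof.
have [cD cK _ _ cI] := chart1_near MG.
rewrite (AdE hG) -[RHS](derive_id (chart_at MG 1%g 1%g) Z).
apply: near_eq_derive; apply: filterS cI => _ [h ch <-].
by rewrite /conj_chart mul1g invg1 mulg1 cK ?inE.
Qed.

Lemma Ad_vintegral d (T : measurableType d) (P : probability T R)
    (f : T -> 'rV[R]_m) g :
  (forall j, P.-integrable setT (EFin \o (fun x => f x 0 j))) ->
  Ad MG g (vintegral P f) = vintegral P (fun x => Ad MG g (f x)).
Proof.
move=> fi; apply/rowP => j; rewrite Ad_basis summxE [RHS]mxE.
have iz i : P.-integrable setT (EFin \o (fun x => f x 0 i * Ad MG g (delta_mx 0 i) 0 j)).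
  have := integrableZr measurableT (Ad MG g (delta_mx 0 i) 0 j) (fi i).
  by apply: eq_integrable.
have [_ e] := Rintegral_sum (index_enum 'I_m) iz.
transitivity (\int[P]_x \sum_i (f x 0 i * Ad MG g (delta_mx 0 i) 0 j)).
  rewrite e; apply: eq_bigr => i _.
  by rewrite mxE [vintegral _ _ _ _]mxE RintegralZr.
apply: eq_Rintegral => x _; rewrite Ad_basis summxE.
by apply: eq_bigr => i _; rewrite mxE.
Qed.

End Ad_facts.

Section averages.
Context (R : realType)
  (X : ptopologicalType) (n : nat) (MX : smooth_manifold R X n)
  (hX : compact [set: X])
  (muX : probability (borel X) R)
  (F : R -> X -> X) (hF : C1_flow MX F)
  (G : ptopologicalGroupType) (m : nat) (MG : smooth_manifold R G m)
  (hG : lie_group MG) (hGc : compact [set: G])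
  (muG : probability (borel G) R)
  (phi : X -> G) (hphi : Ck_map 1 (atlas MX) (atlas MG) phi)
  (hue : uniquely_ergodic (muX \x muG)%E (skew_product F phi)).

Local Notation M := (M_phi MG F phi).
Local Notation Mstar := (M_star MG muX muG F phi).

Lemma flow_continuous t : continuous (F t).
Proof.
have [_ _ [cF _]] := hF.
move=> x; have cp : (t, y) @[y --> x] --> (t, x).
  by apply: cvg_pairT; [exact: cvg_cst|exact: cvg_id].
exact: (cvg_comp _ _ cp (cF (t, x))).
Qed.

Let cphi : continuous phi. Proof. by case: hphi. Qed.

Let T (p : X * G) : X * G := (F 1 p.1, (p.2 * phi p.1)%g).

Let cT : continuous T.
Proof.
move=> p; apply: cvg_pairT.
  exact: (cvg_comp fst (F 1) cvg_fst (@flow_continuous 1 p.1)).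
have c2 : (q.2, phi q.1) @[q --> p] --> (p.2, phi p.1).
  apply: cvg_pairT; first exact: cvg_snd.
  exact: (cvg_comp fst phi cvg_fst (@cphi p.1)).
exact: (cvg_comp _ _ c2 (@lie_mul_continuous _ _ _ _ hG (p.2, phi p.1))).
Qed.

(** Orbits of the skew product that start at the identity of the fibre record
    the cocycle in their second coordinate. *)
Lemma iter_skew k x : iter k T (x, 1%g) = (F k%:R x, cocycle F phi k x).
Proof.
have [F0 FD _] := hF.
elim: k => [|k IH] /=; first by rewrite F0.
by rewrite IH /T /= -FD -natr1 addrC.
Qed.

Definition average (N : nat) (x : X) : 'rV[R]_m :=
  N%:R^-1 *: \sum_(0 <= k < N) Ad MG (cocycle F phi k x) (M (F k%:R x)).

Lemma Ad_M_continuous j : continuous (fun p : X * G => Ad MG p.2 (M p.1) 0 j).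
Proof.
have c : continuous (fun p : X * G => Ad MG p.2 (M p.1)).
  apply: (Ad_continuous2 hG (g := snd) (Z := fun p : X * G => M p.1)).
    by move=> p; exact: cvg_snd.
  have cM : continuous (M : X -> 'rV[R]_m) by exact: M_phi_continuous hphi.
  by move=> p; exact: (cvg_comp fst (M : X -> 'rV[R]_m) cvg_fst (cM p.1)).
by move=> p; apply: cvg_coord; exact: c.
Qed.

(** By iter_skew, average N x is the Birkhoff average at (x, 1) of the
    function (x, g) |-> Ad g (M_phi x), which is continuous on a compact space
    and whose integral is M_star. *)
Lemma average_uniform e : 0 < e ->
  \forall N \near \oo, forall x, `|average N x - Mstar| <= e.
Proof.
move=> e0.
have H j : \forall N \near \oo, forall x, `|average N x 0 j - Mstar 0 j| <= e.
  have := product_birkhoff_uniform hX (manifold_hausdorff MX) (manifold_second_countable MX)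
    hGc (manifold_hausdorff MG) (manifold_second_countable MG)
    (mu := (muX \x muG)%E) cT hue.2 (@Ad_M_continuous j) e0.
  apply: filterS => N HN x; have := HN (x, 1%g).
  rewrite /birkhoff [Mstar 0 j]mxE.
  suff -> : average N x 0 j = N%:R^-1 * \sum_(0 <= k < N)
      Ad MG (iter k T (x, 1%g)).2 (M (iter k T (x, 1%g)).1) 0 j by [].
  by rewrite mxE summxE; congr (_ * _); apply: eq_bigr => k _; rewrite iter_skew.
have H' : \forall N \near \oo, forall j : 'I_m, forall x, `|average N x 0 j - Mstar 0 j| <= e.
  exact: filter_forall H.
apply: filterS H' => N HN x; apply: row_norm_le => [|j]; first exact: ltW.
by have := HN j x; rewrite !mxE.
Qed.

Section representation.
Context (hmu : normalised_haar muG).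
Context (d : nat) (rho : G -> 'M[R[i]]_d) (hrho : unitary_representation rho).

(** The differential of rho is linear, sends M_phi to M_rep, and turns Ad into
    conjugation: it maps averages to averages. *)
Lemma rep_average N x :
  (N%:R)^-1 *: (\sum_(0 <= k < N) W_rep rho F phi k (M_rep rho F phi) x)
    - rep_differential rho MG Mstar = rep_differential rho MG (average N x - Mstar).
Proof.
have cx : (N%:R : R[i])^-1 = Complex (N%:R^-1) 0.
  by rewrite -[RHS]/(real_complex R (N%:R^-1)) fmorphV rmorph_nat.
have neg Z : rep_differential rho MG (- Z) = - rep_differential rho MG Z.
  by apply/matrixP => i j; rewrite !mxE !linearN.
rewrite rep_differentialD neg rep_differentialZ cx rep_differential_sum.
congr (_ *: _ - _); apply: eq_bigr => k _.
by rewrite /W_rep (M_repE hG hGc hmu hrho hF hphi) (rep_differential_Ad hG hGc hmu hrho).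
Qed.

Lemma rep_average_cvg :
  (fun N : nat => Linf_norm muX (fun x =>
         (N%:R)^-1 *: (\sum_(0 <= k < N) W_rep rho F phi k (M_rep rho F phi) x)
         - rep_differential rho MG Mstar)) @ \oo --> 0%E.
Proof.
have [C C0 HC] := rep_differential_bounded MG rho.
apply: cvge_to0 => e e0.
have e1 : 0 < e / (C + 1) by rewrite divr_gt0// ltr_wpDl.
apply: filterS (average_uniform e1) => N HN.
rewrite /Linf_norm; apply/andP; split.
  apply: ess_sup_gee; first exact: (eq_ind_r (fun z => (0 < z)%E) (@lte01 R) (probability_setT muX)).
  by apply: aeW => x; rewrite rep_average lee_fin; case: (HC (average N x - Mstar)).
apply/ess_supP; apply: aeW => x; rewrite rep_average lee_fin.
have [_ h] := HC (average N x - Mstar); apply: (le_trans h).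
apply: (@le_trans _ _ (C * (e / (C + 1)))); first by rewrite ler_wpM2l.
by rewrite mulrCA ler_piMr ?(ltW e0)// ler_pdivrMr ?mul1r ?lerDl ?ltr_wpDl//.
Qed.

End representation.

Lemma M_coord_continuous j : continuous (fun x : X => M x 0 j).
Proof. by move=> x; apply: cvg_coord; exact: (M_phi_continuous hF hG hphi). Qed.

Lemma M_coord_integrable j :
  muX.-integrable setT (EFin \o ((fun x : X => M x 0 j) : borel X -> R)).
Proof. exact: (continuous_integrable muX hX (@M_coord_continuous j)). Qed.

(** Integrate over X first: Ad g is linear, so it commutes with that integral. *)
Lemma M_star_fubini : Mstar = P_Ad MG muG (vintegral muX M).
Proof.
apply/rowP => j; rewrite !mxE.
pose f (p : borel X * borel G) : R := Ad MG p.2 (M p.1) 0 j.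
have [B [B0 fB]] := compact_continuous_bounded (compact_prodT hX hGc) (@Ad_M_continuous j).
have fi : ((muX \x muG)%E).-integrable setT (EFin \o f).
  apply: (@bounded_integrable _ _ _ ((muX \x muG)%E : probability _ _) f B) => //.
  exact: (product_continuous_measurable (manifold_second_countable MX)
    (manifold_second_countable MG) (@Ad_M_continuous j)).
rewrite /Rintegral; congr fine.
have E := integral21_prod_meas1 fi.
rewrite -[LHS]E; apply: eq_integral => g _ /=.
rewrite Ad_vintegral; last exact: M_coord_integrable.
rewrite mxE /Rintegral fineK//.
apply: integrable_fin_num => //.
have cg : continuous (fun x : X => Ad MG g (M x) 0 j).
  move=> x; apply: cvg_coord.
  apply: (Ad_continuous2 hG (g := fun=> g)); first exact: cst_continuous.
  exact: (M_phi_continuous hF hG hphi).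
exact: (continuous_integrable muX hX cg).
Qed.

End averages.

(** * Square-integrable functions *)

Section square_integrable_facts.
Context (R : realType) (m : nat) (dot : 'rV[R]_m -> 'rV[R]_m -> R).
Hypotheses (dotC : forall u v, dot u v = dot v u)
  (dotl : forall a u v w, dot (a *: u + v) w = a * dot u w + dot v w)
  (dot_gt0 : forall u, u != 0 -> 0 < dot u u).

Lemma dot0l w : dot 0 w = 0.
Proof.
have := dotl 1 0 0 w; rewrite scaler0 addr0 mul1r => h.
by apply: (@addrI _ (dot 0 w)); rewrite addr0 -h.
Qed.

Lemma dotDl u v w : dot (u + v) w = dot u w + dot v w.
Proof. by rewrite -[u]scale1r dotl scale1r mul1r. Qed.

Lemma dotZl a u w : dot (a *: u) w = a * dot u w.
Proof. by rewrite -[a *: u]addr0 dotl dot0l addr0. Qed.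

Lemma dotBl u v w : dot (u - v) w = dot u w - dot v w.
Proof. by rewrite dotDl -scaleN1r dotZl mulN1r. Qed.

Lemma dotBr u v w : dot w (u - v) = dot w u - dot w v.
Proof. by rewrite ![dot w _]dotC dotBl. Qed.

Lemma dotDr u v w : dot w (u + v) = dot w u + dot w v.
Proof. by rewrite ![dot w _]dotC dotDl. Qed.

Lemma dot_suml (I : Type) (s : seq I) (f : I -> 'rV[R]_m) w :
  dot (\sum_(i <- s) f i) w = \sum_(i <- s) dot (f i) w.
Proof.
elim: s => [|i s IH]; first by rewrite !big_nil dot0l.
by rewrite !big_cons dotDl IH.
Qed.

Lemma dot_ge0 u : 0 <= dot u u.
Proof. by have [->|/dot_gt0/ltW//] := eqVneq u 0; rewrite dot0l. Qed.

Lemma dot_eq0 u : dot u u = 0 -> u = 0.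
Proof.
by move=> u0; apply/eqP; apply: contraT => /dot_gt0; rewrite u0 ltxx.
Qed.

Lemma dot_basisl u w : dot u w = \sum_i u 0 i * dot (delta_mx 0 i) w.
Proof.
by rewrite {1}[u]row_sum_delta dot_suml; apply: eq_bigr => i _; rewrite dotZl.
Qed.

Lemma dot_norm_le u v : `|dot u v| <= dot u u + dot v v.
Proof.
have h1 := dot_ge0 (u + v); have h2 := dot_ge0 (u - v).
have h3 := dot_ge0 u; have h4 := dot_ge0 v.
rewrite dotDl !dotDr in h1; rewrite dotBl !dotBr in h2.
by move: h1 h2; rewrite [dot v u]dotC ler_norml => *; apply/andP; split; lra.
Qed.

Lemma dotB_le u v : dot (u - v) (u - v) <= 2 * (dot u u + dot v v).
Proof.
have h := dot_ge0 (u + v); rewrite dotDl !dotDr in h.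
by move: h; rewrite dotBl !dotBr [dot v u]dotC => h; lra.
Qed.

Context d (T : measurableType d) (P : probability T R).
Implicit Types f g k : T -> 'rV[R]_m.

Definition measurable_row f := forall j, measurable_fun setT (fun x => f x 0 j).

Lemma measurable_dot f g : measurable_row f -> measurable_row g ->
  measurable_fun setT (fun x => dot (f x) (g x)).
Proof.
move=> mf mg.
have -> : (fun x => dot (f x) (g x)) = (fun x => \sum_i f x 0 i *
    \sum_j g x 0 j * dot (delta_mx 0 j) (delta_mx 0 i)).
  apply/funext => x; rewrite dot_basisl; apply: eq_bigr => i _.
  by rewrite dotC dot_basisl.
apply: measurable_sum => i; apply: measurable_funM => //.
by apply: measurable_sum => j; exact: measurable_funM.
Qed.

Lemma integrable_dot f g : L2 P dot f -> L2 P dot g ->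
  P.-integrable setT (EFin \o (fun x => dot (f x) (g x))).
Proof.
move=> [mf fi] [mg gi].
have H : P.-integrable setT (EFin \o (fun x => dot (f x) (f x) + dot (g x) (g x))).
  exact: integrableDR.
apply: (le_integrable measurableT _ _ H).
  by apply/measurable_EFinP; exact: measurable_dot.
move=> x _ /=; rewrite lee_fin [leRHS]ger0_norm ?addr_ge0 ?dot_ge0//.
exact: dot_norm_le.
Qed.

Lemma L2B f g : L2 P dot f -> L2 P dot g -> L2 P dot (fun x => f x - g x).
Proof.
move=> [mf fi] [mg gi].
have mB : measurable_row (fun x => f x - g x).
  move=> j; have -> : (fun x => (f x - g x) 0 j) = (fun x => f x 0 j - g x 0 j).
    by apply/funext => x; rewrite !mxE.
  exact: measurable_funB.
split => //.
have H : P.-integrable setT (EFin \o (fun x => 2 * (dot (f x) (f x) + dot (g x) (g x)))).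
  have := integrableZl measurableT 2 (integrableDR fi gi).
  by apply: eq_integrable.
apply: (le_integrable measurableT _ _ H).
  by apply/measurable_EFinP; exact: measurable_dot.
move=> x _ /=; rewrite lee_fin ger0_norm ?dot_ge0// ger0_norm.
  exact: dotB_le.
by rewrite mulr_ge0 ?addr_ge0 ?dot_ge0.
Qed.

Lemma L2_dotBl f g k : L2 P dot f -> L2 P dot g -> L2 P dot k ->
  L2_dot P dot (fun x => f x - g x) k = L2_dot P dot f k - L2_dot P dot g k.
Proof.
move=> Lf Lg Lk; rewrite /L2_dot -RintegralB//; try exact: integrable_dot.
by apply: eq_Rintegral => x _; rewrite dotBl.
Qed.

Lemma Rintegral_ae (f g : T -> R) : measurable_fun setT f -> measurable_fun setT g ->
  {ae P, forall x, f x = g x} -> \int[P]_x f x = \int[P]_x g x.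
Proof.
move=> mf mg fg; rewrite /Rintegral; congr fine; apply: ae_eq_integral => //.
- exact/measurable_EFinP.
- exact/measurable_EFinP.
- by apply: filterS fg => x -> _.
Qed.

Lemma ae_imply (A B C : T -> Prop) : (forall x, A x -> B x -> C x) ->
  {ae P, forall x, A x} -> {ae P, forall x, B x} -> {ae P, forall x, C x}.
Proof. by move=> ABC aA aB; apply: filterS2 aA aB => x; exact: ABC. Qed.

Lemma integrable_ae_eq (f g : T -> R) : measurable_fun setT g ->
  P.-integrable setT (EFin \o f) -> {ae P, forall x, f x = g x} ->
  P.-integrable setT (EFin \o g).
Proof.
move=> mg /integrableP[mf fi] fg; apply/integrableP; split; first exact/measurable_EFinP.
suff <- : (\int[P]_x `|(f x)%:E| = \int[P]_x `|(g x)%:E|)%E by [].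
apply: ae_eq_integral => //.
- exact: measurableT_comp.
- by apply: measurableT_comp => //; exact/measurable_EFinP.
- by apply: filterS fg => x ->.
Qed.

Lemma L2_dot_eq0 f : L2 P dot f -> L2_dot P dot f f = 0 -> {ae P, forall x, f x = 0}.
Proof.
move=> Lf; rewrite /L2_dot /Rintegral => f0.
have fi := integrable_dot Lf Lf.
have mf : measurable_fun setT (EFin \o (fun x => dot (f x) (f x))) by case/integrableP: fi.
have I0 : (\int[P]_x `|(dot (f x) (f x))%:E| = 0)%E.
  have -> : (\int[P]_x `|(dot (f x) (f x))%:E| = \int[P]_x (dot (f x) (f x))%:E)%E.
    by apply: eq_integral => x _; rewrite gee0_abs// lee_fin dot_ge0.
  by rewrite -[LHS]fineK ?f0//; exact: integrable_fin_num.
have /(ae_eq_integral_abs P measurableT mf) := I0.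
by apply: filterS => x /(_ I) [] /dot_eq0.
Qed.

(** The difference of two orthogonal projections of f lies in K and is
    orthogonal to K, hence to itself. So the projection picked by orth_proj
    agrees almost everywhere with any other one. *)
Lemma orth_proj_ae (K : set (T -> 'rV[R]_m)) f p : 
  (forall k, K k -> L2 P dot k) -> L2 P dot f ->
  (forall k k', K k -> K k' -> K (fun x => k x - k' x)) ->
  is_orth_proj P dot K f p -> {ae P, forall x, orth_proj P dot K f x = p x}.
Proof.
move=> KL Lf KB pp.
have [Kq qf] : is_orth_proj P dot K f (orth_proj P dot K f).
  exact: (getPex (ex_intro _ p pp)).
set q := orth_proj P dot K f in Kq qf *.
have [Kp pf] := pp.
have Kd := KB _ _ Kq Kp; have Ld := KL _ Kd.
have := qf _ Kd; have := pf _ Kd.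
rewrite !L2_dotBl//; try exact: KL.
move=> e1 e2.
have : {ae P, forall x, q x - p x = 0}.
  apply: L2_dot_eq0 => //; rewrite L2_dotBl//; try exact: KL.
  lra.
by apply: filterS => x /eqP; rewrite subr_eq0 => /eqP.
Qed.

End square_integrable_facts.

(** * The projection of M_phi *)

Section projection.
Context (R : realType)
  (X : ptopologicalType) (n : nat) (MX : smooth_manifold R X n)
  (hX : compact [set: X])
  (muX : probability (borel X) R)
  (F : R -> X -> X) (hF : C1_flow MX F)
  (hFmu : forall t, invariant_measure muX (F t))
  (G : ptopologicalGroupType) (m : nat) (MG : smooth_manifold R G m)
  (hG : lie_group MG) (hGc : compact [set: G])
  (muG : probability (borel G) R) (hmuG : normalised_haar muG)
  (dot : 'rV[R]_m -> 'rV[R]_m -> R)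
  (hdot : Ad_invariant_scalar_product MG dot)
  (phi : X -> G) (hphi : Ck_map 1 (atlas MX) (atlas MG) phi)
  (hue : uniquely_ergodic (muX \x muG)%E (skew_product F phi)).

Local Notation M := (M_phi MG F phi).
Local Notation Mstar := (M_star MG muX muG F phi).
Local Notation K := (ker_1_sub_W MG muX dot F phi).

Let dotC u v : dot u v = dot v u. Proof. by case: hdot. Qed.
Let dotl a u v w : dot (a *: u + v) w = a * dot u w + dot v w.
Proof. by case: hdot. Qed.
Let dot_gt0 u : u != 0 -> 0 < dot u u. Proof. by case: hdot => _ _ h _; exact: h. Qed.
Let dot_Ad g u v : dot (Ad MG g u) (Ad MG g v) = dot u v.
Proof. by case: hdot. Qed.

Let cM : continuous (M : X -> 'rV[R]_m). Proof. exact: M_phi_continuous hphi. Qed.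

Let mM : measurable_row (M : borel X -> _).
Proof.
move=> j; apply: (@borel_continuous_real R X (fun x => M x 0 j)).
exact: (M_coord_continuous hF hG hphi).
Qed.

(** M_star is an average over G of translates Ad h Z, and Haar measure is
    invariant under h |-> g h. *)
Lemma Ad_M_star g : Ad MG g Mstar = Mstar.
Proof.
rewrite (M_star_fubini hX muX hF hG hGc muG hphi) /P_Ad.
set Z := vintegral muX M.
have cA j : continuous (fun h : G => Ad MG h Z 0 j).
  by move=> h; apply: cvg_coord; exact: (Ad_continuous hG).
rewrite Ad_vintegral; last first.
  by move=> j; exact: (continuous_integrable muG hGc (@cA j)).
apply/rowP => j; rewrite !mxE.
rewrite -(haar_Rintegral hG hGc hmuG g (f := fun h => Ad MG h Z 0 j))//.
by apply: eq_Rintegral => h _; rewrite (AdM hG).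
Qed.

Lemma L2_continuous (f : X -> 'rV[R]_m) :
  (forall j, continuous (fun x => f x 0 j)) -> L2 muX dot f.
Proof.
move=> cj; have cff : continuous (fun x : X => dot (f x) (f x)).
  have -> : (fun x => dot (f x) (f x)) = (fun x => \sum_i f x 0 i *
      \sum_j f x 0 j * dot (delta_mx 0 j) (delta_mx 0 i)).
    apply/funext => x; rewrite (dot_basisl dotl); apply: eq_bigr => i _.
    by rewrite dotC (dot_basisl dotl).
  move=> x; apply: (@cvg_big _ _ _ _ _ _ _ (nbhs x)) => [|i _]; first exact: add_continuous.
  apply: (@cvgM _ _ (nbhs x)); first exact: cj.
  apply: (@cvg_big _ _ _ _ _ _ _ (nbhs x)) => [|j _]; first exact: add_continuous.
  by apply: (@cvgM _ _ (nbhs x)); [exact: cj|exact: cvg_cst].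
split; last exact: (continuous_integrable muX hX cff).
by move=> j; exact: (borel_continuous_real (cj j)).
Qed.

Lemma L2_M : L2 muX dot M.
Proof. by apply: L2_continuous => j; exact: (M_coord_continuous hF hG hphi). Qed.

Lemma L2_cst Z : L2 muX dot (fun=> Z).
Proof. by apply: L2_continuous => j; exact: cst_continuous. Qed.

Lemma ae_flow (Q : X -> Prop) t : {ae muX, forall x, Q x} -> {ae muX, forall x, Q (F t x)}.
Proof.
move=> [A [mA A0 QA]].
have mF : measurable_fun setT (F t : borel X -> borel X).
  by apply: borel_continuous; exact: flow_continuous hF t.
exists (F t @^-1` A); split.
- by rewrite -[F t @^-1` A]setTI; exact: (mF measurableT _ mA).
- by rewrite hFmu.
- by move=> x nQ; exact: QA.
Qed.

(** The relation W k = k holds almost everywhere, and it can be used at F N x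
    because the flow preserves null sets. *)
Lemma kernel_iterate (k : borel X -> 'rV[R]_m) N : K k ->
  {ae muX, forall x, Ad MG (cocycle F phi N x) (k (F N%:R x)) = k x}.
Proof.
have [F0 FD _] := hF.
move=> [_ Wk]; elim: N => [|N IH].
  by apply: aeW => x /=; rewrite F0 (Ad1 hG).
apply: ae_imply IH (ae_flow N%:R Wk) => x IH Wx.
rewrite /= (AdM hG) -IH; congr (Ad _ _ _).
by rewrite -Wx /W_phi -FD -natr1 addrC.
Qed.

Lemma ker_sub k k' : K k -> K k' -> K (fun x => k x - k' x).
Proof.
move=> [Lk Wk] [Lk' Wk']; split; first exact: L2B.
apply: ae_imply Wk Wk' => x; rewrite /W_phi => <- <-.
by rewrite [in LHS](Ad_diffE MG) linearB -(Ad_diffE MG).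
Qed.

Let moved N (x : X) : 'rV[R]_m := Ad MG (cocycle F phi N x) (M (F N%:R x)).

Lemma cocycle_continuous N : continuous (cocycle F phi N).
Proof.
elim: N => [|N IH]; first exact: cst_continuous.
have cphi : continuous phi by case: hphi.
have cFN : continuous (F N%:R) by exact: flow_continuous hF _.
move=> x; have c2 : (cocycle F phi N y, phi (F N%:R y)) @[y --> x] -->
    (cocycle F phi N x, phi (F N%:R x)).
  apply: cvg_pairT; first exact: IH.
  exact: (cvg_comp (F N%:R) phi (@cFN x) (@cphi _)).
exact: (cvg_comp _ _ c2 (@lie_mul_continuous _ _ _ _ hG _)).
Qed.

Let moved_continuous N : continuous (moved N).
Proof.
apply: (Ad_continuous2 hG); first exact: cocycle_continuous.
have cFN : continuous (F N%:R) by exact: flow_continuous hF _.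
by move=> x; exact: (cvg_comp (F N%:R) (M : X -> 'rV[R]_m) (@cFN x) (@cM _)).
Qed.

Let L2_moved N : L2 muX dot (moved N).
Proof. by apply: L2_continuous => j x; apply: cvg_coord; exact: moved_continuous. Qed.

Lemma average_coord_continuous N j : continuous (fun x => average F MG phi N x 0 j).
Proof.
move=> x; apply: cvg_coord; apply: (@cvgZ _ _ _ (nbhs x)); first exact: cvg_cst.
apply: (@cvg_big _ _ _ _ _ _ _ (nbhs x)) => [|i _]; first exact: add_continuous.
exact: (@moved_continuous i).
Qed.

(** Change variables by F N, which preserves the measure, then apply Ad to
    both sides of the scalar product, which preserves it, and recognise k by
    kernel_iterate. *)
Lemma moved_dot N k : K k -> L2_dot muX dot (moved N) k = L2_dot muX dot M k.
Proof.
move=> Kk; have [Lk Wk] := Kk; have [mk _] := Lk.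
have mF : measurable_fun setT (F N%:R : borel X -> borel X).
  by apply: borel_continuous; exact: flow_continuous hF _.
have mkF : measurable_row (fun x : borel X => k (F N%:R x)).
  by move=> j; exact: (measurableT_comp (mk j) mF).
have mMF : measurable_row (fun x : borel X => M (F N%:R x)).
  by move=> j; exact: (measurableT_comp (mM j) mF).
have mdk := measurable_dot dotC dotl mM mk.
have mdF := measurable_dot dotC dotl mMF mkF.
have mk' : {ae muX, forall x, dot (moved N x) (k x) = dot (M (F N%:R x)) (k (F N%:R x))}.
  apply: ae_imply (kernel_iterate N Kk) Wk => x kx _; rewrite -[in LHS]kx; exact: dot_Ad.
have mi := integrable_dot dotC dotl dot_gt0 (L2_moved N) Lk.
have iF : muX.-integrable setT (EFin \o ((fun x => dot (M x) (k x)) \o F N%:R)).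
  exact: integrable_ae_eq mk'.
rewrite /L2_dot (Rintegral_image mF _ mdk iF); last by move=> A mA; rewrite hFmu.
apply: Rintegral_ae => //.
by apply: measurable_dot => //; case: (L2_moved N).
Qed.

(** The constant M_star lies in the kernel because Ad fixes it. Against an
    element k of the kernel, M_phi and all its averages have the same scalar
    product; the averages tend to M_star uniformly, so M_star has that scalar
    product too. *)
Lemma is_orth_proj_M_star : is_orth_proj muX dot K M (fun=> Mstar).
Proof.
split.
  by split; [exact: L2_cst|apply: aeW => x; rewrite /W_phi Ad_M_star].
move=> k Kk; have [Lk Wk] := Kk; have [mk _] := Lk.
have I0 N : L2_dot muX dot (moved N) k = L2_dot muX dot M k.
  exact: moved_dot.
have LA N : L2 muX dot (moved N) := L2_moved N.
have avgE N : (0 < N)%N ->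
    L2_dot muX dot (average F MG phi N) k = L2_dot muX dot M k.
  move=> N0; have ii i := integrable_dot dotC dotl dot_gt0 (LA i) Lk.
  have [si se] := Rintegral_sum (index_iota 0 N) ii.
  transitivity (\int[muX]_x (N%:R^-1 * \sum_(0 <= i < N) dot (moved i x) (k x))).
    apply: eq_Rintegral => x _; rewrite (dotZl dotl) (dot_suml dotl) //.
  rewrite RintegralZl// se (eq_bigr (fun=> L2_dot muX dot M k)); last by move=> i _; exact: I0.
  by rewrite sumr_const_nat subn0 -(mulr_natl (L2_dot muX dot M k)) mulKf// pnatr_eq0 -lt0n.
have ci i := integrable_dot dotC dotl dot_gt0 (L2_cst (delta_mx 0 i)) Lk.
have cn i : muX.-integrable setT (EFin \o (fun x => `|dot (delta_mx 0 i) (k x)|)).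
  exact: integrable_norm (ci i).
have [Si _] := Rintegral_sum (index_enum 'I_m) cn.
set C := \int[muX]_x \sum_i `|dot (delta_mx 0 i) (k x)|.
have C0 : 0 <= C by apply: Rintegral_ge0 => x _; apply: sumr_ge0 => i _.
rewrite (L2_dotBl dotC dotl dot_gt0 L2_M (L2_cst _) Lk).
apply/eqP; rewrite -normr_le0; apply/ler_addgt0Pr => e e0; rewrite add0r.
(* C + 1 rather than C, which may vanish. *)
have e1 : 0 < e / (C + 1) by rewrite divr_gt0// ltr_wpDl.
have [N1 _ HN] := average_uniform hX hF hG hGc hphi hue e1.
have {HN} HN := HN N1.+1 (leqnSn _).
have LAv : L2 muX dot (average F MG phi N1.+1).
  apply: L2_continuous => j; exact: average_coord_continuous.
rewrite -(avgE N1.+1)// -(L2_dotBl dotC dotl dot_gt0 LAv (L2_cst _) Lk).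
have LB := L2B dotC dotl dot_gt0 LAv (L2_cst Mstar).
have Bi := integrable_dot dotC dotl dot_gt0 LB Lk.
rewrite /L2_dot; apply: (le_trans (le_normr_Rintegral measurableT Bi)).
apply: (@le_trans _ _ (\int[muX]_x (e / (C + 1) * \sum_i `|dot (delta_mx 0 i) (k x)|))).
  apply: le_Rintegral => //.
  - exact: integrable_norm.
  - by have := integrableZl measurableT (e / (C + 1)) Si; apply: eq_integrable.
  move=> x _; rewrite (dot_basisl dotl) mulr_sumr.
  apply: (le_trans (ler_norm_sum _ _ _)); apply: ler_sum => i _.
  rewrite normrM ler_wpM2r//; apply: le_trans (HN x); exact: row_coord_norm.
rewrite RintegralZl// -/C.
by rewrite -mulrA ler_piMr ?(ltW e0)// mulrC ler_pdivrMr ?mul1r ?lerDl ?ltr_wpDl//.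
Qed.

Lemma projection_M : {ae muX, forall x, P_phi MG muX dot F phi M x = Mstar}.
Proof.
apply: (orth_proj_ae dotC dotl dot_gt0); last exact: is_orth_proj_M_star.
- by move=> k [].
- exact: L2_M.
- exact: ker_sub.
Qed.

End projection.

(** * The theorem *)

Theorem lemma3p15 (R : realType)
  (X : ptopologicalType) (n : nat) (MX : smooth_manifold R X n)
  (hX : compact [set: X])
  (muX : probability (borel X) R)
  (F : R -> X -> X) (hF : C1_flow MX F)
  (hFmu : forall t, invariant_measure muX (F t))
  (G : ptopologicalGroupType) (m : nat) (MG : smooth_manifold R G m)
  (hG : lie_group MG) (hGc : compact [set: G])
  (muG : probability (borel G) R) (hmuG : normalised_haar muG)
  (dot : 'rV[R]_m -> 'rV[R]_m -> R)
  (hdot : Ad_invariant_scalar_product MG dot)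
  (d : nat) (rho : G -> 'M[R[i]]_d)
  (hrho : unitary_representation rho) (hirr : irreducible rho)
  (phi : X -> G) (hphi : Ck_map 1 (atlas MX) (atlas MG) phi)
  (hue : uniquely_ergodic (muX \x muG)%E (skew_product F phi)) :
  [/\ (fun N : nat => Linf_norm muX (fun x =>
         (N%:R)^-1 *: (\sum_(0 <= k < N) W_rep rho F phi k (M_rep rho F phi) x)
         - rep_differential rho MG (M_star MG muX muG F phi)))
        @ \oo --> 0%E,
      M_star MG muX muG F phi = P_Ad MG muG (vintegral muX (M_phi MG F phi)) &
      {ae muX, forall x,
        P_phi MG muX dot F phi (M_phi MG F phi) x = M_star MG muX muG F phi}].
Proof.
split.
- exact: (rep_average_cvg hX hF hG hGc hphi hue hmuG hrho).
- exact: (M_star_fubini hX muX hF hG hGc muG hphi).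
- exact: (projection_M hX hF hFmu hG hGc hmuG hdot hphi hue).
Qed.
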